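(* Let $\delta_{s,h}=\theta h$ with $\theta>0$, $h>0$, let $f\in L^2(Q)$, and let $u\in V^{\Delta_x}_{0,\underline{0}}$ be the solution of $\partial_t u-\Delta_x u=f$ in $Q$, $u=0$ on $\Sigma$, $u=0$ on $\Sigma_0$. Let $v\in V^{\nabla_x\partial_t}_{0,\underline{0}}$ and $\boldsymbol{y}\in H^{\mathrm{div}_x,1}(Q)$, and put $e:=u-v$, $\mathbf r_{\rm eq}:=f-\partial_t v+\mathrm{div}_x\boldsymbol y$, $\mathbf r_{\rm d}:=\boldsymbol y-\nabla_x v$. Then for all $\zeta\in[\tfrac12,+\infty)$, $\epsilon\in[1,+\infty)$ and $\beta_1,\beta_2>0$, $$(2-\tfrac1\zeta)\big(\|\nabla_x e\|_Q^2+\delta_{s,h}\|\partial_t e\|_Q^2\big)+\delta_{s,h}(1-\tfrac1\epsilon)\|\nabla_x e\|_{\Sigma_T}^2+\|e\|_{\Sigma_T}^2$$ $$\le\epsilon\,\delta_{s,h}\|\mathbf r_{\rm d}\|_{\Sigma_T}^2+\zeta\Big((1+\beta_1)\big((1+\beta_2)\|\mathbf r_{\rm d}\|_Q^2+(1+\tfrac1{\beta_2})C_{\rm F}^2\|\mathbf r_{\rm eq}\|_Q^2\big)+(1+\tfrac1{\beta_1})\delta_{s,h}^2\|\partial_t\mathbf r_{\rm d}\|_Q^2+\delta_{s,h}\|\mathbf r_{\rm eq}\|_Q^2\Big).$$ In particular, for $\zeta=1$ and $\epsilon=2$, $$\|\nabla_x e\|_Q^2+\delta_{s,h}\|\partial_t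 e\|_Q^2+\|e\|_{\Sigma_T}^2+\tfrac{\delta_{s,h}}2\|\nabla_x e\|_{\Sigma_T}^2$$ $$\le2\,\delta_{s,h}\|\mathbf r_{\rm d}\|_{\Sigma_T}^2+(1+\beta_1)\big((1+\beta_2)\|\mathbf r_{\rm d}\|_Q^2+(1+\tfrac1{\beta_2})C_{\rm F}^2\|\mathbf r_{\rm eq}\|_Q^2\big)+(1+\tfrac1{\beta_1})\delta_{s,h}^2\|\partial_t\mathbf r_{\rm d}\|_Q^2+\delta_{s,h}\|\mathbf r_{\rm eq}\|_Q^2,$$ and the optimal (i.e. right-hand side minimising) parameters $\beta_1,\beta_2>0$ in the last estimate are $$\beta_1^*=\frac{\delta_{s,h}\|\partial_t\mathbf r_{\rm d}\|_Q}{\sqrt{(1+\beta_2^* )\|\mathbf r_{\rm d}\|_Q^2+\big(1+\tfrac1{\beta_2^*}\big)C_{\rm F}^2\|\mathbf r_{\rm eq}\|_Q^2}},\qquad\beta_2^*=\frac{C_{\rm F}\|\mathbf r_{\rm eq}\|_Q}{\|\mathbf r_{\rm d}\|_Q},$$ whenever these are well-defined positive numbers.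
   Context: $\Omega\subset\mathbb R^d$, $d\in\{1,2,3\}$, is a bounded Lipschitz domain, $0<T<+\infty$, $Q:=\Omega\times(0,T)$, $\Sigma:=\partial\Omega\times(0,T)$, $\Sigma_0:=\Omega\times\{0\}$, $\Sigma_T:=\Omega\times\{T\}$. $\nabla_x$, $\mathrm{div}_x$, $\Delta_x$ are the gradient, divergence and Laplacian in the spatial variables, and $\partial_t$ is the time derivative. $\|\cdot\|_Q$ and $\|\cdot\|_{\Sigma_T}$ are the $L^2(Q)$ and $L^2(\Sigma_T)$ norms (also for vector-valued functions). $H^1_0(Q):=\{u\in H^1(Q): u=0\text{ on }\Sigma\}$, $V^{\Delta_x}_{0,\underline 0}:=\{u\in H^1_0(Q): \Delta_x u\in L^2(Q),\ u=0\text{ on }\Sigma_0\}$, $V^{\nabla_x\partial_t}_{0,\underline 0}:=\{w\in V^{\Delta_x}_{0,\underline 0}:\nabla_x\partial_t w\in [L^2(Q)]^d\}$. $H^{\mathrm{div}_x,1}(Q):=\{\boldsymbol y\in[L^2(Q)]^d:\mathrm{div}_x\boldsymbol y\in L^2(Q),\ \partial_t\boldsymbol y\in[L^2(Q)]^d\}$. $C_{\rm F}>0$ is the constant in the Friedrichs inequality $\|w\|_Q\le C_{\rm F}\|\nabla_x w\|_Q$ for all $w\in L^2(Q)$ with $\nabla_x w\in[L^2(Q)]^d$ and $w=0$ on $\Sigma$. The parameter $\delta_{s,h}=\theta h$ is a positive number, where $\theta$ is a positive constant and $h$ is the (global) mesh size of a discretisation; only its positivity matters here. For $w\in V^{\Delta_x}_{0,\underline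 0}$ the map $t\mapsto w(\cdot,t)$ is continuous with values in $H^1_0(\Omega)$, so $\|\nabla_x w\|_{\Sigma_T}$ is meaningful. For $f\in L^2(Q)$ and zero initial data the problem is uniquely solvable in $V^{\Delta_x}_{0,\underline 0}$. *)

(* Defs.v *)
From HB Require Import structures.
From mathcomp Require Import all_boot all_order all_algebra.
From mathcomp Require Import all_classical all_reals all_analysis.

Set Implicit Arguments.
Unset Strict Implicit.
Unset Printing Implicit Defensive.

Import Order.TTheory GRing.Theory Num.Theory.
Import numFieldNormedType.Exports.

Local Open Scope classical_set_scope.
Local Open Scope ring_scope.

Definition measure_rV_display : measure_display. Proof. exact. Qed.

(* The Borel sigma-algebra of R^d, generated by the coordinates. *)
Section measurable_rV.
Context {R : realType}.
Variable d : nat.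

Let coors : 'I_d -> 'rV[R]_d -> measurableTypeR R := fun i x => x 0 i.

Let rV_set0 : g_sigma_preimage coors set0.
Proof. exact: sigma_algebra0. Qed.

Let rV_setC A : g_sigma_preimage coors A -> g_sigma_preimage coors (~` A).
Proof. exact: sigma_algebraC. Qed.

Let rV_bigcup (F : _^nat) : (forall i, g_sigma_preimage coors (F i)) ->
  g_sigma_preimage coors (\bigcup_i (F i)).
Proof. exact: sigma_algebra_bigcup. Qed.

HB.instance Definition _ := @isMeasurable.Build measure_rV_display
  'rV[R]_d (g_sigma_preimage coors) rV_set0 rV_setC rV_bigcup.

End measurable_rV.

Lemma measurable_coord {R : realType} d (i : 'I_d) :
  measurable_fun [set: 'rV[R]_d] (fun x => x 0 i : measurableTypeR R).
Proof.
move=> _ Y mY; rewrite setTI; apply: sub_sigma_algebra => /=.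
rewrite -bigcup_seq/=; exists i => /=; first by rewrite mem_index_enum.
by exists Y => //; rewrite setTI.
Qed.

Lemma measurable_fun_rVP d' (T : measurableType d') {R : realType} d
    (f : T -> 'rV[R]_d) :
  (forall i, measurable_fun setT (fun x => f x 0 i : measurableTypeR R)) ->
  measurable_fun setT f.
Proof.
move=> mf; move=> _ Y mY; rewrite setTI.
pose S : set (set 'rV[R]_d) := [set A | measurable (f @^-1` A)].
suff: (measurable : set (set 'rV[R]_d)) `<=` S by apply.
apply: smallest_sub.
  split => [|A mA|F mF].
  - by rewrite /S /= preimage_set0.
  - by rewrite /S /= setTD preimage_setC; exact: measurableC.
  - by rewrite /S /= preimage_bigcup; exact: bigcupT_measurable.
rewrite -bigcup_seq => A [i _] /= [B mB <-].
rewrite /S /= setTI.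
by have := mf i measurableT B mB; rewrite setTI.
Qed.

Definition rV_cons {R : realType} (d : nat)
    (p : 'rV[R]_d * measurableTypeR R) : 'rV[R]_d.+1 :=
  row_mx (\row_(_ < 1) (p.2 : R)) p.1.

Lemma rV_cons_head {R : realType} (d : nat) (x : 'rV[R]_d)
    (t : measurableTypeR R) : rV_cons (x, t) 0 (lshift d ord0 : 'I_(1 + d)) = t.
Proof. by apply: (etrans (row_mxEl _ _ _ _)); rewrite mxE. Qed.

Lemma rV_cons_tail {R : realType} (d : nat) (x : 'rV[R]_d)
    (t : measurableTypeR R) (i : 'I_d) :
  rV_cons (x, t) 0 (rshift 1 i : 'I_(1 + d)) = x 0 i.
Proof. exact: (etrans (row_mxEr _ _ _ _)). Qed.

Lemma measurable_rV_cons {R : realType} (d : nat) :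
  measurable_fun [set: 'rV[R]_d * measurableTypeR R] (@rV_cons R d).
Proof.
apply: measurable_fun_rVP => i.
case: (split_ordP (i : 'I_(1 + d))) => j ->.
  rewrite (_ : (fun _ => _) = snd) //.
  by apply/funext => -[x t]; rewrite (ord1 j) rV_cons_head.
rewrite (_ : (fun _ => _) =
    (fun x : 'rV[R]_d => x 0 j : measurableTypeR R) \o fst).
  by apply: measurableT_comp => //; exact: measurable_coord.
by apply/funext => -[x t]; rewrite rV_cons_tail.
Qed.

(* Lebesgue measure on R^d restricted to the Borel sets, as an iterated
   product; see [leb_box]. *)
Fixpoint leb {R : realType} (d : nat) : {measure set 'rV[R]_d -> \bar R} :=
  match d with
  | 0 => \d_ (0 : 'rV[R]_0)
  | n.+1 => measure_function_pushforward__canonical__measure_function_Measure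
     (leb n \x lebesgue_measure)%E (@measurable_rV_cons R n)
  end.

Lemma leb_box {R : realType} (d : nat) (a b : 'rV[R]_d) :
  (forall i, a 0 i <= b 0 i) ->
  leb d [set x : 'rV[R]_d | forall i, a 0 i < x 0 i <= b 0 i] =
  (\prod_i (b 0 i - a 0 i))%:E.
Proof.
elim: d => [|d IH] in a b *.
  move=> _; rewrite big_ord0 /= diracE mem_set//= => -[] //.
move=> ab.
pose i0 : 'I_(1 + d) := lshift d ord0.
pose a' : 'rV[R]_d := \row_j a 0 (rshift 1 j).
pose b' : 'rV[R]_d := \row_j b 0 (rshift 1 j).
have mbox : measurable [set x : 'rV[R]_d | forall i, a' 0 i < x 0 i <= b' 0 i].
  rewrite (_ : mkset _ = \bigcap_(i in [set: 'I_d])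
    ((fun x : 'rV[R]_d => x 0 i) @^-1` `]a' 0 i, b' 0 i])).
    apply: fin_bigcap_measurable => // i _.
    have := @measurable_coord R d i measurableT [set` `]a' 0 i, b' 0 i]].
    by rewrite setTI; apply; exact: measurable_itv.
  apply/seteqP; split => x /= H i; last by have := H i I; rewrite /= in_itv.
  by move=> _; rewrite /= in_itv /=; exact: H.
rewrite /= /pushforward.
rewrite (_ : _ @^-1` _ =
  [set x : 'rV[R]_d | forall i, a' 0 i < x 0 i <= b' 0 i] `*`
  `]a 0 i0, b 0 i0]).
  rewrite product_measure1E; [|exact: mbox|exact: measurable_itv].
  rewrite IH; last by move=> i; rewrite !mxE.
  have mI : lebesgue_measure [set` `]a 0 i0, b 0 i0]] = (b 0 i0 - a 0 i0)%:E.
    rewrite lebesgue_measure_itv /= lte_fin; case: ltP => //= ba.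
    by have := ab i0; rewrite le_eqVlt ltNge ba orbF => /eqP ->; rewrite subrr.
  have -> : \prod_i (b 0 i - a 0 i) =
     (b 0 i0 - a 0 i0) * \prod_i (b' 0 i - a' 0 i).
    rewrite big_ord_recl; congr (_ * _).
      by rewrite (_ : ord0 = i0)//; exact/val_inj.
    apply: eq_bigr => i _; rewrite !mxE.
    by rewrite (_ : lift ord0 i = rshift 1 i)//; exact/val_inj.
  by rewrite mulrC EFinM; congr (_ * _)%E; exact: mI.
apply/seteqP; split => -[x t] /=.
- move=> H; split; last by have := H i0; rewrite rV_cons_head in_itv.
  by move=> i; have := H (rshift 1 i); rewrite rV_cons_tail !mxE.
- rewrite in_itv /= => -[H1 H2] i.
  case: (split_ordP (i : 'I_(1 + d))) => j ->.
    by rewrite (ord1 j) rV_cons_head.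
  by rewrite rV_cons_tail; have := H1 j; rewrite !mxE.
Qed.

Section function_spaces.
Context {R : realType}.

Definition L2 dm (X : measurableType dm) (mu : {measure set X -> \bar R})
    (D : set X) (f : X -> R) : Prop :=
  measurable_fun D f /\ mu.-integrable D (fun x => (f x ^+ 2)%:E).

Definition L2norm dm (X : measurableType dm) (mu : {measure set X -> \bar R})
    (D : set X) (f : X -> R) : R :=
  Num.sqrt (\int[mu]_(x in D) (f x ^+ 2)).

(* The same for fields, with the Euclidean norm on R^d (the norm of the
   library on row vectors is the maximum norm). *)
Definition L2v dm (X : measurableType dm) (mu : {measure set X -> \bar R})
    (D : set X) d (F : X -> 'rV[R]_d) : Prop :=
  forall i, L2 mu D (fun x => F x 0 i).

Definition L2vnorm dm (X : measurableType dm) (mu : {measure set X -> \bar R})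
    (D : set X) d (F : X -> 'rV[R]_d) : R :=
  Num.sqrt (\int[mu]_(x in D) (\sum_i F x 0 i ^+ 2)).

(* All iterated directional derivatives exist and are continuous. *)
Definition smooth (V : normedModType R) (phi : V -> R) : Prop :=
  forall s : seq V, let psi := foldr (fun h g => 'D_h g) phi s in
  continuous psi /\ forall x h, derivable psi x h.

Definition test_function (V : normedModType R) (D : set V) (phi : V -> R) :=
  smooth phi /\
  exists2 K, compact K & K `<=` D /\ forall x, ~ K x -> phi x = 0.

(* Near each boundary point, after an orthogonal change of coordinates, the set
   is the part lying above the graph of a Lipschitz function of the other
   coordinates ([gamma] is constant when d = 1). *)
Definition lipschitz_boundary d (Om : set 'rV[R]_d) : Prop :=
  forall x, (closure Om `\` Om) x ->
  exists (O : 'M[R]_d) (k : 'I_d) (gamma : 'rV[R]_d.-1 -> R) (r : R),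
    [/\ O *m O^T = 1%:M, lipschitz gamma, 0 < r &
        forall y, ball x r y ->
          (Om y <-> gamma (col' k (y *m O)) < (y *m O) 0 k)].

Definition bounded_lipschitz_domain d (Om : set 'rV[R]_d) : Prop :=
  [/\ open Om, connected Om, Om !=set0, bounded_set Om &
      lipschitz_boundary Om].

End function_spaces.

(* Space-time is 'rV[R]_d * R with generic point z = (x, t). Functions on Q,
   Omega are represented by total functions, considered only on Q, Omega. The
   operators below that depend on the choice of a representative (weak
   derivatives, traces) are determined up to a null set when they exist, and
   are zero by convention otherwise. *)
Section space_time.
Context {R : realType} {d : nat}.
Variables (Om : set 'rV[R]_d) (T : R).

Local Notation ST := ('rV[R]_d * measurableTypeR R)%type.
Implicit Types (w g phi : ST -> R) (y : ST -> 'rV[R]_d).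

Definition leb_st : {measure set ST -> \bar R} :=
  (leb d \x lebesgue_measure)%E.

Definition cylinder : set ST := Om `*` `]0, T[.

Definition lateral : set ST := (closure Om `\` Om) `*` `]0, T[.

Definition L2Q w : Prop := L2 leb_st cylinder w.
Definition L2vQ y : Prop := L2v leb_st cylinder y.
Definition normQ w : R := L2norm leb_st cylinder w.
Definition vnormQ y : R := L2vnorm leb_st cylinder y.

Definition e_x (i : 'I_d) : 'rV[R]_d * R := (delta_mx 0 i, 0).
Definition e_t : 'rV[R]_d * R := (0, 1).

Definition is_wderiv (h : 'rV[R]_d * R) w g : Prop :=
  L2Q g /\ forall phi, test_function cylinder phi ->
    \int[leb_st]_(z in cylinder) (w z * 'D_h phi z) =
    - \int[leb_st]_(z in cylinder) (g z * phi z).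

Definition has_wderiv h w : Prop := exists g, is_wderiv h w g.

Definition wderiv h w : ST -> R := xget (cst 0) [set g | is_wderiv h w g].

Definition dt w : ST -> R := wderiv e_t w.

Definition vdt y : ST -> 'rV[R]_d :=
  fun z => \row_i dt (fun z' => y z' 0 i) z.

Definition grad_x w : ST -> 'rV[R]_d := fun z => \row_i wderiv (e_x i) w z.

Definition has_grad_x w : Prop := forall i, has_wderiv (e_x i) w.

Definition is_wdiv_x y g : Prop :=
  L2Q g /\ forall phi, test_function cylinder phi ->
    \int[leb_st]_(z in cylinder) (\sum_i y z 0 i * 'D_(e_x i) phi z) =
    - \int[leb_st]_(z in cylinder) (g z * phi z).

Definition has_wdiv_x y : Prop := exists g, is_wdiv_x y g.

Definition div_x y : ST -> R := xget (cst 0) [set g | is_wdiv_x y g].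

Definition lap_x w : ST -> R := div_x (grad_x w).

(* Zero trace on the lateral boundary, for w with w and grad_x w in L^2(Q):
   w is a limit of smooth functions that vanish near the lateral boundary, in
   the norm of L^2(0, T; H^1(Omega)). This is the norm for which the trace is
   continuous, so no time derivative of w is involved. *)
Definition zero_on_lateral w : Prop :=
  forall eps : R, 0 < eps -> exists phi : 'rV[R]_d * R -> R,
    [/\ smooth phi,
        exists2 U, open U & lateral `<=` U /\ forall z, U z -> phi z = 0,
        normQ (w \- phi) < eps &
        vnormQ (fun z => grad_x w z - \row_i 'D_(e_x i) phi z) < eps].

(* g is the value at time s of the representative of w in C([0, T]; L^2(Omega)).
   By the embedding of H^1(0, T; L^2(Omega)) in this space, it is the trace of w
   on Omega * {s} whenever w and dt w are in L^2(Q). *)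
Definition is_time_trace (s : R) w (g : 'rV[R]_d -> R) : Prop :=
  exists W : R -> 'rV[R]_d -> R,
    [/\ forall t, 0 <= t <= T -> L2 (leb d) Om (W t),
        forall t0, 0 <= t0 <= T ->
          L2norm (leb d) Om (W t \- W t0) @[t --> within `[0, T] (nbhs t0)] --> 0,
        {ae lebesgue_measure, forall t, 0 < t < T ->
          {ae leb d, forall x, Om x -> w (x, t) = W t x}} &
        g = W s].

Definition time_trace (s : R) w : 'rV[R]_d -> R :=
  xget (cst 0) [set g | is_time_trace s w g].

Definition norm_end w : R := L2norm (leb d) Om (time_trace T w).

Definition vnorm_end y : R :=
  L2vnorm (leb d) Om (fun x => \row_i time_trace T (fun z => y z 0 i) x).

Definition H1 w : Prop := [/\ L2Q w, has_grad_x w & has_wderiv e_t w].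

Definition H1_0 w : Prop := H1 w /\ zero_on_lateral w.

Definition V_Delta w : Prop :=
  [/\ H1_0 w, has_wdiv_x (grad_x w) & is_time_trace 0 w (cst 0)].

Definition V_grad_dt w : Prop := V_Delta w /\ has_grad_x (dt w).

Definition H_div_x_1 y : Prop :=
  [/\ L2vQ y, has_wdiv_x y & forall i, has_wderiv e_t (fun z => y z 0 i)].

Definition friedrichs_constant (C : R) : Prop :=
  0 < C /\
  forall w, L2Q w -> has_grad_x w -> zero_on_lateral w ->
    normQ w <= C * vnormQ (grad_x w).

(* The equation holds almost everywhere since both sides are in L^2(Q); the
   boundary and initial conditions are part of [V_Delta]. *)
Definition heat_solution (f u : ST -> R) : Prop :=
  V_Delta u /\
  {ae leb_st, forall z, cylinder z -> dt u z - lap_x u z = f z}.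

End space_time.

(* Main.v *)
Require Import Defs.
From HB Require Import structures.
From mathcomp Require Import all_boot all_order all_algebra.
From mathcomp Require Import all_classical all_reals all_analysis.
From mathcomp Require Import measurable_realfun.
From mathcomp Require Import ring lra.

Set Implicit Arguments.
Unset Strict Implicit.
Unset Printing Implicit Defensive.

Import Order.TTheory GRing.Theory Num.Theory.
Import numFieldNormedType.Exports.

Local Open Scope classical_set_scope.
Local Open Scope ring_scope.

(** The field [p = y - grad_x u = r_d - grad_x e] has the weak divergence
    [kappa = r_eq - dt e], because [u] solves the heat equation. The proof
    tests this relation with [e] and with [e] shifted backwards in time.

    Testing with [e] itself, which vanishes on the lateral boundary ([green]),
    expresses the squared norm of [grad_x e] as the sum of the integrals of
    [r_d * grad_x e], [r_eq * e] and [- e * dt e] ([gradient_identity]). As [e]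
    vanishes at time 0, the integral of [e * dt e] bounds half the squared norm
    of the trace of [e] at time [T] ([final_energy]).

    The terms with [dt e] and with the trace of [grad_x e] come, formally, from
    testing with [dt e]. The regularity of [u] does not allow that: [dt e] need
    not have a gradient. Instead the relation tested with [e] shifted by a small
    time is subtracted from the unshifted one, and the difference is divided by
    the shift. Three things happen in the limit.
    - Difference quotients of [e] are averages of [dt e] over short times and
      converge weakly to it ([diffq_cvg_weak]).
    - For [q = grad_x e] and its shift [q'], the inequality
      [2 q (q - q') >= q^2 - q'^2] leaves half the mean energy of [q] over the
      last times ([shift_square]), which dominates that of its trace at time [T]
      in the limit ([time_trace_late]).
    - In the product of [r_d] with [q - q'] the difference moves to [r_d], which
      has the weak time derivative [dt r_d] as [grad_x (dt v)] is square
      integrable; this leaves a boundary term at time [T] ([shift_product]),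
      which Young's inequality with the parameter [eps] separates
      ([shifted_energy], [energy_at_end], [final_gradient_energy]).

    Friedrichs' inequality, the Cauchy-Schwarz inequality ([error_energy]) and
    Young's inequality with [zeta], [beta1], [beta2] then give the majorant
    ([error_majorant]). The optimal parameters are read off by completing
    squares: with the three norms [a], [b], [c] in question, the majorant is a
    constant plus [(a + b + c) ^+ 2] plus two weighted squares that vanish
    exactly there ([majorant_excess]).

    These arguments rest on the description of functions with a weak derivative
    in time: such a function is, almost everywhere, a function of [x] plus the
    primitive of its derivative ([time_representation]), hence continuous in
    time with values in L^2, which determines its traces. This follows from the
    fundamental lemma of the calculus of variations, proved with products of
    bumps of one variable ([fundamental_lemma], [constant_in_time]). *)

(** * Square-integrable functions *)
Section L2_theory.
Context {R : realType} dm (X : measurableType dm).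
Variables (mu : {measure set X -> \bar R}) (D : set X).
Hypothesis mD : measurable D.
Implicit Types f g : X -> R.

Lemma le_integrable_EFin f g : measurable_fun D f ->
  mu.-integrable D (EFin \o g) -> (forall x, D x -> `|f x| <= g x) ->
  mu.-integrable D (EFin \o f).
Proof.
move=> mf ig fg; apply: (le_integrable mD _ _ ig).
  exact/measurable_EFinP.
by move=> x Dx /=; rewrite lee_fin (le_trans (fg x Dx))// ler_norm.
Qed.

Lemma integrableD_EFin f g : mu.-integrable D (EFin \o f) ->
  mu.-integrable D (EFin \o g) -> mu.-integrable D (EFin \o (f \+ g)).
Proof.
by move=> fi gi; apply: (eq_integrable mD _ _ _ (integrableD mD fi gi)) => x _ /=;
  rewrite EFinD.
Qed.

Lemma integrableB_EFin f g : mu.-integrable D (EFin \o f) ->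
  mu.-integrable D (EFin \o g) -> mu.-integrable D (EFin \o (f \- g)).
Proof.
by move=> fi gi; apply: (eq_integrable mD _ _ _ (integrableB mD fi gi)) => x _ /=;
  rewrite EFinB.
Qed.

Lemma integrableZ_EFin (k : R) f : mu.-integrable D (EFin \o f) ->
  mu.-integrable D (EFin \o (fun x => k * f x)).
Proof.
by move=> fi; apply: (eq_integrable mD _ _ _ (integrableZl mD k fi)) => x _ /=;
  rewrite EFinM.
Qed.

Lemma L2_measurable f : L2 mu D f -> measurable_fun D f. Proof. by case. Qed.

Lemma L2_sqr f : L2 mu D f -> mu.-integrable D (EFin \o (fun x => f x ^+ 2)).
Proof. by case. Qed.

Lemma L2M f g : L2 mu D f -> L2 mu D g ->
  mu.-integrable D (EFin \o (fun x => f x * g x)).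
Proof.
move=> [mf f2] [mg g2].
apply: (le_integrable_EFin _ (integrableD_EFin f2 g2)).
  exact: measurable_funM.
move=> x _ /=; rewrite normrM -(real_normK (num_real (f x))).
rewrite -(real_normK (num_real (g x))); set a := `|_|; set b := `|_|.
by have := sqr_ge0 (a - b); have := sqr_ge0 (a + b); nra.
Qed.

Lemma L2_le f g : measurable_fun D f -> L2 mu D g ->
  (forall x, D x -> `|f x| <= `|g x|) -> L2 mu D f.
Proof.
move=> mf [mg g2] fg; split=> //; apply: (le_integrable_EFin _ g2).
  exact: measurable_funX.
move=> x Dx /=; rewrite ger0_norm ?sqr_ge0// -(real_normK (num_real (f x))).
by rewrite -(real_normK (num_real (g x))) lerXn2r ?nnegrE//; exact: fg.
Qed.

Lemma L2D f g : L2 mu D f -> L2 mu D g -> L2 mu D (f \+ g).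
Proof.
move=> f2 g2; split; first by case: f2; case: g2 => *; exact: measurable_funD.
have fi := L2_sqr f2; have gi := L2_sqr g2.
apply: (le_integrable_EFin _ (integrableZ_EFin 2 (integrableD_EFin fi gi))).
  apply: measurable_funX; apply: measurable_funD; [exact: L2_measurable f2|].
  exact: L2_measurable g2.
move=> x _ /=; rewrite ger0_norm ?sqr_ge0//.
by have := sqr_ge0 (f x - g x); nra.
Qed.

Lemma L2Z (k : R) f : L2 mu D f -> L2 mu D (fun x => k * f x).
Proof.
move=> [mf f2]; split; first exact: measurable_funM.
apply: (eq_integrable mD _ _ _ (integrableZ_EFin (k ^+ 2) f2)) => x _ /=.
by rewrite exprMn.
Qed.

Lemma L2B f g : L2 mu D f -> L2 mu D g -> L2 mu D (f \- g).
Proof.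
move=> f2 g2; have := L2D f2 (L2Z (-1) g2).
by rewrite (_ : _ \+ _ = f \- g)//; apply/funext => x /=; rewrite mulN1r.
Qed.

Lemma L2N f : L2 mu D f -> L2 mu D (\- f).
Proof.
move=> /(L2Z (-1)); rewrite (_ : (fun x => -1 * f x) = \- f)//.
by apply/funext => x /=; rewrite mulN1r.
Qed.

Lemma L2_bounded f M : (mu D < +oo)%E -> measurable_fun D f ->
  (forall x, D x -> `|f x| <= M) -> L2 mu D f.
Proof.
move=> muD mf fM; split=> //.
have iM : mu.-integrable D (EFin \o cst (M ^+ 2)).
  apply/integrableP; split; first exact/measurable_EFinP.
  under eq_integral do rewrite /= ger0_norm ?sqr_ge0//.
  by rewrite integral_cst//= lte_mul_pinfty// lee_fin sqr_ge0.
apply: (le_integrable_EFin _ iM); first exact: measurable_funX.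
move=> x Dx /=; rewrite ger0_norm ?sqr_ge0//.
rewrite -(real_normK (num_real (f x))) lerXn2r ?nnegrE//; last exact: fM.
by rewrite (le_trans _ (fM x Dx)).
Qed.

Lemma L2_cst k : (mu D < +oo)%E -> L2 mu D (cst k).
Proof. by move=> muD; apply: (@L2_bounded _ `|k|). Qed.

Lemma L2_integrable f : (mu D < +oo)%E -> L2 mu D f ->
  mu.-integrable D (EFin \o f).
Proof.
move=> muD f2; apply: (eq_integrable mD _ _ _ (L2M f2 (L2_cst 1 muD))) => x _ /=.
by rewrite mulr1.
Qed.

Lemma Rintegral_sum (I : Type) (s : seq I) (F : I -> X -> R) :
  (forall i, mu.-integrable D (EFin \o F i)) ->
  mu.-integrable D (EFin \o (fun x => \sum_(i <- s) F i x)) /\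
  \int[mu]_(x in D) (\sum_(i <- s) F i x) = \sum_(i <- s) \int[mu]_(x in D) F i x.
Proof.
move=> Fi; elim: s => [|i s [IH1 IH2]].
  rewrite (_ : (fun x => _) = cst 0); last by apply/funext => x; rewrite big_nil.
  by split; [exact: integrable0|rewrite big_nil Rintegral_cst// mul0r].
rewrite (_ : (fun x => _) = F i \+ (fun x => \sum_(j <- s) F j x)); last first.
  by apply/funext => x; rewrite big_cons.
split; first exact: integrableD_EFin.
by rewrite big_cons -IH2 -RintegralD.
Qed.

Lemma L2norm_sqr f : L2norm mu D f ^+ 2 = \int[mu]_(x in D) (f x ^+ 2).
Proof.
by rewrite sqr_sqrtr//; apply: Rintegral_ge0 => x _; exact: sqr_ge0.
Qed.

Lemma L2vnorm_sqr k (F : X -> 'rV[R]_k) : L2v mu D F ->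
  L2vnorm mu D F ^+ 2 = \sum_i \int[mu]_(x in D) (F x 0 i ^+ 2).
Proof.
move=> F2; rewrite sqr_sqrtr; last first.
  by apply: Rintegral_ge0 => x _; apply: sumr_ge0 => i _; exact: sqr_ge0.
by rewrite (Rintegral_sum _ (fun i => L2_sqr (F2 i))).2.
Qed.

Lemma Rintegral_youngM (l : R) f g : 0 < l -> L2 mu D f -> L2 mu D g ->
  2 * \int[mu]_(x in D) (f x * g x) <=
  l * \int[mu]_(x in D) (f x ^+ 2) + l^-1 * \int[mu]_(x in D) (g x ^+ 2).
Proof.
move=> l0 f2 g2; have fg := L2M f2 g2.
have fi := L2_sqr f2; have gi := L2_sqr g2.
rewrite -!RintegralZl// -RintegralD//; [|exact: integrableZ_EFin..].
apply: le_Rintegral => //; first exact: integrableZ_EFin.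
  by apply: integrableD_EFin; exact: integrableZ_EFin.
move=> x _; rewrite -subr_ge0.
have -> : l * f x ^+ 2 + l^-1 * g x ^+ 2 - 2 * (f x * g x) =
  l^-1 * (l * f x - g x) ^+ 2 by field; rewrite gt_eqF.
by rewrite mulr_ge0 ?sqr_ge0// invr_ge0 ltW.
Qed.

(** The parametrised forms of the Cauchy-Schwarz inequality add up over the
    components of a field. The best parameter is [b / a]; when [a] or [b]
    vanishes, a parameter that tends to infinity or to zero takes its place. *)
Lemma young_to_cauchy (a b c : R) : 0 <= a -> 0 <= b ->
  (forall l, 0 < l -> 2 * c <= l * a ^+ 2 + l^-1 * b ^+ 2) -> c <= a * b.
Proof.
move=> a0 b0 H; apply/ler_addgt0Pr => e e0.
have [ab|] := ltP 0 (a * b).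
  have /andP[a1 b1] : (0 < a) && (0 < b).
    by rewrite !lt_def a0 b0 !andbT; apply/andP; split; apply: contraTneq ab =>
      ->; rewrite ?mul0r ?mulr0 ltxx.
  have := H (b / a) (divr_gt0 b1 a1).
  have -> : b / a * a ^+ 2 + (b / a)^-1 * b ^+ 2 = 2 * (a * b).
    by field; rewrite !gt_eqF.
  by rewrite ler_pM2l// => ?; lra.
move=> ab; have {ab} : a * b = 0 by apply/le_anti; rewrite ab mulr_ge0.
move=> /[dup] + ->; rewrite add0r => /eqP; rewrite mulf_eq0 => /orP[]/eqP z.
  (* with [a = 0] this parameter makes the right-hand side at most [e] *)
  rewrite z in H; have k0 : 0 < (b ^+ 2 + 1) / e.
    by rewrite divr_gt0// ltr_wpDl ?sqr_ge0.
  have := H _ k0; rewrite expr0n/= mulr0 add0r invf_div => {}H.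
  have : e / (b ^+ 2 + 1) * b ^+ 2 <= e.
    rewrite mulrAC ler_pdivrMr ?ltr_wpDl ?sqr_ge0// ler_pM2l// lerDl//.
  lra.
rewrite z in H; have k0 : 0 < e / (a ^+ 2 + 1).
  by rewrite divr_gt0// ltr_wpDl ?sqr_ge0.
have := H _ k0; rewrite expr0n/= mulr0 addr0 => {}H.
have : e / (a ^+ 2 + 1) * a ^+ 2 <= e.
  rewrite mulrAC ler_pdivrMr ?ltr_wpDl ?sqr_ge0// ler_pM2l// lerDl//.
lra.
Qed.

Lemma cauchy_schwarz f g : L2 mu D f -> L2 mu D g ->
  \int[mu]_(x in D) (f x * g x) <= L2norm mu D f * L2norm mu D g.
Proof.
move=> f2 g2; apply: young_to_cauchy; rewrite ?sqrtr_ge0// => l l0.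
by rewrite !L2norm_sqr; exact: Rintegral_youngM.
Qed.

Lemma L2normN f : L2norm mu D (\- f) = L2norm mu D f.
Proof.
by rewrite /L2norm; congr Num.sqrt; apply: eq_Rintegral => x _ /=; rewrite sqrrN.
Qed.

Lemma cauchy_schwarz_norm f g : L2 mu D f -> L2 mu D g ->
  `|\int[mu]_(x in D) (f x * g x)| <= L2norm mu D f * L2norm mu D g.
Proof.
move=> f2 g2; rewrite ler_norml cauchy_schwarz// andbT lerNl.
rewrite -(L2normN f).
apply: le_trans (cauchy_schwarz (L2N f2) g2).
rewrite -[leLHS]mulN1r -RintegralZl//; last exact: L2M.
by under [leRHS]eq_Rintegral do rewrite mulNr -mulN1r.
Qed.

Lemma cauchy_schwarzv k (F G : X -> 'rV[R]_k) : L2v mu D F -> L2v mu D G ->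
  \sum_i \int[mu]_(x in D) (F x 0 i * G x 0 i) <= L2vnorm mu D F * L2vnorm mu D G.
Proof.
move=> F2 G2; apply: young_to_cauchy; rewrite ?sqrtr_ge0// => l l0.
rewrite !L2vnorm_sqr// !mulr_sumr -big_split/=; apply: ler_sum => i _.
exact: Rintegral_youngM.
Qed.

Lemma L2norm0_ae f : L2 mu D f -> L2norm mu D f = 0 ->
  {ae mu, forall x, D x -> f x = 0}.
Proof.
move=> f2 f0; have : \int[mu]_(x in D) (f x ^+ 2) = 0.
  by rewrite -L2norm_sqr f0 expr0n.
move=> i0; have fi := L2_sqr f2.
have : (\int[mu]_(x in D) `|((f x ^+ 2)%R)%:E| = 0)%E.
  transitivity ((\int[mu]_(x in D) (f x ^+ 2))%:E); last by rewrite i0.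
  rewrite /Rintegral fineK; last exact: integrable_fin_num.
  by apply: eq_integral => x _ /=; rewrite ger0_norm// sqr_ge0.
move/(ae_eq_integral_abs mu mD (measurable_int _ fi)).
apply: filterS => x /= H Dx; have := H Dx => -[] /eqP.
by rewrite sqrf_eq0 => /eqP.
Qed.

Lemma ae_eq_L2 f g : measurable_fun D g -> {ae mu, forall x, D x -> f x = g x} ->
  L2 mu D f -> L2 mu D g.
Proof.
move=> mg fg [mf f2]; split=> //; have mg2 := measurable_funX 2 mg.
have mf2 := measurable_funX 2 mf.
apply/integrableP; split; first exact/measurable_EFinP.
case/integrableP : f2 => _; rewrite (ae_eq_integral (abse \o EFin \o (fun x => g x ^+ 2)))//.
- by apply: measurableT_comp => //; exact/measurable_EFinP.
- by do 2 apply: measurableT_comp => //.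
- by apply: filterS fg => x + Dx => /(_ Dx) /= ->.
Qed.

Lemma ae_eq_Rintegral f g : measurable_fun D f -> measurable_fun D g ->
  {ae mu, forall x, D x -> f x = g x} ->
  \int[mu]_(x in D) f x = \int[mu]_(x in D) g x.
Proof.
move=> mf mg fg; congr fine; apply: ae_eq_integral => //; try exact/measurable_EFinP.
by apply: filterS fg => x + Dx => /(_ Dx) ->.
Qed.

Lemma ae_imp (P Q : X -> Prop) : (forall x, P x -> Q x) ->
  {ae mu, forall x, P x} -> {ae mu, forall x, Q x}.
Proof. by move=> PQ; apply: filterS. Qed.

Lemma ae_imp2 (P Q S : X -> Prop) : (forall x, P x -> Q x -> S x) ->
  {ae mu, forall x, P x} -> {ae mu, forall x, Q x} -> {ae mu, forall x, S x}.
Proof. by move=> PQ; apply: filterS2. Qed.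

End L2_theory.

(** * Primitives in one variable *)
Section primitive.
Context {R : realType}.
Local Notation mu := (@lebesgue_measure R).
Implicit Types f : R -> R.

(** The base point minus infinity makes the primitive of a function that vanishes
    at negative times start from zero at time 0, without a sign convention for
    integrals over reversed intervals. *)
Definition primitive f (t : R) : R := \int[mu]_(s in `]-oo, t]) f s.

Variables (T : R) (f : R -> R).
Hypothesis supp_f : forall t : R, ~~ (0 < t < T) -> f t = 0.

Lemma integrable_supp : L2 mu setT f -> mu.-integrable setT (EFin \o f).
Proof.
move=> f2; have := L2_sqr f2; have mf := L2_measurable f2 => f2i.
have i1 : mu.-integrable setT (EFin \o (\1_`]0, T[ : R -> R)).
  exact: integrable_indic_itv.
apply: (le_integrable_EFin measurableT mf (integrableD_EFin measurableT f2i i1)).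
move=> t _ /=; rewrite indicE mem_setE /= in_itv/=.
case: (boolP (0 < t < T)) => /= [_|/supp_f ->]; last first.
  by rewrite normr0 expr0n addr0.
rewrite -(real_normK (num_real (f t))); set a := `|_|.
by have := sqr_ge0 (a - 1); have := sqr_ge0 a; nra.
Qed.

Lemma primitive_le0 (t : R) : t <= 0 -> primitive f t = 0.
Proof.
move=> t0; rewrite /primitive (@eq_Rintegral _ _ _ _ _ (cst 0)) ?Rintegral_cst ?mul0r//.
move=> s; rewrite inE /= in_itv/= => st; apply: supp_f.
by rewrite negb_and -!leNgt (le_trans st t0).
Qed.

Lemma primitive_geT t : T <= t -> primitive f t = primitive f T.
Proof.
move=> Tt; rewrite /primitive [LHS]Rintegral_mkcond [RHS]Rintegral_mkcond.
apply: eq_Rintegral => s _; rewrite /patch !mem_setE/= !in_itv/=.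
case: (leP s T) => sT; first by rewrite (le_trans sT).
by rewrite supp_f ?if_same// [s < T]ltNge (ltW sT) andbF.
Qed.

Lemma primitiveB s t : mu.-integrable setT (EFin \o f) -> s <= t ->
  primitive f t - primitive f s = \int[mu]_(r in `]s, t]) f r.
Proof.
move=> fi st; rewrite /primitive Rintegral_itvB//.
by apply: integrableS fi.
Qed.

(** The Cauchy-Schwarz inequality against the constant function 1. *)
Lemma primitive_diff_sqr s t : L2 mu setT f -> s <= t ->
  (primitive f t - primitive f s) ^+ 2 <=
  (t - s) * \int[mu]_(r in `]s, t]) (f r ^+ 2).
Proof.
move=> f2 st; rewrite primitiveB//; last exact: integrable_supp.
have f2' : L2 mu `]s, t] f.
  case: f2 => mf f2; split; first exact: measurable_funS mf.
  exact: integrableS f2.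
have mst : (mu `]s, t] = (t - s)%:E)%E.
  rewrite lebesgue_measure_itv/= lte_fin; case: ltP => // ts.
  by rewrite (_ : t = s) ?subrr//; apply/le_anti; rewrite st ts.
have i1 : L2 mu `]s, t] (cst 1 : R -> R).
  by apply: L2_cst => //; exact: (eq_ind_r (fun x => (x < +oo)%E) (ltry _) mst).
have := cauchy_schwarz_norm _ f2' i1.
under eq_Rintegral do rewrite mulr1.
move=> /(_ (measurable_itv _)); rewrite -(@ler_pXn2r _ 2)// ?nnegrE ?mulr_ge0 ?sqrtr_ge0//.
rewrite real_normK ?num_real// exprMn !L2norm_sqr mulrC.
congr (_ <= _ * _).
transitivity (1 * fine (mu `]s, t])); last by rewrite mst mul1r.
by rewrite -Rintegral_cst//; apply: eq_Rintegral => x _ /=; rewrite expr1n.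
Qed.

(** Lebesgue's differentiation theorem, for increments that tend to zero along
    a sequence. *)
Lemma primitive_derivable_ae : mu.-integrable setT (EFin \o f) ->
  {ae mu, forall t : R, forall k : nat -> R, (forall n, k n != 0) ->
    k n @[n --> \oo] --> 0 ->
    (primitive f (t + k n) - primitive f t) / k n @[n --> \oo] --> f t}.
Proof.
move=> fi.
have lf : locally_integrable setT f.
  have := integrable_locally measurableT fi.
  by rewrite patch_setT.
have fiy y : mu.-integrable `]-oo, y] (EFin \o f) by exact: integrableS fi.
have := FTC1Ny fiy lf; apply: ae_imp => t /= [dF <-] k k0 kc.
rewrite derive1E; move: dF; rewrite /derivable /derive => dF.
have /cvgr_dnbhsP/(_ k (conj k0 kc)) := dF.
apply: cvg_trans; apply: near_eq_cvg; near=> n => /=.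
by rewrite /primitive /GRing.scale/= mulr1 mulrC (addrC t).
Unshelve. all: by end_near. Qed.

End primitive.

(** * Integration over space and time *)
Section shift_invariance.
Context {R : realType}.
Local Notation leb1 := (@lebesgue_measure R).

Definition tshift (k t : R) : R := t + k.

Lemma measurable_tshift k : measurable_fun [set: measurableTypeR R]
  (tshift k : measurableTypeR R -> measurableTypeR R).
Proof. by apply: measurable_funD => //; exact: measurable_cst. Qed.

Lemma lebesgue_tshift k (A : set (measurableTypeR R)) : measurable A ->
  leb1 (tshift k @^-1` A) = leb1 A.
Proof.
move=> mA; pose m := pushforward leb1 (tshift k : measurableTypeR R -> measurableTypeR R).
have mk := measurable_tshift k.
pose m' : {measure set (measurableTypeR R) -> \bar R} :=
  measure_function_pushforward__canonical__measure_function_Measure leb1 mk.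
rewrite (@lebesgue_measure_unique _ m' _ _ mA)// => _ [[a b] _ <-].
rewrite /m'/= /pushforward/=.
have -> : tshift k @^-1` `]a, b] = `](a - k), (b - k)]%classic.
  by apply/seteqP; split => t; rewrite /tshift/= !in_itv/= ltrBlDr lerBrDr.
rewrite !lebesgue_measure_itv/= !lte_fin ltrD2r; case: ifP => // _.
by rewrite -!EFinB; congr EFin; ring.
Qed.

End shift_invariance.

Section space_time_integrals.
Context {R : realType} dX (X : measurableType dX).
Variable mu : {sigma_finite_measure set X -> \bar R}.
Local Notation leb1 := (@lebesgue_measure R).
Local Notation ST := (X * measurableTypeR R)%type.
Local Notation nu := (mu \x leb1)%E.
Implicit Types f g a b : ST -> R.

Lemma measurable_Rintegral_snd d1 d2 (X1 : measurableType d1)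
    (X2 : measurableType d2) (m2 : {sigma_finite_measure set X2 -> \bar R})
    (f : X1 * X2 -> R) : measurable_fun setT f ->
  measurable_fun setT (fun x => \int[m2]_y f (x, y)).
Proof.
move=> mf; apply: measurableT_comp; first exact: fine_measurable.
under eq_fun do rewrite integralE.
have mF : measurable_fun setT (EFin \o f) by exact/measurable_EFinP.
apply: emeasurable_funB.
- rewrite (_ : (fun _ => _) = fubini_F m2 ((EFin \o f)^\+)%E); last first.
    by apply/funext => x; apply: eq_integral => y _; rewrite !unlock.
  by apply: measurable_fun_fubini_tonelli_F => //; exact: measurable_funepos.
- rewrite (_ : (fun _ => _) = fubini_F m2 ((EFin \o f)^\-)%E); last first.
    by apply/funext => x; apply: eq_integral => y _; rewrite !unlock.
  by apply: measurable_fun_fubini_tonelli_F => //; exact: measurable_funeneg.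
Qed.

Definition stshift (k : R) (z : ST) : ST := (z.1, tshift k z.2).

Lemma measurable_stshift k : measurable_fun setT (stshift k).
Proof.
apply: measurable_fun_pair; first exact: measurable_fst.
by apply: measurableT_comp; [exact: measurable_tshift|exact: measurable_snd].
Qed.

Lemma pushforward_stshift k (A : set ST) : measurable A ->
  nu (stshift k @^-1` A) = nu A.
Proof.
move=> mA; have mk := measurable_stshift k.
pose m' : {measure set ST -> \bar R} :=
  measure_function_pushforward__canonical__measure_function_Measure nu mk.
rewrite [RHS](@product_measure_unique _ _ _ _ _ mu leb1 m')// => B C mB mC.
rewrite /m'/= /pushforward/=.
have -> : stshift k @^-1` (B `*` C) = B `*` (tshift k @^-1` C) by [].
have mC' : measurable (tshift k @^-1` C).
  by have := measurable_tshift k measurableT mC; rewrite setTI.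
rewrite (product_measure1E mu leb1 mB mC').
by congr (_ * _)%E; exact: lebesgue_tshift.
Qed.

Lemma integral_stshift k (f : ST -> \bar R) : measurable_fun setT f ->
  (forall z, 0 <= f z)%E -> (\int[nu]_z f (stshift k z) = \int[nu]_z f z)%E.
Proof.
move=> mf f0; have mk := measurable_stshift k.
transitivity (\int[measure_function_pushforward__canonical__measure_function_Measure nu mk]_z f z)%E.
  by apply/esym; apply: (@ge0_integral_pushforward _ _ _ _ _ _ mk nu setT f).
by apply: eq_measure_integral => A mA _; exact: pushforward_stshift.
Qed.

Lemma integrable_stshift k f : nu.-integrable setT (EFin \o f) ->
  nu.-integrable setT (EFin \o (f \o stshift k)).
Proof.
move=> /integrableP[mf fi]; have mk := measurable_stshift k.
apply/integrableP; split; first by apply: (measurableT_comp mf).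
rewrite (integral_stshift k (f := abse \o (EFin \o f)))//.
  exact: measurableT_comp.
by move=> z /=.
Qed.

Lemma Rintegral_stshift k f : nu.-integrable setT (EFin \o f) ->
  \int[nu]_z f (stshift k z) = \int[nu]_z f z.
Proof.
move=> fi; have mk := measurable_stshift k; congr fine.
have /= <- := @integral_pushforward _ _ _ _ _ _ mk nu setT (EFin \o f).
- by apply: eq_measure_integral => A mA _; exact: pushforward_stshift.
- exact: measurable_int fi.
- exact: integrable_stshift.
- by [].
Qed.

Lemma L2_stshift k f : L2 nu setT f -> L2 nu setT (f \o stshift k).
Proof.
move=> [mf f2]; split; first exact: measurableT_comp (measurable_stshift k).
exact: (integrable_stshift k f2).
Qed.

Lemma L2norm_stshift k f : L2 nu setT f ->
  L2norm nu setT (f \o stshift k) = L2norm nu setT f.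
Proof.
by move=> [mf f2]; rewrite /L2norm; congr Num.sqrt; exact: (Rintegral_stshift k f2).
Qed.

Lemma product_null (N : set ST) : measurable N ->
  {ae mu, forall x, {ae leb1, forall t, ~ N (x, t)}} -> nu N = 0%E.
Proof.
move=> mN aeN; rewrite /product_measure1.
have : {ae mu, forall x, setT x -> ((fun x => leb1 (xsection N x)) x = cst 0 x)%E}.
  apply: ae_imp aeN => x [M [mM M0 NM]] _ /=.
  apply/eqP; rewrite eq_le measure_ge0 andbT -M0.
  apply: le_measure; rewrite ?inE//; first exact: measurable_xsection.
  by move=> t /xsectionP Nt; apply: NM => /=; apply.
move=> H; rewrite (ae_eq_integral (cst 0%E) _ _ _ _ H)//.
  by rewrite integral_cst// mul0e.
exact: measurable_fun_xsection.
Qed.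

Lemma product_ae_sections (N : set ST) : measurable N -> nu N = 0%E ->
  {ae leb1, forall t, {ae mu, forall x, ~ N (x, t)}}.
Proof.
move=> mN N0.
have N0' : (\int[leb1]_t mu (ysection N t) = 0)%E.
  by rewrite -[LHS]/((mu \x^ leb1)%E N) -[RHS]N0; apply/esym;
    apply: product_measure_unique => // A B mA mB; exact: (product_measure2E mu leb1 mA mB).
have my : measurable_fun setT (fun t => mu (ysection N t)) by exact: measurable_fun_ysection.
have : (\int[leb1]_t `|mu (ysection N t)| = 0)%E.
  by rewrite -[RHS]N0'; apply: eq_integral => t _; rewrite gee0_abs.
move/(ae_eq_integral_abs leb1 measurableT my).
apply: ae_imp => t /= /(_ I) h; exists (ysection N t); split => //.
  exact: measurable_ysection.
by move=> x /= /contrapT xN; apply/ysectionP.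
Qed.

End space_time_integrals.

(** * Difference quotients of primitives in time *)
Section difference_quotient.
Context {R : realType}.
Local Notation leb1 := (@lebesgue_measure R).

Lemma measurable_primitive d1 (X1 : measurableType d1)
    (b : X1 * measurableTypeR R -> R) : measurable_fun setT b ->
  measurable_fun setT (fun z => primitive (fun s => b (z.1, s)) z.2).
Proof.
(* the condition [s <= t] becomes a factor that is measurable in all variables *)
move=> mb; pose I : set (measurableTypeR R) := [set` `]-oo, 0]].
pose f (p : (X1 * measurableTypeR R) * measurableTypeR R) : R :=
  b (p.1.1, p.2) * \1_I (p.2 - p.1.2).
rewrite (_ : (fun _ => _) = (fun z => \int[leb1]_s f (z, s))); last first.
  apply/funext => -[x t]; rewrite /primitive Rintegral_mkcond.
  apply: eq_Rintegral => s _; rewrite /patch /f /= indicE.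
  rewrite !mem_setE/= !in_itv/= subr_le0.
  by case: ifP => _; rewrite ?mulr1 ?mulr0.
apply: measurable_Rintegral_snd; apply: measurable_funM.
  apply: (measurableT_comp mb); apply: measurable_fun_pair => /=.
    by apply: measurableT_comp; exact: measurable_fst.
  exact: measurable_snd.
have mI : measurable_fun setT (\1_I : measurableTypeR R -> R).
  by apply: measurable_indic; exact: measurable_itv.
apply: (measurableT_comp mI); apply: measurable_funB.
  exact: measurable_snd.
by apply: (measurableT_comp measurable_snd); exact: measurable_fst.
Qed.

(** Averaging over time windows does not increase the norm: the square of the
    mean over a window is at most the mean of the square, and the windows that
    contain a given time have total weight one. *)
Lemma primitive_diff_sqr_int (T : R) (f : R -> R) (k : R) :
  (forall t : R, ~~ (0 < t < T) -> f t = 0) -> k != 0 -> L2 leb1 setT f ->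
  (\int[leb1]_t ((((primitive f (t + k) - primitive f t) / k) ^+ 2)%:E)
   <= \int[leb1]_s ((f s ^+ 2)%:E))%E.
Proof.
move=> sf k0 f2; have [mf f2i] := f2.
(* the window starts or ends at [t], according to the sign of [k] *)
pose I := [set` `]Num.min 0 k, Num.max 0 k]].
pose G (p : measurableTypeR R * measurableTypeR R) : R :=
  `|k|^-1 * (f p.2 ^+ 2 * \1_I (p.2 - p.1)).
have mI : measurable_fun setT (\1_I : measurableTypeR R -> R).
  by apply: measurable_indic; exact: measurable_itv.
have mG : measurable_fun setT (EFin \o G).
  apply/measurable_EFinP; apply: measurable_funM => //; apply: measurable_funM.
    by apply: measurable_funX; apply: measurableT_comp => //; exact: measurable_snd.
  apply: (measurableT_comp mI); apply: measurable_funB.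
    exact: measurable_snd.
  exact: measurable_fst.
have G0 p : (0 <= (EFin \o G) p)%E.
  by rewrite lee_fin mulr_ge0// ?invr_ge0// mulr_ge0 ?sqr_ge0.
apply: (@le_trans _ _ (\int[leb1]_t \int[leb1]_s (EFin \o G) (t, s))%E); last first.
  rewrite (fubini_tonelli _ mG G0) le_eqVlt; apply/orP; left; apply/eqP.
  apply: eq_integral => s _ /=.
  under eq_integral do rewrite /G /= mulrCA EFinM.
  have mIs : measurable_fun setT (fun t : measurableTypeR R => (\1_I (s - t) : R)).
    by apply: (measurableT_comp mI); apply: measurable_funB.
  rewrite ge0_integralZl//; [|by apply/measurable_EFinP; apply: measurable_funM
    |by rewrite lee_fin sqr_ge0].
  rewrite -[RHS]mule1; congr (_ * _)%E.
  under eq_integral do rewrite EFinM.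
  rewrite ge0_integralZl//; [|by apply/measurable_EFinP].
  transitivity ((`|k|^-1)%:E * `|k|%:E)%E; last by rewrite -EFinM mulVf ?normr_eq0.
  congr (_ * _)%E.
  pose J : set (measurableTypeR R) := [set` `[(s - Num.max 0 k), (s - Num.min 0 k)[].
  transitivity (\int[leb1]_t (\1_J t)%:E)%E.
    apply: eq_integral => t _; rewrite !indicE !mem_setE !in_itv/=.
    congr ((_ : bool)%:R%:E).
    by apply/idP/idP => /andP[h1 h2]; apply/andP; split; lra.
  rewrite integral_indic//; last exact: measurable_itv.
  transitivity (leb1 J); first by rewrite setIT.
  rewrite /J lebesgue_measure_itv/= lte_fin ltrD2l ltrN2 -EFinB.
  have [k_gt|k_lt|k_eq] := ltgtP 0 k.
  - by rewrite k_gt gtr0_norm//; congr EFin; ring.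
  - by rewrite k_lt ltr0_norm//; congr EFin; ring.
  - by rewrite k_eq eqxx in k0.
have mP : measurable_fun setT (primitive f : measurableTypeR R -> R).
  have mf' : measurable_fun [set: measurableTypeR R * measurableTypeR R] (f \o snd).
    by apply: (measurableT_comp mf); exact: measurable_snd.
  have := measurable_fun_pair2 (0 : measurableTypeR R) (measurable_primitive mf').
  exact.
have fk : 0 < `|k| by rewrite normr_gt0.
apply: ge0_le_integral => //.
- by move=> t _; rewrite lee_fin sqr_ge0.
- apply/measurable_EFinP; apply: measurable_funX; apply: measurable_funM => //.
  apply: measurable_funB => //; apply: (measurableT_comp mP).
  exact: measurable_tshift.
- exact: (measurable_fun_fubini_tonelli_F _ mG G0).
move=> t _.
have key u v : u <= v -> v - u = `|k| -> `]u, v]%classic = `]t + Num.min 0 k, t + Num.max 0 k]%classic ->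
  ((((primitive f v - primitive f u) / k) ^+ 2)%:E <= \int[leb1]_s (EFin \o G) (t, s))%E.
  move=> uv vu uvE.
  have i2 : leb1.-integrable `]u, v] (EFin \o (fun s => f s ^+ 2)) by exact: integrableS f2i.
  have -> : (\int[leb1]_s (EFin \o G) (t, s) = \int[leb1]_(s in `]u, v]) (`|k|^-1 * f s ^+ 2)%:E)%E.
    rewrite [RHS]integral_mkcond; apply: eq_integral => s _; rewrite /G/= /patch uvE indicE.
    have -> : (s \in `]t + Num.min 0 k, t + Num.max 0 k]%classic) = (s - t \in I).
      by rewrite !mem_setE !in_itv/=; apply/idP/idP => /andP[h1 h2]; apply/andP; split; lra.
    by case: ifP => _; rewrite ?mulr1 ?mulr0.
  have -> : (\int[leb1]_(s in `]u, v]) (`|k|^-1 * f s ^+ 2)%:E =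
      (\int[leb1]_(s in `]u, v]) (`|k|^-1 * f s ^+ 2))%:E)%E.
    by rewrite /Rintegral fineK//; apply: integrable_fin_num => //; exact: integrableZ_EFin.
  rewrite lee_fin RintegralZl// exprMn exprVn -[k ^+ 2](real_normK (num_real k)).
  have := primitive_diff_sqr sf f2 uv; rewrite vu => H.
  by rewrite ler_pdivrMr ?exprn_gt0// (le_trans H)// expr2 mulrACA mulVf ?gt_eqF// mul1r mulrC.
have [k_gt|k_lt|k_eq] := ltgtP 0 k.
- apply: key; first by rewrite lerDl ltW.
    by rewrite gtr0_norm// addrAC subrr add0r.
  by rewrite (min_l (ltW k_gt)) (max_r (ltW k_gt)) addr0.
- have := key (t + k) t; rewrite -[primitive f t - _]opprB mulNr sqrrN; apply.
  + by rewrite gerDl ltW.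
  + by rewrite ltr0_norm// opprD addrA subrr add0r.
  + by rewrite (min_r (ltW k_lt)) (max_l (ltW k_lt)) addr0.
- by rewrite k_eq eqxx in k0.
Qed.

End difference_quotient.

Section space_time_difference_quotient.
Context {R : realType} dX (X : measurableType dX).
Variable mu : {sigma_finite_measure set X -> \bar R}.
Local Notation leb1 := (@lebesgue_measure R).
Local Notation ST := (X * measurableTypeR R)%type.
Local Notation nu := (mu \x leb1)%E.
Implicit Types (a b : ST -> R) (k : R).

Definition stprimitive b (z : ST) : R := primitive (fun s => b (z.1, s)) z.2.

(** The mean of [b] over the time window between [t] and [t + k]. *)
Definition diffq k b (z : ST) : R :=
  (stprimitive b (stshift k z) - stprimitive b z) / k.

Lemma measurable_diffq k b : measurable_fun setT b ->
  measurable_fun setT (diffq k b).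
Proof.
move=> mb; have mp := measurable_primitive mb.
apply: measurable_funM => //; apply: measurable_funB => //.
exact: (measurableT_comp mp (measurable_stshift k)).
Qed.

Lemma L2_sections b : L2 nu setT b ->
  {ae mu, forall x, L2 leb1 setT (fun s => b (x, s))}.
Proof.
move=> [mb b2]; have := ae_integrable1 b2; apply: ae_imp => x bx; split=> //.
exact: measurable_fun_pair2.
Qed.

Variables (T : R) (b : ST -> R).
Hypothesis supp_b : forall z : ST, ~~ (0 < (z.2 : R) < T) -> b z = 0.
Hypothesis b2 : L2 nu setT b.

Let supp_section x (t : R) : ~~ (0 < t < T) -> b (x, t) = 0.
Proof. by move=> t0T; rewrite supp_b. Qed.

Lemma diffq_L2 k : k != 0 -> L2 nu setT (diffq k b) /\
  \int[nu]_z (diffq k b z ^+ 2) <= \int[nu]_z (b z ^+ 2).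
Proof.
move=> k0; have mb := L2_measurable b2; have md := measurable_diffq k mb.
have b2i := L2_sqr b2; have /integrableP[mb2 b2y] := b2i.
have mdq : measurable_fun setT (fun z => (diffq k b z ^+ 2)%:E).
  by apply/measurable_EFinP; exact: measurable_funX.
have le : (\int[nu]_z (diffq k b z ^+ 2)%:E <= \int[nu]_z (b z ^+ 2)%:E)%E.
  rewrite !fubini_tonelli1//; last 2 first.
  - by move=> z; rewrite lee_fin sqr_ge0.
  - by move=> z; rewrite lee_fin sqr_ge0.
  apply: ae_ge0_le_integral => //.
  - by move=> x _; apply: integral_ge0 => t _; rewrite lee_fin sqr_ge0.
  - apply: measurable_fun_fubini_tonelli_F => // z.
    by rewrite lee_fin sqr_ge0.
  - by move=> x _; apply: integral_ge0 => t _; rewrite lee_fin sqr_ge0.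
  - apply: measurable_fun_fubini_tonelli_F => // z.
    by rewrite lee_fin sqr_ge0.
  apply: ae_imp (L2_sections b2) => x bx _.
  exact: (primitive_diff_sqr_int (supp_section x) k0 bx).
have L : L2 nu setT (diffq k b).
  split => //; apply/integrableP; split => //.
  apply: le_lt_trans b2y; under eq_integral do rewrite gee0_abs ?lee_fin ?sqr_ge0//.
  by under [leRHS]eq_integral do rewrite gee0_abs ?lee_fin ?sqr_ge0//.
split=> //; rewrite /Rintegral fine_le//; apply: integrable_fin_num => //.
by case: L.
Qed.

Variable h : nat -> R.
Hypothesis h0 : forall n, h n != 0.
Hypothesis hcvg : h n @[n --> \oo] --> 0.

(** On almost every line in time this is Lebesgue's differentiation theorem. The
    set of divergence is measurable, being given by an upper limit, and a
    measurable set with null sections is null. *)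
Lemma diffq_cvg_ae : {ae nu, forall z, diffq (h n) b z @[n --> \oo] --> b z}.
Proof.
have mb := L2_measurable b2.
pose u n z : \bar R := `|diffq (h n) b z - b z|%:E.
pose F z := limn_esup (u ^~ z).
have mu_ n : measurable_fun setT (u n).
  apply/measurable_EFinP; apply: measurableT_comp => //.
  by apply: measurable_funB => //; exact: measurable_diffq.
have mF : measurable_fun setT F by exact: measurable_fun_limn_esup.
pose N := ~` (F @^-1` [set 0%E]).
have mN : measurable N.
  apply: measurableC; have := mF measurableT [set 0%E] (emeasurable_set1 0%E).
  by rewrite setTI.
exists N; split => //.
- apply: product_null => //; apply: ae_imp (L2_sections b2) => x bx.
  have bi := integrable_supp (supp_section x) bx.
  apply: ae_imp (primitive_derivable_ae bi) => t /(_ h h0 hcvg) H.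
  rewrite /N /= => /(_ _)[]; rewrite /F.
  have uc : u n (x, t) @[n --> \oo] --> 0%E.
    apply: cvg_EFin; first by apply: nearW.
    move: H => /= H.
    rewrite [X in X @ _ --> _](_ : _ = (fun n => `|diffq (h n) b (x, t) - b (x, t)|))//.
    by rewrite -(normr0 R) -(subrr (b (x, t))); apply: cvg_norm; apply: cvgB => //; exact: cvg_cst.
  by have [_ ->] := cvg_limn_einf_sup uc.
- move=> z /= nz Fz; apply: nz.
  have : u n z @[n --> \oo] --> 0%E.
    have Fz0 : limn_esup (u ^~ z) = 0%E := Fz.
    by apply: limn_esup_le_cvg; [rewrite Fz0|move=> n; rewrite lee_fin].
  move=> /fine_cvg /=; rewrite /comp/= => uc.
  apply/subr_cvg0; apply/norm_cvg0P => //.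
Qed.

(** Strong convergence comes from almost everywhere convergence and the bound
    by the norm of the limit: Fatou's lemma for the square of the sum gives
    four times the square of the norm of the limit as a lower bound, and the
    parallelogram identity turns it into an upper bound for the difference. *)
Lemma diffq_cvg_L2 : forall eps, 0 < eps -> \forall n \near \oo,
  \int[nu]_z ((diffq (h n) b z - b z) ^+ 2) < eps.
Proof.
move=> eps eps0; have mb := L2_measurable b2.
pose B := \int[nu]_z (b z ^+ 2).
have D2 n := (diffq_L2 (h0 n)).1.
have S2 n : L2 nu setT (diffq (h n) b \+ b) by exact: L2D (D2 n) b2.
have M2 n : L2 nu setT (diffq (h n) b \- b) by exact: L2B (D2 n) b2.
pose F n z := (((diffq (h n) b \+ b) z) ^+ 2)%:E.
have para n : \int[nu]_z ((diffq (h n) b z - b z) ^+ 2) <=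
    4 * B - \int[nu]_z ((diffq (h n) b z + b z) ^+ 2).
  rewrite lerBrDr -RintegralD//; [|exact: L2_sqr (M2 n)|exact: L2_sqr (S2 n)].
  have -> : \int[nu]_z ((diffq (h n) b z - b z) ^+ 2 + (diffq (h n) b z + b z) ^+ 2)
    = 2 * \int[nu]_z (diffq (h n) b z ^+ 2) + 2 * B.
    have i1 := L2_sqr (D2 n); have i2 := L2_sqr b2.
    rewrite /B -!RintegralZl// -RintegralD//; [|exact: integrableZ_EFin..].
    by apply: eq_Rintegral => z _; ring.
  by have := (diffq_L2 (h0 n)).2; rewrite -/B; lra.
have mF n : measurable_fun setT (F n).
  by apply/measurable_EFinP; apply: measurable_funX; exact: L2_measurable (S2 n).
have F0 n z : setT z -> (0 <= F n z)%E by move=> _; rewrite lee_fin sqr_ge0.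
have := fatou nu measurableT mF F0.
have -> : (\int[nu]_z limn_einf (F ^~ z) = (4 * B)%:E)%E.
  have -> : ((4 * B)%:E = \int[nu]_z (4 * b z ^+ 2)%:E)%E.
    have i2 := L2_sqr b2; rewrite /B -RintegralZl// /Rintegral fineK//.
    by apply: integrable_fin_num => //; exact: integrableZ_EFin.
  apply: ae_eq_integral => //.
  - apply: measurableT_comp => //; apply: measurable_fun_limn_esup => n.
    exact: measurableT_comp.
  - by apply/measurable_EFinP; apply: measurable_funM => //; exact: measurable_funX.
  - apply: ae_imp diffq_cvg_ae => z dz _.
    have : F n z @[n --> \oo] --> (4 * b z ^+ 2)%:E.
      apply: cvg_EFin; first by apply: nearW.
      have -> : 4 * b z ^+ 2 = (b z + b z) * (b z + b z) by ring.
      rewrite (_ : _ \o _ = (fun n => (diffq (h n) b z + b z) * (diffq (h n) b z + b z))).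
        by apply: cvgM; apply: cvgD => //; exact: cvg_cst.
      by apply/funext => n; rewrite /= expr2.
    by move/cvg_limn_einf_sup => [].
rewrite limn_einf_lim => H.
have : (((4 * B - eps)%:E) < ereal_sup (range (einfs (fun n => \int[nu]_z F n z))))%E.
  apply: lt_le_trans (_ : _ < (4 * B)%:E)%E _.
    by rewrite lte_fin ltrBlDr ltrDl.
  apply: le_trans H _; rewrite le_eqVlt; apply/orP; left; apply/eqP.
  by apply: cvg_lim => //; exact: cvg_einfs_sup.
move=> /ereal_sup_gt[_ [N _ <-] HN]; exists N => // n Nn /=.
apply: le_lt_trans (para n) _.
have : ((4 * B - eps)%:E < \int[nu]_z F n z)%E.
  by apply: lt_le_trans HN _; apply: ereal_inf_lbound; exists n.
have -> : (\int[nu]_z F n z = (\int[nu]_z ((diffq (h n) b z + b z) ^+ 2))%:E)%E.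
  rewrite /Rintegral fineK//; apply: integrable_fin_num => //.
  exact: L2_sqr (S2 n).
by rewrite lte_fin; lra.
Qed.

Lemma diffq_cvg_weak a : L2 nu setT a ->
  \int[nu]_z (a z * diffq (h n) b z) @[n --> \oo] --> \int[nu]_z (a z * b z).
Proof.
move=> a2; have D2 n := (diffq_L2 (h0 n)).1.
apply/cvgrPdist_lt => eps eps0.
have A0 : 0 < L2norm nu setT a + 1 by rewrite ltr_wpDl// sqrtr_ge0.
have e0 : 0 < (eps / (L2norm nu setT a + 1)) ^+ 2 by rewrite exprn_gt0// divr_gt0.
have := diffq_cvg_L2 e0; apply: filterS => n Hn.
have M2 : L2 nu setT (diffq (h n) b \- b) by exact: L2B (D2 n) b2.
rewrite distrC -RintegralB//; [|exact: L2M..].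
rewrite (_ : \int[nu]_z _ = \int[nu]_z (a z * (diffq (h n) b \- b) z)); last first.
  by apply: eq_Rintegral => z _ /=; ring.
apply: le_lt_trans (cauchy_schwarz_norm _ a2 M2) _ => //.
have : L2norm nu setT (diffq (h n) b \- b) < eps / (L2norm nu setT a + 1).
  rewrite -(@ltr_pXn2r _ 2)// ?nnegrE ?sqrtr_ge0// ?L2norm_sqr//.
  by rewrite divr_ge0// ltW.
rewrite ltr_pdivlMr//; apply: le_lt_trans.
by rewrite mulrC ler_wpM2l ?sqrtr_ge0// lerDl.
Qed.

End space_time_difference_quotient.

(** * Time shifts and the energy at the final time *)
Section time_shift_energy.
Context {R : realType} dX (X : measurableType dX).
Variable mu : {sigma_finite_measure set X -> \bar R}.
Local Notation leb1 := (@lebesgue_measure R).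
Local Notation ST := (X * measurableTypeR R)%type.
Local Notation nu := (mu \x leb1)%E.
Variable T : R.
Implicit Types (q r rho : ST -> R) (h : R).

Definition late (s : R) : set ST := [set z | s <= z.2].

Lemma measurable_late s : measurable (late s).
Proof.
rewrite (_ : late s = setT `*` [set` `[s, +oo[]).
  by apply: measurableX => //; exact: measurable_itv.
by apply/seteqP; split => -[x t] /=; rewrite /late /= in_itv/= andbT// => -[].
Qed.

Lemma stshiftK h : cancel (stshift (X := X) h) (stshift (- h)).
Proof. by move=> [x t]; rewrite /stshift/tshift/= addrK. Qed.

Lemma Rintegral_late s f : measurable_fun setT f ->
  \int[nu]_(z in late s) f z = \int[nu]_z (f z * \1_(late s) z).
Proof.
move=> mf; rewrite Rintegral_mkcond; apply: eq_Rintegral => z _.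
by rewrite /patch indicE; case: ifP => _; rewrite ?mulr1 ?mulr0.
Qed.

Lemma integrable_late s f : nu.-integrable setT (EFin \o f) ->
  nu.-integrable setT (EFin \o (fun z => f z * \1_(late s) z)).
Proof.
move=> fi; have mf : measurable_fun setT f.
  by apply/measurable_EFinP; exact: measurable_int fi.
apply: (le_integrable_EFin measurableT _ (integrable_norm fi)).
  by apply: measurable_funM => //; apply: measurable_indic; exact: measurable_late.
move=> z _ /=; rewrite normrM indicE; case: (z \in _) => /=.
  by rewrite normr1 mulr1.
by rewrite normr0 mulr0.
Qed.

(** Since [2 q (q - q') >= q^2 - q'^2] and [q] vanishes after time [T], half of
    the energy that the shift carries beyond [T] is a lower bound. *)
Lemma shift_square q h : 0 < h -> (forall z : ST, ~~ (0 < (z.2 : R) < T) -> q z = 0) ->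
  L2 nu setT q ->
  2^-1 * \int[nu]_(z in late (T - h)) (q z ^+ 2) <=
  \int[nu]_z (q z * (q z - q (stshift (- h) z))).
Proof.
move=> h0 sq q2; have mq := L2_measurable q2; have q2i := L2_sqr q2.
have qs2 := L2_stshift (- h) q2.
have ql2 := integrable_late (T - h) q2i.
pose f z := q z ^+ 2 - q z ^+ 2 * \1_(late (T - h)) z.
have fi : nu.-integrable setT (EFin \o f) by exact: integrableB_EFin.
have fsi := integrable_stshift (- h) fi.
rewrite Rintegral_late; last exact: measurable_funX.
have -> : \int[nu]_z (q z ^+ 2 * \1_(late (T - h)) z) =
    \int[nu]_z (q z ^+ 2 - f (stshift (- h) z)).
  rewrite RintegralB// (Rintegral_stshift _ fi) -RintegralB//.
  by apply: eq_Rintegral => z _; rewrite /f; ring.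
have qfi : nu.-integrable setT (EFin \o (fun z => q z ^+ 2 - f (stshift (- h) z))).
  exact: integrableB_EFin.
rewrite -RintegralZl//; apply: le_Rintegral => //.
- exact: integrableZ_EFin.
- by apply: L2M => //; exact: L2B.
move=> z _; rewrite /f indicE; case: (boolP (_ \in _)) => [|].
  rewrite inE /late /= /tshift lerD2r => Tz.
  rewrite (sq z) ?mul0r ?expr0n/=; last by rewrite [_ < T]ltNge Tz andbF.
  by rewrite mulr1 subrr subr0 mulr0.
move=> _; rewrite mulr0 subr0.
by have := sqr_ge0 (q z - q (stshift (- h) z)); nra.
Qed.

(** Against a function that is absolutely continuous in time, the shift leaves
    a boundary term at the end of the interval and moves the difference
    quotient to that function. *)
Lemma shift_product q r rho c h : 0 < h -> h < T ->
  (forall z : ST, ~~ (0 < (z.2 : R) < T) -> q z = 0) ->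
  (forall z : ST, ~~ (0 < (z.2 : R) < T) -> r z = 0) ->
  (forall z : ST, ~~ (0 < (z.2 : R) < T) -> rho z = 0) ->
  (forall x t s, q (x, t) != 0 -> 0 < s < T ->
     r (x, s) = c x + stprimitive rho (x, s)) ->
  L2 nu setT q -> L2 nu setT r -> L2 nu setT rho ->
  nu.-integrable setT (EFin \o
    (fun z => (c z.1 + stprimitive rho (z.1, T)) * q z * \1_(late (T - h)) z)) /\
  \int[nu]_z (r z * (q z - q (stshift (- h) z))) =
  \int[nu]_z ((c z.1 + stprimitive rho (z.1, T)) * q z * \1_(late (T - h)) z)
  - h * \int[nu]_z (diffq h rho z * q z).
Proof.
move=> h0 hT sq sr srho rE q2 r2 rho2.
have dq2 : L2 nu setT (diffq h rho).
  by apply: (diffq_L2 srho rho2 _).1; rewrite gt_eqF.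
have qs2 := L2_stshift (- h) q2.
have rs2 := L2_stshift h r2.
pose F z := (c z.1 + stprimitive rho (z.1, T)) * q z * \1_(late (T - h)) z.
have FE z : F z = r z * q z + h * (diffq h rho z * q z) - r (stshift h z) * q z.
  rewrite /F; have [->|q0] := eqVneq (q z) 0.
    by rewrite !mulr0 mul0r addr0 subr0.
  have zT : 0 < (z.2 : R) < T by apply: contraNT q0 => /sq ->.
  have qz : q (z.1, z.2) != 0 by case: (z) q0.
  have rz : r z = c z.1 + stprimitive rho z.
    by case: (z) qz zT => x t /= qz zT; rewrite (rE _ _ _ qz zT).
  have dE : h * (diffq h rho z * q z) =
      (stprimitive rho (stshift h z) - stprimitive rho z) * q z.
    by rewrite /diffq; field; rewrite gt_eqF.
  rewrite dE rz indicE; case: (boolP (_ \in _)).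
    rewrite inE /late/= lerBlDr => Tz.
    rewrite (sr (stshift h z)); last first.
      by rewrite /stshift/= /tshift negb_and -!leNgt Tz orbT.
    have -> : stprimitive rho (stshift h z) = stprimitive rho (z.1, T).
      rewrite /stprimitive/=; apply: primitive_geT => // t tT.
      by rewrite srho.
    by rewrite mulr1 /=; ring.
  rewrite notin_setE /late/= => /negP; rewrite -ltNge ltrBrDr => zhT.
  rewrite {1}/stshift (rE _ _ _ qz); last first.
    by case/andP: zT => z0 _; rewrite /tshift zhT andbT addr_gt0.
  by rewrite mulr0 /stshift/=; ring.
have i1 : nu.-integrable setT (EFin \o (fun z => r z * q z)) by exact: L2M.
have i2 : nu.-integrable setT (EFin \o (fun z => diffq h rho z * q z)) by exact: L2M.
have i3 : nu.-integrable setT (EFin \o (fun z => r (stshift h z) * q z)) by exact: L2M.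
have i4 := integrableZ_EFin measurableT h i2.
have i12 := integrableD_EFin measurableT i1 i4.
have FEE : F = (fun z => (r z * q z + h * (diffq h rho z * q z)) - r (stshift h z) * q z).
  by apply/funext => z; rewrite FE.
have Fi : nu.-integrable setT (EFin \o F).
  by rewrite FEE; exact: (integrableB_EFin measurableT i12 i3).
split => //; rewrite -/F.
have -> : \int[nu]_z F z = \int[nu]_z (r z * q z) + h * \int[nu]_z (diffq h rho z * q z)
    - \int[nu]_z (r (stshift h z) * q z).
  by rewrite FEE RintegralB// RintegralD// RintegralZl.
have -> : \int[nu]_z (r (stshift h z) * q z) = \int[nu]_z (r z * q (stshift (- h) z)).
  have i5 : nu.-integrable setT (EFin \o (fun z => r z * q (stshift (- h) z))).
    exact: L2M.
  rewrite -(Rintegral_stshift h i5); apply: eq_Rintegral => z _.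
  by rewrite stshiftK.
have i5 : nu.-integrable setT (EFin \o (fun z => r z * q (stshift (- h) z))).
  exact: L2M.
rewrite (_ : \int[nu]_z (r z * _) = \int[nu]_z (r z * q z - r z * q (stshift (- h) z))).
  by rewrite RintegralB//; ring.
by apply: eq_Rintegral => z _; rewrite mulrBr.
Qed.

End time_shift_energy.

Lemma cvg_sumr {R : realType} (I : Type) (s : seq I) (f : I -> nat -> R)
    (a : I -> R) : (forall i, f i n @[n --> \oo] --> a i) ->
  \sum_(i <- s) f i n @[n --> \oo] --> \sum_(i <- s) a i.
Proof.
move=> fa; elim: s => [|i s IH].
  by rewrite big_nil; under eq_fun do rewrite big_nil; exact: cvg_cst.
by rewrite big_cons; under eq_fun do rewrite big_cons; exact: cvgD.
Qed.

Lemma time_step_cvg {R : realType} (T : R) : T / n.+2%:R @[n --> \oo] --> (0 : R).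
Proof.
rewrite -(mulr0 T); apply: cvgM; first exact: cvg_cst.
by have := @cvg_harmonic R; rewrite -cvg_shiftS; exact.
Qed.

Section energy_at_final_time.
Context {R : realType} dX (X : measurableType dX).
Variable mu : {sigma_finite_measure set X -> \bar R}.
Local Notation leb1 := (@lebesgue_measure R).
Local Notation ST := (X * measurableTypeR R)%type.
Local Notation nu := (mu \x leb1)%E.

Lemma integral_slab (Om : set X) (f : X -> R) (a b : R) : measurable Om ->
  a <= b -> mu.-integrable Om (EFin \o f) -> (forall x, 0 <= f x) ->
  nu.-integrable setT (EFin \o
    (fun z : ST => (f \_ Om) z.1 * \1_(`[a, b[%classic) (z.2 : R))) /\
  \int[nu]_z ((f \_ Om) z.1 * \1_(`[a, b[%classic) (z.2 : R)) =
  (b - a) * \int[mu]_(x in Om) f x.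
Proof.
move=> mOm ab fi f0.
pose J : set (measurableTypeR R) := [set` `[a, b[].
have mJ : measurable_fun setT (\1_J : measurableTypeR R -> R).
  by apply: measurable_indic; exact: measurable_itv.
pose F (z : ST) : \bar R := ((f \_ Om) z.1 * \1_J z.2)%:E.
have fO0 x : 0 <= (f \_ Om) x by rewrite /patch; case: ifP.
have fOi : mu.-integrable setT (EFin \o (f \_ Om)).
  by have /(integrable_mkcond _ mOm) := fi; rewrite restrict_EFin.
have mfO : measurable_fun setT (f \_ Om).
  by apply/measurable_EFinP; exact: measurable_int fOi.
have F0 z : (0 <= F z)%E by rewrite lee_fin mulr_ge0.
have mF : measurable_fun setT F.
  apply/measurable_EFinP; apply: measurable_funM.
    by apply: (measurableT_comp mfO); exact: measurable_fst.
  by apply: (measurableT_comp mJ); exact: measurable_snd.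
have IF : (\int[nu]_z F z = ((b - a) * \int[mu]_(x in Om) f x)%:E)%E.
  rewrite fubini_tonelli1// /fubini_F.
  transitivity (\int[mu]_x ((b - a)%:E * ((f \_ Om) x)%:E))%E.
    apply: eq_integral => x _; rewrite /F/=; under eq_integral do rewrite EFinM.
    rewrite ge0_integralZl//; [|by apply/measurable_EFinP|by rewrite lee_fin].
    rewrite muleC; congr (_ * _)%E; rewrite integral_indic//; last exact: measurable_itv.
    transitivity (leb1 J); first by rewrite setIT.
    rewrite /J lebesgue_measure_itv/= lte_fin; case: ltP => // ba.
    by rewrite (_ : a = b) ?subrr//; apply/le_anti; rewrite ab ba.
  have fO0' x : [set: X] x -> (0 <= ((f \_ Om) x)%:E)%E by rewrite lee_fin.
  have mfO' : measurable_fun setT (fun x => ((f \_ Om) x)%:E) by exact/measurable_EFinP.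
  have ba0 : (0 <= (b - a)%:E :> \bar R)%E by rewrite lee_fin subr_ge0.
  rewrite (ge0_integralZl mu measurableT mfO' fO0' ba0).
  by rewrite EFinM; congr (_ * _)%E; rewrite Rintegral_mkcond /Rintegral fineK//;
      exact: integrable_fin_num.
split; last by rewrite /Rintegral IF.
apply/integrableP; split => //.
under eq_integral do rewrite gee0_abs//.
by rewrite [X in (X < _)%E]IF ltry.
Qed.

Variables (Om : set X) (T : R) (d : nat).
Hypotheses (mOm : measurable Om) (T0 : 0 < T).
Let Q : set ST := [set z | Om z.1 /\ 0 < (z.2 : R) < T].
(* [n.+2] keeps the shift strictly below [T] *)
Let h (n : nat) : R := T / n.+2%:R.

Variables (q r rho : 'I_d -> ST -> R) (c : 'I_d -> X -> R) (kappa g e : ST -> R).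
Hypothesis q_off : forall i z, ~ Q z -> q i z = 0.
Hypothesis r_off : forall i z, ~ Q z -> r i z = 0.
Hypothesis rho_off : forall i z, ~ Q z -> rho i z = 0.
Hypothesis kappa_off : forall z, ~ Q z -> kappa z = 0.
Hypothesis g_off : forall z, ~ Q z -> g z = 0.
Hypothesis e_off : forall z, ~ Q z -> e z = 0.
Hypothesis q2 : forall i, L2 nu setT (q i).
Hypothesis r2 : forall i, L2 nu setT (r i).
Hypothesis rho2 : forall i, L2 nu setT (rho i).
Hypothesis kappa2 : L2 nu setT kappa.
Hypothesis g2 : L2 nu setT g.
Hypothesis e2 : L2 nu setT e.
Hypothesis rE : forall i z, Q z -> r i z = c i z.1 + stprimitive (rho i) z.
Hypothesis eE : forall z, Q z -> e z = stprimitive g z.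
Let rT i x := c i x + stprimitive (rho i) (x, T).
Hypothesis rT2 : forall i, L2 mu Om (rT i).

Let off_time (f : ST -> R) : (forall z, ~ Q z -> f z = 0) ->
  forall z : ST, ~~ (0 < (z.2 : R) < T) -> f z = 0.
Proof. by move=> fQ z zT; apply: fQ => -[_]; apply/negP. Qed.

Let h_gt0 n : 0 < h n. Proof. by rewrite divr_gt0. Qed.
Let h_lt n : h n < T.
Proof. by rewrite ltr_pdivrMr// ltr_pMr// ltr1n. Qed.
Let h_cvg : h n @[n --> \oo] --> 0.
Proof. exact: time_step_cvg. Qed.

Let e_shift n z : Q z ->
  e z - e (stshift (- h n) z) = h n * diffq (- h n) g z.
Proof.
move=> Qz; rewrite (eE Qz).
have -> : e (stshift (- h n) z) = stprimitive g (stshift (- h n) z).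
  have [Qs|nQs] := pselect (Q (stshift (- h n) z)); first exact: eE.
  rewrite e_off// /stprimitive (@primitive_le0 _ T)//.
    by move=> t tT; rewrite (off_time g_off).
  rewrite leNgt; apply/negP => s0; apply: nQs; split; first by case: Qz.
  rewrite s0/= /tshift; case: Qz => _ /andP[_ zT].
  by rewrite ltrBlDr (lt_trans zT)// ltrDl.
by rewrite /diffq; field; rewrite gt_eqF.
Qed.

(** This is [shift_square] divided by the shift: the difference quotients of
    [e] are averages of [g], which converge weakly. The number [G] stands for
    the energy at time [T], known through averages over the last times. *)
Lemma energy_of_primitive (G : R) :
  (forall eta, 0 < eta -> \forall n \near \oo,
     G - eta <= (h n)^-1 * \int[nu]_(z in late (T - h n)) (e z ^+ 2)) ->
  G / 2 <= \int[nu]_z (e z * g z).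
Proof.
move=> HG; have hN0 n : - h n != 0 by rewrite oppr_eq0 gt_eqF.
have hNc : (- h n) @[n --> \oo] --> 0 by rewrite -oppr0; exact: cvgN.
have D2 n : L2 nu setT (diffq (- h n) g) by exact: (diffq_L2 (off_time g_off) g2 _).1.
have cvg := diffq_cvg_weak (off_time g_off) g2 hN0 hNc e2.
apply/ler_addgt0Pr => eta eta0.
have [n] : exists n, G - eta <= (h n)^-1 * \int[nu]_(z in late (T - h n)) (e z ^+ 2) /\
    `|\int[nu]_z (e z * g z) - \int[nu]_z (e z * diffq (- h n) g z)| < eta / 2.
  have [N _ HN] := HG _ eta0.
  have /cvgrPdist_lt/(_ _ (divr_gt0 eta0 (ltr0Sn R 1)))[M _ HM] := cvg.
  by exists (maxn N M); split; [apply: HN|apply: HM]; rewrite /= ?leq_maxl ?leq_maxr.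
move=> [Gn]; rewrite ltr_distl => /andP[en _].
have := shift_square (h_gt0 n) (off_time e_off) e2.
rewrite (_ : \int[nu]_z (e z * (e z - _)) = h n * \int[nu]_z (e z * diffq (- h n) g z)).
  rewrite -ler_pdivrMl// mulrCA => H; move: H Gn en.
  move: (_^-1 * \int[nu]_(z in _) _) (\int[nu]_z (e z * g z)).
  move: (\int[nu]_z (e z * diffq _ _ z)) => A B C H Gn en.
  by lra.
rewrite -RintegralZl//; last exact: L2M.
apply: eq_Rintegral => z _.
have [Qz|/e_off ->] := pselect (Q z); last by rewrite !mul0r mulr0.
rewrite mulrCA; congr (_ * _); exact: e_shift.
Qed.

Hypothesis green : forall k, 0 <= k < T ->
  \sum_i \int[nu]_z ((r i z - q i z) * q i (stshift (- k) z)) =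
  - \int[nu]_z (kappa z * e (stshift (- k) z)).

Variable eps : R.
Hypothesis eps1 : 1 <= eps.

Let eps0 : 0 < eps. Proof. exact: lt_le_trans eps1. Qed.

(** The difference of [green] without shift and with the shift [h n], divided by
    the shift. The quadratic term is bounded by [shift_square] and the mixed one
    rewritten by [shift_product]; Young's inequality with the parameter [eps]
    splits its boundary term into the trace of [r] at time [T] and a part of the
    energy of [q] in the last time window. *)
Lemma shifted_energy n :
  2^-1 * (1 - eps^-1) * \sum_i ((h n)^-1 * \int[nu]_(z in late (T - h n)) (q i z ^+ 2))
  <= \int[nu]_z (kappa z * diffq (- h n) g z)
     - \sum_i \int[nu]_z (q i z * diffq (h n) (rho i) z)
     + eps / 2 * \sum_i \int[mu]_(x in Om) (rT i x ^+ 2).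
Proof.
have hn0 := h_gt0 n; have hnT := h_lt n.
have D2 : L2 nu setT (diffq (- h n) g).
  by apply: (diffq_L2 (off_time g_off) g2 _).1; rewrite oppr_eq0 gt_eqF.
have Dr2 i : L2 nu setT (diffq (h n) (rho i)).
  by apply: (diffq_L2 (off_time (rho_off i)) (rho2 i) _).1; rewrite gt_eqF.
have qs2 i : L2 nu setT (q i \o stshift (- h n)) by exact: L2_stshift.
have es2 : L2 nu setT (e \o stshift (- h n)) by exact: L2_stshift.
have dq2 i : L2 nu setT (q i \- (q i \o stshift (- h n))) by exact: L2B.
have stshift0 z : stshift (- 0) z = z :> ST.
  by case: z => x t; rewrite /stshift/tshift/= oppr0 addr0.
have K : h n * \int[nu]_z (kappa z * diffq (- h n) g z) =
    - (\sum_i \int[nu]_z (r i z * (q i z - q i (stshift (- h n) z))))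
    + \sum_i \int[nu]_z (q i z * (q i z - q i (stshift (- h n) z))).
  have -> : h n * \int[nu]_z (kappa z * diffq (- h n) g z) =
      \int[nu]_z (kappa z * e (stshift (- 0) z))
      - \int[nu]_z (kappa z * e (stshift (- h n) z)).
    rewrite -RintegralB//; [|by apply: L2M => //; exact: L2_stshift|exact: L2M].
    rewrite -RintegralZl//; last exact: L2M.
    apply: eq_Rintegral => z _; rewrite stshift0.
    have [Qz|/kappa_off ->] := pselect (Q z); last by rewrite !mul0r mulr0 subr0.
    by rewrite mulrCA -mulrBr e_shift.
  have := green (k := h n); rewrite (ltW hn0) hnT => /(_ isT) Gh.
  have := green (k := 0); rewrite lexx T0 => /(_ isT) G0.
  rewrite (canRL (@opprK R) (esym G0)) (canRL (@opprK R) (esym Gh)) opprK.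
  rewrite -!sumrN -!big_split/=.
  apply: eq_bigr => i _.
  have p2 : L2 nu setT (r i \- q i) by exact: L2B.
  have q02 : L2 nu setT (q i \o stshift (- 0)) by exact: L2_stshift.
  have i1 : nu.-integrable setT (EFin \o (fun z => (r i z - q i z) * q i (stshift (- h n) z))).
    exact: (L2M measurableT p2 (qs2 i)).
  have i2 : nu.-integrable setT (EFin \o (fun z => (r i z - q i z) * q i (stshift (- 0) z))).
    exact: (L2M measurableT p2 q02).
  have i3 : nu.-integrable setT (EFin \o (fun z => r i z * (q i z - q i (stshift (- h n) z)))).
    exact: (L2M measurableT (r2 i) (dq2 i)).
  have i4 : nu.-integrable setT (EFin \o (fun z => q i z * (q i z - q i (stshift (- h n) z)))).
    exact: (L2M measurableT (q2 i) (dq2 i)).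
  rewrite addrC -RintegralB// addrC -RintegralB//.
  by apply: eq_Rintegral => z _; rewrite stshift0; ring.
have SP i := shift_product hn0 hnT (off_time (q_off i)) (off_time (r_off i))
  (off_time (rho_off i)) (c := c i) _ (q2 i) (r2 i) (rho2 i).
have rE' i x t s : q i (x, t) != 0 -> 0 < s < T ->
    r i (x, s) = c i x + stprimitive (rho i) (x, s).
  move=> q0 sT; rewrite rE//; split => //=.
  have [Qxt|/(q_off i)] := pselect (Q (x, t)); first by case: Qxt.
  by move/eqP; rewrite (negPf q0).
have {}SP i := SP rE' i.
have SS i := shift_square hn0 (off_time (q_off i)) (q2 i).
have young i : \int[nu]_z ((c i z.1 + stprimitive (rho i) (z.1, T)) * q i z
      * \1_(late (T - h n)) z) <=
    eps / 2 * (h n * \int[mu]_(x in Om) (rT i x ^+ 2))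
    + (2 * eps)^-1 * \int[nu]_(z in late (T - h n)) (q i z ^+ 2).
  have rT2i := L2_sqr (rT2 i).
  have Tle : T - h n <= T by rewrite gerBl ltW.
  have [slabi] := integral_slab mOm Tle rT2i (fun x => sqr_ge0 _).
  rewrite opprB addrCA subrr addr0 => <-.
  have mq := L2_measurable (q2 i).
  rewrite Rintegral_late; last exact: measurable_funX.
  have qli := integrable_late (T - h n) (L2_sqr (q2 i)).
  rewrite -!RintegralZl// -RintegralD//; [|exact: integrableZ_EFin..].
  have i1 := integrableZ_EFin measurableT (eps / 2) slabi.
  have i2 := integrableZ_EFin measurableT (2 * eps)^-1 qli.
  have i3 := integrableD_EFin measurableT i1 i2.
  apply: le_Rintegral => //; first exact: (SP i).1.
  move=> z _; have [Qz|/(q_off i) ->] := pselect (Q z); last first.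
    rewrite mulr0 mul0r expr0n/= mul0r mulr0 addr0 mulr_ge0 ?divr_ge0 ?(ltW eps0)//.
    by rewrite mulr_ge0// /patch; case: ifP => // _; exact: sqr_ge0.
  have -> : (\1_(`[(T - h n), T[%classic) (z.2 : R) : R) = \1_(late (T - h n)) z.
    rewrite !indicE mem_setE in_itv/=; congr ((_ : bool)%:R).
    case: Qz => _ /andP[_ zT]; rewrite zT andbT.
    by apply/idP/idP; rewrite inE.
  rewrite patchT ?inE; last by case: Qz.
  rewrite [eps / 2 * (_ * _)]mulrA [(2 * eps)^-1 * (_ * _)]mulrA -mulrDl ler_wpM2r//.
  rewrite -/(rT i z.1); set a := rT i z.1; set b := q i z.
  rewrite -subr_ge0 (_ : _ - _ = (2 * eps)^-1 * (eps * a - b) ^+ 2); last first.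
    by field; rewrite gt_eqF.
  by rewrite mulr_ge0 ?sqr_ge0// invr_ge0 mulr_ge0// ltW.
have each i : 2^-1 * (1 - eps^-1) * \int[nu]_(z in late (T - h n)) (q i z ^+ 2) <=
    - (\int[nu]_z (r i z * (q i z - q i (stshift (- h n) z))))
    + \int[nu]_z (q i z * (q i z - q i (stshift (- h n) z)))
    - h n * \int[nu]_z (q i z * diffq (h n) (rho i) z)
    + eps / 2 * (h n * \int[mu]_(x in Om) (rT i x ^+ 2)).
  rewrite (SP i).2; have := SS i; have := young i.
  have -> : \int[nu]_z (q i z * diffq (h n) (rho i) z) =
      \int[nu]_z (diffq (h n) (rho i) z * q i z).
    by apply: eq_Rintegral => z _; rewrite mulrC.
  move: (\int[nu]_z (diffq _ _ _ * _)) (\int[nu]_z (q i z * _)) => A B.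
  move: (\int[nu]_z ((c i z.1 + stprimitive (rho i) (z.1, T)) * q i z * \1_(late (T - h n)) z)) => C.
  move: (\int[nu]_(z in late (T - h n)) (q i z ^+ 2)) => D.
  move: (h n * \int[mu]_(x in Om) (rT i x ^+ 2)) => E.
  have -> : (2 * eps)^-1 * D = 2^-1 * (eps^-1 * D) by field; rewrite gt_eqF.
  by move: (h n * A) (eps / 2 * E) => A' E' h1 h2; lra.
have : \sum_i _ <= \sum_i _ := ler_sum _ (fun i _ => each i).
rewrite !big_split/= !sumrN -!mulr_sumr -K.
move: (\sum_i \int[nu]_(z in late (T - h n)) (q i z ^+ 2)) => S1.
move: (\int[nu]_z (kappa z * diffq (- h n) g z)) => S2.
move: (\sum_i \int[nu]_z (q i z * diffq (h n) (rho i) z)) => S3.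
move: (\sum_i \int[mu]_(x in Om) (rT i x ^+ 2)) => S4 H.
rewrite mulrCA ler_pdivrMl//; apply: le_trans H _; rewrite le_eqVlt; apply/orP; left.
by apply/eqP; ring.
Qed.

(** The limit of [shifted_energy]. The field [q] may have no trace at time [T];
    [G i] stands for the energy of its component there. *)
Lemma energy_at_end (G : 'I_d -> R) :
  (forall i eta, 0 < eta -> \forall n \near \oo,
     G i - eta <= (h n)^-1 * \int[nu]_(z in late (T - h n)) (q i z ^+ 2)) ->
  2^-1 * (1 - eps^-1) * \sum_i G i <=
  \int[nu]_z (kappa z * g z) - \sum_i \int[nu]_z (q i z * rho i z)
     + eps / 2 * \sum_i \int[mu]_(x in Om) (rT i x ^+ 2).
Proof.
move=> HG.
pose A n := \int[nu]_z (kappa z * diffq (- h n) g z)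
     - \sum_i \int[nu]_z (q i z * diffq (h n) (rho i) z)
     + eps / 2 * \sum_i \int[mu]_(x in Om) (rT i x ^+ 2).
have Ac : A n @[n --> \oo] --> \int[nu]_z (kappa z * g z)
     - \sum_i \int[nu]_z (q i z * rho i z)
     + eps / 2 * \sum_i \int[mu]_(x in Om) (rT i x ^+ 2).
  apply: cvgD; last exact: cvg_cst.
  apply: cvgB.
    have hN0 n : - h n != 0 by rewrite oppr_eq0 gt_eqF.
    have hNc : (- h n) @[n --> \oo] --> 0 by rewrite -oppr0; exact: cvgN.
    exact: (diffq_cvg_weak (off_time g_off) g2 hN0 hNc kappa2).
  apply: cvg_sumr => i.
  have hn0 n : h n != 0 by rewrite gt_eqF.
  exact: (diffq_cvg_weak (off_time (rho_off i)) (rho2 i) hn0 h_cvg (q2 i)).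
apply/ler_addgt0Pr => eta eta0.
have e1 : 0 <= 1 - eps^-1 by rewrite subr_ge0 invf_le1.
(* each of the [d] components may err by this amount, in total by [eta / 2] *)
have k0 : 0 < eta / (2 * d.+1%:R) by rewrite divr_gt0// mulr_gt0.
have /cvgrPdist_lt/(_ _ (divr_gt0 eta0 (ltr0Sn R 1))) := Ac => HA.
have HGA : \forall n \near \oo, forall i, G i - eta / (2 * d.+1%:R) <=
    (h n)^-1 * \int[nu]_(z in late (T - h n)) (q i z ^+ 2).
  by apply: filter_forall => i; exact: HG.
have [N _ HN] := filterI HA HGA.
have [] := HN N (leqnn N); rewrite ltr_distl => /andP[{}HA _] {}HGA.
have := shifted_energy N; rewrite -/(A N) => HS.
have : 2^-1 * (1 - eps^-1) * \sum_i (G i - eta / (2 * d.+1%:R)) <= A N.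
  apply: le_trans HS; rewrite ler_wpM2l ?mulr_ge0//; exact: ler_sum.
rewrite sumrB sumr_const card_ord -[_ *+ d]mulr_natr.
have : eta / (2 * d.+1%:R) * d%:R <= eta / 2.
  rewrite invfM mulrA -mulrA ler_piMr ?divr_ge0 ?(ltW eta0)//.
  by rewrite mulrC ler_pdivrMr// mul1r ler_nat.
have e2' : eps^-1 <= 1 by rewrite invf_le1.
have e3 : 0 < eps^-1 by rewrite invr_gt0.
have : 0 <= eta / (2 * d.+1%:R) * d%:R by rewrite mulr_ge0// ltW.
move: (eta / (2 * d.+1%:R) * d%:R) (\sum_i G i) (eps^-1) e2' e3 {e1} HA => a b k k1 k2' HA a0 a1 H.
have : 2^-1 * (1 - k) * a <= eta / 2.
  by apply: le_trans a1; rewrite ler_piMl//; lra.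
move: H HA; rewrite mulrBr.
move: (A N) (_ * b) (_ * a) (_ + _ * \sum_i _) => u v w y; lra.
Qed.

End energy_at_final_time.

(** * Smooth functions *)
Section smooth_calculus.
Context {R : realType}.

(** The order of differentiation is bounded so that the stability of smooth
    functions under products and compositions can be proved by induction. *)
Fixpoint csmooth (V : normedModType R) (n : nat) (f : V -> R) : Prop :=
  continuous f /\
  if n is m.+1 then
    forall h, (forall x, derivable f x h) /\ csmooth m ('D_h f)
  else True.

Lemma csmooth_continuous (V : normedModType R) n (f : V -> R) :
  csmooth n f -> continuous f.
Proof. by case: n => [|n] []. Qed.

Lemma csmoothW (V : normedModType R) n (f : V -> R) :
  csmooth n.+1 f -> csmooth n f.
Proof.
elim: n f => [|n IH] f /=; first by case.
move=> [cf H]; split=> // h; split; first by case: (H h).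
exact/IH/(H h).2.
Qed.

Lemma smoothP (V : normedModType R) (f : V -> R) :
  smooth f <-> forall n, csmooth n f.
Proof.
split=> [sf n|Hf].
  elim: n f sf => [|n IH] f sf; first by split; [case: (sf [::])|].
  split=> [|h]; first by case: (sf [::]).
  split=> [x|]; first by case: (sf [::]).
  by apply: IH => s; have := sf (rcons s h); rewrite foldr_rcons.
move=> s; elim/last_ind: s f Hf => [|s h IH] f Hf /=.
  split; first by case: (Hf 0%N).
  by move=> x h; have [_ /(_ h)[]] := Hf 1%N.
rewrite foldr_rcons; apply: IH => n.
by have [_ /(_ h)[]] := Hf n.+1.
Qed.

Lemma smooth_continuous (V : normedModType R) (f : V -> R) :
  smooth f -> continuous f.
Proof. by case/(_ [::]). Qed.

Lemma smooth_derivable (V : normedModType R) (f : V -> R) x h :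
  smooth f -> derivable f x h.
Proof. by case/(_ [::]) => _; apply. Qed.

Lemma smooth_derive (V : normedModType R) (f : V -> R) h :
  smooth f -> smooth ('D_h f).
Proof. by move=> sf s; have := sf (rcons s h); rewrite foldr_rcons. Qed.

Lemma csmooth_cst (V : normedModType R) n (k : R) : csmooth n (cst k : V -> R).
Proof.
elim: n k => [|n IH] k /=; first by split=> // x; exact: cvg_cst.
split=> [x|h]; first exact: cvg_cst.
split=> [x|]; first exact: derivable_cst.
rewrite (_ : 'D_h _ = cst 0); first exact: IH.
by apply/funext => x; rewrite derive_cst.
Qed.

Lemma csmoothD (V : normedModType R) n (f g : V -> R) :
  csmooth n f -> csmooth n g -> csmooth n (f + g).
Proof.
elim: n f g => [|n IH] f g /=.
  by move=> [cf _] [cg _]; split=> // x; apply: cvgD; [exact: cf|exact: cg].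
move=> [cf Hf] [cg Hg]; split=> [x|h]; first by apply: cvgD; [exact: cf|exact: cg].
have [[df sf] [dg sg]] := (Hf h, Hg h).
split=> [x|]; first exact: derivableD.
rewrite (_ : 'D_h _ = 'D_h f + 'D_h g); first exact: IH.
by apply/funext => x; rewrite deriveD.
Qed.

Lemma csmoothM (V : normedModType R) n (f g : V -> R) :
  csmooth n f -> csmooth n g -> csmooth n (f * g).
Proof.
elim: n f g => [|n IH] f g /=.
  by move=> [cf _] [cg _]; split=> // x; apply: cvgM; [exact: cf|exact: cg].
move=> [cf Hf] [cg Hg]; split=> [x|h]; first by apply: cvgM; [exact: cf|exact: cg].
have [[df sf] [dg sg]] := (Hf h, Hg h).
split=> [x|]; first exact: derivableM.
rewrite (_ : 'D_h _ = f * 'D_h g + g * 'D_h f).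
  by apply: csmoothD; apply: IH => //; apply: csmoothW; split.
by apply/funext => x; rewrite deriveM.
Qed.

Lemma smoothM (V : normedModType R) (f g : V -> R) :
  smooth f -> smooth g -> smooth (f * g).
Proof. by move=> /smoothP sf /smoothP sg; apply/smoothP => n; exact: csmoothM. Qed.

Lemma smoothD (V : normedModType R) (f g : V -> R) :
  smooth f -> smooth g -> smooth (f + g).
Proof. by move=> /smoothP sf /smoothP sg; apply/smoothP => n; exact: csmoothD. Qed.

Lemma smooth_cst (V : normedModType R) (k : R) : smooth (cst k : V -> R).
Proof. by apply/smoothP => n; exact: csmooth_cst. Qed.

Lemma smooth_prod (V : normedModType R) (I : Type) (s : seq I) (F : I -> V -> R) :
  (forall i, smooth (F i)) -> smooth (fun x => \prod_(i <- s) F i x).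
Proof.
move=> sF; elim: s => [|i s IH].
  rewrite (_ : (fun x => _) = cst 1); first exact: smooth_cst.
  by apply/funext => x; rewrite big_nil.
rewrite (_ : (fun x => _) = F i * (fun x => \prod_(j <- s) F j x)).
  exact: (smoothM (sF i) IH).
by apply/funext => x; rewrite big_cons.
Qed.

(** Both sides have the same difference quotients, because [A] is affine with
    linear part [L]. *)
Lemma derive_affine (V W : normedModType R) (A L : V -> W) (f : W -> R) (x h : V) :
  (forall k h x, A (k *: h + x) = k *: L h + A x) ->
  (derivable (f \o A) x h <-> derivable f (A x) (L h)) /\
  'D_h (f \o A) x = 'D_(L h) f (A x).
Proof.
move=> AE; have E : (fun k : R => k^-1 *: ((f \o A \o shift x) (k *: h) - (f \o A) x)) =
    (fun k : R => k^-1 *: ((f \o shift (A x)) (k *: L h) - f (A x))).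
  by apply/funext => k /=; rewrite AE.
by split; rewrite /derivable/derive E.
Qed.

Lemma smooth_affine (V W : normedModType R) (A L : V -> W) (f : W -> R) :
  (forall k h x, A (k *: h + x) = k *: L h + A x) -> continuous A ->
  smooth f -> smooth (f \o A).
Proof.
move=> AE cA /smoothP sf; apply/smoothP => n.
elim: n f sf => [|n IH] f sf; have cf := csmooth_continuous (sf 0%N).
  by split=> // x; apply: continuous_comp; [exact: cA|exact: cf].
split=> [x|h]; first by apply: continuous_comp; [exact: cA|exact: cf].
split=> [x|].
  by apply/(derive_affine f x h AE).1; have [_ /(_ (L h))[]] := sf 1%N.
rewrite (_ : 'D_h _ = ('D_(L h) f) \o A); last first.
  by apply/funext => x; rewrite (derive_affine f x h AE).2.
by apply: IH => m; have [_ /(_ (L h))[]] := sf m.+1.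
Qed.

Lemma smooth_local (V : normedModType R) (f : V -> R) :
  (forall x : V, exists2 g : V -> R, smooth g & nbhs x (fun y => f y = g y)) -> smooth f.
Proof.
move=> Hf; apply/smoothP => n; elim: n f Hf => [|n IH] f Hf.
  split=> // x; have [g sg fg] := Hf x.
  have cg := smooth_continuous sg (x := x).
  rewrite /continuous_at (nbhs_singleton fg).
  by apply: cvg_trans cg; apply: near_eq_cvg; apply: filterS fg => y ->.
split=> [x|h].
  have [g sg fg] := Hf x; have cg := smooth_continuous sg (x := x).
  rewrite /continuous_at (nbhs_singleton fg).
  by apply: cvg_trans cg; apply: near_eq_cvg; apply: filterS fg => y ->.
split=> [x|].
  have [g sg fg] := Hf x; have gf : {near x, g =1 f} by apply: filterS fg => y ->.
  exact: (near_eq_derivable gf (smooth_derivable sg)).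
apply: IH => x; have [g sg fg] := Hf x; exists ('D_h g).
  exact: smooth_derive.
have := nbhs_interior fg; apply: filterS => y fgy.
exact: near_eq_derive.
Qed.

Lemma derive_R (f : R -> R) (x h : R) : derivable f x 1 ->
  derivable f x h /\ 'D_h f x = h * 'D_1 f x.
Proof.
move=> /derivable1_diffP df; split; first exact: diff_derivable.
rewrite !deriveE// -[in LHS](mulr1 h) -/(h *: (1 : R^o)) linearZ//.
Qed.

Lemma csmooth_R n (f : R -> R) : continuous f -> (forall x, derivable f x 1) ->
  csmooth n ('D_1 f) -> csmooth n.+1 f.
Proof.
move=> cf df sf; split; first exact: cf.
move=> h; split; first by move=> x; have [] := derive_R h (df x).
rewrite (_ : 'D_h f = cst h * 'D_1 f).
  by apply: csmoothM => //; exact: csmooth_cst.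
by apply/funext => x; rewrite (derive_R h (df x)).2.
Qed.

End smooth_calculus.

(** * Flat functions and bumps *)
Section flat_function.
Context {R : realType}.

(** A class of functions that contains [exp (- 1 / t)], extended by zero, and is
    closed under derivation. *)
Definition flat (p : {poly R}) (t : R) : R :=
  if 0 < t then p.[t^-1] * expR (- t^-1) else 0.

(** From [u ^ m <= m ^ m * exp u], with [m = n + 1] and [u = 1 / t]. *)
Lemma flat_monomial_le n (t : R) : 0 < t ->
  t ^- n * expR (- t^-1) <= n.+1%:R ^+ n.+1 * t.
Proof.
move=> t0; have n0 : 0 < n.+1%:R :> R by [].
have u0 : 0 < t^-1 by rewrite invr_gt0.
rewrite expRN ler_pdivrMr ?expR_gt0//.
have : (t^-1 / n.+1%:R) ^+ n.+1 <= expR t^-1.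
  rewrite -[X in expR X](divfK (x := n.+1%:R)) ?gt_eqF// expRM_natr.
  rewrite lerXn2r ?nnegrE ?expR_ge0 ?divr_ge0 ?(ltW u0)//.
  by apply: le_trans (expR_ge1Dx _); rewrite lerDr.
rewrite expr_div_n ler_pdivrMr ?exprn_gt0// => H.
have -> : t ^- n = t * t^-1 ^+ n.+1.
  by rewrite exprS mulrA divff ?gt_eqF// mul1r exprVn.
by rewrite [leRHS]mulrAC [leRHS]mulrC ler_wpM2l ?(ltW t0)// mulrC.
Qed.

Lemma flat_le (p : {poly R}) : exists2 C, 0 <= C &
  forall t, `|flat p t| <= C * `|t|.
Proof.
exists (\sum_(i < size p) `|p`_i| * i.+1%:R ^+ i.+1).
  by apply: sumr_ge0 => i _; rewrite mulr_ge0.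
move=> t; rewrite /flat; case: ifPn => [t0|_]; last first.
  by rewrite normr0 mulr_ge0// sumr_ge0// => i _; rewrite mulr_ge0.
rewrite horner_coef mulr_suml (gtr0_norm t0) mulr_suml.
apply: le_trans (ler_norm_sum _ _ _) _; apply: ler_sum => i _.
rewrite -mulrA normrM -mulrA ler_wpM2l//.
rewrite ger0_norm ?mulr_ge0 ?expR_ge0 ?exprn_ge0 ?invr_ge0 ?(ltW t0)//.
by rewrite exprVn flat_monomial_le.
Qed.

Lemma flat_cvg0 (p : {poly R}) : flat p t @[t --> 0] --> 0.
Proof.
have [C C0 HC] := flat_le p.
apply/cvgrPdist_lt => e e0; near=> t.
rewrite sub0r normrN; apply: le_lt_trans (HC t) _.
apply: le_lt_trans (_ : (C + 1) * `|t| < e); first by rewrite ler_wpM2r// lerDl.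
rewrite -ltr_pdivlMl ?ltr_wpDl//; near: t.
apply: (@nbhs0_lt _ R^o); rewrite mulr_gt0// invr_gt0 ltr_wpDl//.
Unshelve. all: by end_near. Qed.

Definition flat_next (p : {poly R}) : {poly R} := 'X^2 * (p - p^`()).

(** Away from zero this is the product rule; at zero, the difference quotient of
    [flat p] is [flat ('X * p)], which tends to zero. *)
Lemma is_derive_flat (p : {poly R}) (t : R) :
  is_derive t 1 (flat p) (flat (flat_next p) t).
Proof.
have [t0|t0|<-] := ltgtP 0 t.
- have -> : flat (flat_next p) t = p.[t^-1] * (expR (- t^-1) * t ^- 2) +
      expR (- t^-1) * (p^`().[t^-1] * - t ^- 2).
    by rewrite /flat t0 /flat_next hornerM hornerXn hornerD hornerN -!exprVn; ring.
  apply: (near_eq_is_derive (f := (horner p \o GRing.inv) *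
     (expR \o (fun s => - s^-1)))).
    near=> s; rewrite /flat (_ : 0 < s)//; near: s; exact: lt_nbhsr.
  have tN0 : t != 0 by rewrite gt_eqF.
  have dV : is_derive t 1 (GRing.inv : R -> R) (- t ^- 2).
    have := @is_deriveV _ id t 1 1 tN0 (is_derive_id _ _).
    by rewrite /GRing.scale/= mulr1.
  have dNV : is_derive t 1 (fun s : R => - s^-1) (t ^- 2).
    by have := is_deriveN dV; rewrite opprK.
  have d1 := is_derive1_comp (is_derive_poly p t^-1) dV.
  have d2 := @is_derive1_comp _ expR (fun s => - s^-1) t _ _ (is_derive_expR (- t^-1)) dNV.
  exact: (is_deriveM d1 d2).
- rewrite {2}/flat ltNge (ltW t0)/=.
  have H0 : is_derive t 1 (cst (0 : R) : R -> R) 0 by apply: is_derive_cst.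
  apply: (near_eq_is_derive _ H0).
  near=> s; rewrite /flat ltNge (_ : s <= 0)//; apply: ltW; near: s; exact: lt_nbhsl.
- rewrite {2}/flat ltxx.
  have H : h^-1 *: ((flat p \o shift 0) (h *: 1) - flat p 0) @[h --> 0^'] --> (0 : R).
    apply: cvg_trans (_ : flat ('X * p) t @[t --> 0^'] --> 0); last first.
      by apply: cvg_trans (flat_cvg0 _); apply: cvg_app; exact: nbhs_dnbhs.
    apply: near_eq_cvg; near=> h.
    rewrite /= addr0 {3}/flat ltxx subr0 /flat /GRing.scale/= mulr1.
    by case: ifP; rewrite ?mulr0// hornerM hornerX mulrA.
  by apply: DeriveDef; [apply/cvg_ex; exists 0|apply/cvg_lim].
Unshelve. all: by end_near. Qed.

Lemma csmooth_flat n (p : {poly R}) : csmooth n (flat p).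
Proof.
have cf q : continuous (flat q).
  move=> t; apply: differentiable_continuous; apply/derivable1_diffP.
  by case: (is_derive_flat q t).
elim: n p => [|n IH] p; first by split=> //; exact: cf.
apply: csmooth_R => [|t|]; first exact: cf.
  by case: (is_derive_flat p t).
rewrite (_ : 'D_1 (flat p) = flat (flat_next p)); first exact: IH.
by apply/funext => t; case: (is_derive_flat p t).
Qed.

Definition ramp : R -> R := flat 1.

Lemma rampE t : ramp t = if 0 < t then expR (- t^-1) else 0.
Proof. by rewrite /ramp /flat hornerE mul1r. Qed.

Lemma smooth_ramp : smooth (ramp : R^o -> R).
Proof. by apply/smoothP => n; exact: csmooth_flat. Qed.

Lemma ramp_ge0 t : 0 <= ramp t.
Proof. by rewrite rampE; case: ifP => // _; rewrite expR_ge0. Qed.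

Lemma ramp_le1 t : ramp t <= 1.
Proof.
rewrite rampE; case: ifPn => // t0.
by rewrite -expR0 ler_expR oppr_le0 invr_ge0 ltW.
Qed.

Lemma ramp_le0 t : t <= 0 -> ramp t = 0.
Proof. by move=> t0; rewrite rampE ltNge t0. Qed.

Lemma ramp_cvg1 (c : R) : 0 < c -> ramp (c * n%:R - 1) @[n --> \oo] --> (1 : R).
Proof.
move=> c0; have cy : (c * n%:R - 1) @[n --> \oo] --> +oo%R.
  apply/cvgryPge => M; near=> n.
  rewrite lerBrDr -ler_pdivrMl//; near: n; exact: nbhs_infty_ger.
have : expR (- (c * n%:R - 1)^-1) @[n --> \oo] --> (1 : R).
  rewrite -[X in _ --> X]expR0; apply: continuous_cvg; first exact: continuous_expR.
  rewrite -[X in _ --> X]oppr0; apply: cvgN; apply/gtr0_cvgV0 => //.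
  near=> n; near: n.
  by have /cvgryPgt/(_ 0) := cy.
apply: cvg_trans; apply: near_eq_cvg; near=> n.
rewrite rampE (_ : 0 < c * n%:R - 1)//; near: n.
by have /cvgryPgt/(_ 0) := cy.
Unshelve. all: by end_near. Qed.

(** With growing [n] these functions increase to the indicator of the open
    interval from [a] to [b], each with compact support inside it. *)
Definition bump (a b : R) (n : nat) (t : R) : R :=
  ramp ((t - a) * n%:R - 1) * ramp ((b - t) * n%:R - 1).

Lemma smooth_bump a b n : smooth (bump a b n : R^o -> R).
Proof.
have E1 : continuous (fun t : R => (t - a) * n%:R - 1).
  move=> t; apply: cvgB; last exact: cvg_cst.
  by apply: cvgM; [apply: cvgB; [exact: cvg_id|exact: cvg_cst]|exact: cvg_cst].
have E2 : continuous (fun t : R => (b - t) * n%:R - 1).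
  move=> t; apply: cvgB; last exact: cvg_cst.
  by apply: cvgM; [apply: cvgB; [exact: cvg_cst|exact: cvg_id]|exact: cvg_cst].
apply: (@smoothM _ R^o).
  apply: (@smooth_affine _ R^o R^o (fun t => (t - a) * n%:R - 1)
    (fun t => t * n%:R) ramp) => //; last exact: smooth_ramp.
  by move=> k h x; rewrite /GRing.scale/=; ring.
apply: (@smooth_affine _ R^o R^o (fun t => (b - t) * n%:R - 1)
    (fun t => - t * n%:R) ramp) => //; last exact: smooth_ramp.
by move=> k h x; rewrite /GRing.scale/=; ring.
Qed.

Lemma bump_ge0 a b n t : 0 <= bump a b n t.
Proof. by rewrite mulr_ge0 ?ramp_ge0. Qed.

Lemma bump_le1 a b n t : bump a b n t <= 1.
Proof. by rewrite -[leRHS]mulr1 ler_pM ?ramp_ge0 ?ramp_le1. Qed.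

Lemma bump_neq0 a b n t : bump a b n t != 0 ->
  a + n%:R^-1 <= t <= b - n%:R^-1 /\ (0 < n)%N.
Proof.
rewrite mulf_eq0 negb_or => /andP[h1 h2].
have {}h1 : 1 < (t - a) * n%:R.
  by rewrite -subr_gt0 ltNge; apply: contra h1 => /ramp_le0 ->.
have {}h2 : 1 < (b - t) * n%:R.
  by rewrite -subr_gt0 ltNge; apply: contra h2 => /ramp_le0 ->.
have n0 : (0 < n)%N by case: n h1 {h2} => //; rewrite mulr0 ltr10.
have nR : 0 < n%:R :> R by rewrite ltr0n.
split=> //; rewrite -ltr_pdivrMr// div1r in h1.
rewrite -ltr_pdivrMr// div1r in h2.
by apply/andP; split; lra.
Qed.

Lemma bump_cvg a b t : a < t < b -> bump a b n t @[n --> \oo] --> (1 : R).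
Proof.
move=> /andP[at_ tb]; rewrite -[X in _ --> X]mulr1.
by apply: cvgM; apply: ramp_cvg1; rewrite subr_gt0.
Qed.

Lemma bump_out a b n t : ~~ (a < t < b) -> bump a b n t = 0.
Proof.
apply: contraNeq => /bump_neq0[/andP[h1 h2] n0].
have nV : 0 < n%:R^-1 :> R by rewrite invr_gt0 ltr0n.
by apply/andP; split; lra.
Qed.

End flat_function.

(** * Symmetry of second derivatives *)
Section mixed_derivatives.
Context {R : realType} (V : normedModType R).
Implicit Types (f : V -> R) (h k x : V).

Lemma line_mean_value f x h (s : R) : 0 < s -> (forall y, derivable f y h) ->
  exists2 c : R, 0 < c < s & f (s *: h + x) - f x = s * 'D_h f (c *: h + x).
Proof.
move=> s0 df; pose A (t : R^o) : V := t *: h + x.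
have AE (k : R) (t u : R^o) : A (k *: t + u) = k *: (t *: h) + A u.
  by rewrite /A scalerDl scalerA addrA.
have dA (t : R) : is_derive t 1 (f \o A : R -> R) ('D_h f (A t)).
  have [d1 d2] := derive_affine f (t : R^o) (1 : R^o) AE.
  rewrite scale1r in d1 d2.
  by apply: DeriveDef; [exact/d1|exact: d2].
have cA : continuous (f \o A : R -> R).
  by move=> t; apply: differentiable_continuous; apply/derivable1_diffP; case: (dA t).
have [c] := @MVT _ (f \o A : R -> R) (fun t => 'D_h f (A t)) 0 s s0
  (fun t _ => dA t) (continuous_subspaceT cA).
rewrite in_itv/= => c0s E; exists c => //.
by move: E; rewrite /A/= scale0r add0r subr0 => ->; rewrite mulrC.
Qed.

Lemma derive_translate f x h a : 'D_h (fun y => f (y + a)) x = 'D_h f (x + a).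
Proof.
have AE (k : R) u w : (k *: u + w) + a = k *: u + (w + a) by rewrite addrA.
by have [_] := derive_affine f x h AE.
Qed.

Lemma derivable_translate f x h a :
  derivable f (x + a) h -> derivable (fun y => f (y + a)) x h.
Proof.
have AE (k : R) u w : (k *: u + w) + a = k *: u + (w + a) by rewrite addrA.
by have [] := derive_affine f x h AE => -[_ H] _.
Qed.

(** Both mixed derivatives are values of the same second difference quotient
    at nearby points. *)
Lemma derive_mixed_mean f z h k (s : R) : smooth f -> 0 < s ->
  exists2 x, `|x - z| <= s * (`|h| + `|k|) &
    f (s *: h + z + s *: k) - f (s *: h + z) - (f (z + s *: k) - f z)
      = s * s * 'D_k ('D_h f) x.
Proof.
move=> sf s0; pose G y := f (y + s *: k) - f y.
have dG y : derivable G y h /\ 'D_h G y = 'D_h f (y + s *: k) - 'D_h f y.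
  have d1 : derivable (fun y => f (y + s *: k)) y h.
    by apply: derivable_translate; exact: smooth_derivable.
  have d2 : derivable f y h by exact: smooth_derivable.
  split; first exact: (derivableB d1 d2).
  by apply: etrans (deriveB d1 d2) _; rewrite derive_translate.
have [c /andP[c0 cs] cE] := line_mean_value z s0 (fun y => (dG y).1).
have dh : forall y, derivable ('D_h f) y k.
  by move=> y; apply: smooth_derivable; exact: smooth_derive.
have [c' /andP[c'0 c's] c'E] := line_mean_value (c *: h + z) s0 dh.
exists (c' *: k + (c *: h + z)).
  rewrite addrA addrK addrC mulrDr; apply: le_trans (ler_normD _ _) _.
  by rewrite !normrZ !gtr0_norm// lerD// ler_wpM2r// ltW.
by rewrite -/(G (s *: h + z)) -/(G z) cE (dG _).2 addrC (addrC _ (s *: k)) -mulrA -c'E addrC.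
Qed.

(** The second difference quotient is symmetric in the two directions. *)
Lemma derive_mixed f z h k : smooth f -> 'D_k ('D_h f) z = 'D_h ('D_k f) z.
Proof.
move=> sf.
have c1 : continuous ('D_k ('D_h f)).
  by apply: smooth_continuous; do 2 apply: smooth_derive.
have c2 : continuous ('D_h ('D_k f)).
  by apply: smooth_continuous; do 2 apply: smooth_derive.
apply/eqP; rewrite -subr_eq0 -normr_eq0; apply/eqP/le_anti; rewrite normr_ge0 andbT.
apply/ler_addgt0Pr => e e0; rewrite add0r.
have e20 : 0 < e / 2 by rewrite divr_gt0.
have /cvgrPdist_lt/(_ _ e20)/nbhs_ballP[r1 /= r10 H1] := c1 z.
have /cvgrPdist_lt/(_ _ e20)/nbhs_ballP[r2 /= r20 H2] := c2 z.
pose s := Num.min r1 r2 / (2 * (`|h| + `|k| + 1)).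
have N0 : 0 < `|h| + `|k| + 1 by rewrite ltr_wpDl// addr_ge0.
have m0 : 0 < Num.min r1 r2 by rewrite lt_min r10.
have s0 : 0 < s by rewrite divr_gt0// mulr_gt0.
have sN : s * (`|h| + `|k|) < Num.min r1 r2.
  apply: le_lt_trans (_ : s * (`|h| + `|k| + 1) < _).
    by rewrite ler_wpM2l ?(ltW s0)// lerDl.
  rewrite /s invfM mulrA mulfVK ?gt_eqF//.
  by rewrite ltr_pdivrMr// ltr_pMr// ltr1n.
have [x xz xE] := derive_mixed_mean z h k sf s0.
have [y yz yE] := derive_mixed_mean z k h sf s0.
have xy : 'D_k ('D_h f) x = 'D_h ('D_k f) y.
  apply: (mulfI (x := s * s)); first by rewrite mulf_neq0// gt_eqF.
  apply: etrans (esym xE) (etrans _ yE).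
  have -> : s *: h + z + s *: k = s *: k + z + s *: h.
    by rewrite addrAC [RHS]addrAC (addrC (s *: h)).
  rewrite (addrC z (s *: k)) (addrC z (s *: h)).
  move: (f (s *: k + z + s *: h)) (f (s *: k + z)) (f (s *: h + z)) (f z) => A B C D.
  by ring.
have Bx : ball z r1 x.
  rewrite -ball_normE /ball_ /= distrC; apply: le_lt_trans xz _.
  by apply: lt_le_trans sN _; rewrite ge_min lexx.
have By : ball z r2 y.
  rewrite -ball_normE /ball_ /= distrC; apply: le_lt_trans yz _.
  by rewrite addrC in sN; apply: lt_le_trans sN _; rewrite ge_min lexx orbT.
have := H1 _ Bx; have := H2 _ By; rewrite /= xy.
move: ('D_k ('D_h f) z) ('D_h ('D_k f) z) ('D_h ('D_k f) y) => a b c bc ac {xE yE xy Bx By H1 H2 c1 c2}.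
rewrite -(subrKA c); apply: le_trans (ler_normD _ _) _.
rewrite [leRHS]splitr; apply: lerD; first exact: ltW.
by rewrite distrC; exact: ltW.
Qed.

End mixed_derivatives.

(** * Boxes, Borel sets and Lebesgue measure *)
Section borel_sets.
Context {R : realType} {d : nat}.
Local Notation ST := ('rV[R]_d * measurableTypeR R)%type.

Definition stbox (a b : 'rV[R]_d) (s t : R) : set ST :=
  [set z : ST | (forall i, a 0 i < z.1 0 i < b 0 i) /\ s < (z.2 : R) < t].

Lemma measurable_stbox a b s t : measurable (stbox a b s t).
Proof.
have mc (i : 'I_d) : measurable_fun [set: ST] (fun z : ST => z.1 0 i : measurableTypeR R).
  by apply: (measurableT_comp (@measurable_coord R d i)); exact: measurable_fst.
rewrite (_ : stbox a b s t = (\bigcap_(i in [set: 'I_d])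
    ((fun z : ST => z.1 0 i : measurableTypeR R) @^-1` `]a 0 i, b 0 i[)) `&` (snd @^-1` `]s, t[)).
  apply: measurableI.
    apply: fin_bigcap_measurable => // i _.
    by rewrite -[X in measurable X]setTI; apply: mc => //; exact: measurable_itv.
  rewrite -[X in measurable X]setTI.
  by apply: (@measurable_snd _ _ 'rV[R]_d (measurableTypeR R)) => //; exact: measurable_itv.
apply/seteqP; split => -[x r] /= [H1 H2]; split; rewrite ?in_itv//.
- by move=> i _; rewrite /= in_itv/=; exact: H1.
- by move=> i; have := H1 i I; rewrite /= in_itv.
Qed.

(** Rational boxes form a countable base. *)
Lemma open_stbox_cover (O : set ('rV[R]_d * R)) : open O ->
  exists (a b : nat -> 'rV[R]_d) (s t : nat -> R),
    O = \bigcup_n stbox (a n) (b n) (s n) (t n).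
Proof.
move=> oO.
pose code := ('rV[rat]_d * 'rV[rat]_d * rat * rat)%type.
pose A (p : code) : 'rV[R]_d := map_mx ratr p.1.1.1.
pose B (p : code) : 'rV[R]_d := map_mx ratr p.1.1.2.
pose inO (p : code) := `[< stbox (A p) (B p) (ratr p.1.2) (ratr p.2) `<=` O >].
pose c n := if unpickle n is Some p then if inO p then Some p else None else None.
(* codes of boxes that are not included in [O] are sent to an empty box *)
exists (fun n => if c n is Some p then A p else 0), (fun n => if c n is Some p then B p else 0),
  (fun n => if c n is Some p then ratr p.1.2 else 0), (fun n => if c n is Some p then ratr p.2 else 0).
apply/seteqP; split => [[x r] Ox|z [n _]]; last first.
  rewrite /c; case: (unpickle n) => [p|] /=; last by case=> _ /andP[/lt_trans/[apply]]; rewrite ltxx.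
  case: ifPn => [/asboolP|_]; first by apply.
  by case=> _ /andP[/lt_trans/[apply]]; rewrite ltxx.
have /nbhs_ballP[e /= e0 eO] := open_nbhs_nbhs (conj oO Ox).
have lo (y : R) : {p : rat | y - e < ratr p < y}.
  by apply: cid; have [q] := @rat_in_itvoo R (y - e) y ltac:(by rewrite ltrBlDr ltrDl); exists q.
have hi (y : R) : {p : rat | y < ratr p < y + e}.
  by apply: cid; have [q] := @rat_in_itvoo R y (y + e) ltac:(by rewrite ltrDl); exists q.
pose p : code := (\row_i sval (lo (x 0 i)), \row_i sval (hi (x 0 i)), sval (lo r), sval (hi r)).
have pO : inO p.
  apply/asboolP => -[x' r'] [/= H1 H2]; apply: eO; split => /=.
    split => // i j; rewrite (ord1 i) /ball/= distrC.
    have := H1 j; rewrite /A /B !mxE /=.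
    case: (lo _) => a /= /andP[a1 a2]; case: (hi _) => b /= /andP[b1 b2] /andP[c1 c2].
    by rewrite ltr_distlC; apply/andP; split; lra.
  rewrite /ball/= distrC ltr_distlC; move: H2.
  case: (lo _) => a /= /andP[a1 a2]; case: (hi _) => b /= /andP[b1 b2] /andP[c1 c2].
  by apply/andP; split; lra.
exists (pickle p) => //; rewrite /c pickleK pO; split => /=.
  move=> i; rewrite /A/B !mxE/=.
  by case: (lo _) => a /= /andP[a1 a2]; case: (hi _) => b /= /andP[b1 b2]; apply/andP.
by case: (lo _) => a /= /andP[a1 a2]; case: (hi _) => b /= /andP[b1 b2]; apply/andP.
Qed.

Lemma open_measurable_st (O : set ('rV[R]_d * R)) : open O -> measurable (O : set ST).
Proof.
move=> /open_stbox_cover[a [b [s [t ->]]]].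
by apply: bigcupT_measurable => n; exact: measurable_stbox.
Qed.

Lemma open_measurable_rV (O : set 'rV[R]_d) : open O -> measurable O.
Proof.
move=> oO.
have mO : measurable ((fst @^-1` O) : set ST).
  apply: open_measurable_st; apply: open_comp => // x _; exact: cvg_fst.
have mp : measurable_fun setT (fun x : 'rV[R]_d => (x, 0) : ST).
  by apply: measurable_fun_pair => //; exact: measurable_id.
by have := mp measurableT _ mO; rewrite setTI.
Qed.

Lemma continuous_measurable_st (f : 'rV[R]_d * R -> R) : continuous f ->
  measurable_fun setT (f : ST -> R).
Proof.
move=> cf; apply: (measurability _ (RGenOInfty.measurableE R)) => //.
move=> /= _ [_ [x ->] <-]; rewrite setTI.
apply: open_measurable_st; apply: open_comp => [y _|]; first exact: cf.
by rewrite set_itvE; exact: open_gt.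
Qed.

End borel_sets.

Section lebesgue_sigma_finite.
Context {R : realType} {d : nat}.
Local Notation ST := ('rV[R]_d * measurableTypeR R)%type.

Lemma leb_bounded_lty (A : set 'rV[R]_d) : measurable A -> bounded_set A ->
  (leb d A < +oo)%E.
Proof.
move=> mA [M [Mr HM]].
pose k : R := `|M| + 1; have kM : M < k by apply: le_lt_trans (ler_norm _) _; rewrite ltrDl.
have H x : A x -> `|x| <= k by move=> Ax; exact: HM.
have k0 : 0 <= k by rewrite addr_ge0.
pose a : 'rV[R]_d := const_mx (- (k + 1)); pose b : 'rV[R]_d := const_mx (k + 1).
have ab i : a 0 i <= b 0 i by rewrite !mxE; lra.
have mB : measurable [set x : 'rV[R]_d | forall i, a 0 i < x 0 i <= b 0 i].
  rewrite (_ : mkset _ = \bigcap_(i in [set: 'I_d])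
    ((fun x : 'rV[R]_d => x 0 i) @^-1` `]a 0 i, b 0 i])).
    apply: fin_bigcap_measurable => // i _.
    have := @measurable_coord R d i measurableT [set` `]a 0 i, b 0 i]].
    by rewrite setTI; apply; exact: measurable_itv.
  apply/seteqP; split => x /= L i; last by have := L i I; rewrite /= in_itv.
  by move=> _; rewrite /= in_itv /=; exact: L.
apply: (@le_lt_trans _ _ (leb d [set x : 'rV[R]_d | forall i, a 0 i < x 0 i <= b 0 i])).
  apply: le_measure; rewrite ?inE// => x /H xk i; rewrite !mxE.
  have : `|x 0 i| <= k.
    apply: le_trans xk; rewrite [leRHS]mx_normrE.
    exact: (le_bigmax _ (fun ij : 'I_1 * 'I_d => `|x ij.1 ij.2|) (ord0, i)).
  by rewrite ler_norml => /andP[? ?]; apply/andP; split; lra.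
by rewrite leb_box// ltry.
Qed.

Lemma leb_sigma_finite : sigma_finite [set: 'rV[R]_d] (leb d).
Proof.
exists (fun n : nat => [set x : 'rV[R]_d | `|x| < n%:R]).
  apply/seteqP; split => // x _.
  exists (Num.truncn `|x|).+1 => //=; exact: truncnS_gt.
have op (n : nat) : open [set x : 'rV[R]_d | `|x| < n%:R].
  rewrite (_ : mkset _ = (fun x : 'rV[R]_d => `|x|) @^-1` [set y | y < n%:R])//.
  by apply: open_comp => [x _|]; [exact: norm_continuous|exact: open_lt].
move=> n; have mn := open_measurable_rV (op n); split => //.
apply: leb_bounded_lty => //; exists n%:R; split; first by rewrite num_real.
by move=> M nM x /= xn; rewrite ltW// (lt_trans xn).
Qed.
End lebesgue_sigma_finite.

(** Lebesgue measure under a name that carries its sigma-finiteness, as Fubini's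
    theorem asks for. *)
Definition lebn {R : realType} (d : nat) : set 'rV[R]_d -> \bar R := leb d.
HB.instance Definition _ {R : realType} (d : nat) := Measure.copy (@lebn R d) (leb d).
HB.instance Definition _ {R : realType} (d : nat) :=
  Measure_isSigmaFinite.Build _ _ _ (@lebn R d) (@leb_sigma_finite R d).
Definition lebs {R : realType} d : {sigma_finite_measure set 'rV[R]_d -> \bar R} := @lebn R d.

(** * The fundamental lemma of the calculus of variations *)
Lemma Rintegral_dominated_cvg {R : realType} dm (X : measurableType dm)
    (mu : {measure set X -> \bar R}) (D : set X) (f_ : nat -> X -> R) (f g : X -> R) :
  measurable D -> (forall n, measurable_fun D (f_ n)) ->
  (forall x, D x -> f_ n x @[n --> \oo] --> f x) ->
  mu.-integrable D (EFin \o g) -> (forall n x, D x -> `|f_ n x| <= g x) ->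
  mu.-integrable D (EFin \o f) /\
  \int[mu]_(x in D) f_ n x @[n --> \oo] --> \int[mu]_(x in D) f x.
Proof.
move=> mD mf fcvg ig fg.
have mlim : measurable_fun D f by apply: (@measurable_fun_cvg _ _ _ D f_).
have fcvg' : {ae mu, forall x, D x -> (EFin \o f_ n) x @[n --> \oo] --> (EFin \o f) x}.
  by apply: aeW => x Dx; apply: cvg_EFin; [exact: nearW|exact: fcvg].
have fg' : {ae mu, forall x n, D x -> (`|(EFin \o f_ n) x| <= (EFin \o g) x)%E}.
  by apply: aeW => x n Dx; rewrite lee_fin; exact: fg.
have mf' n : measurable_fun D (EFin \o f_ n) by exact/measurable_EFinP.
have mlim' : measurable_fun D (EFin \o f) by exact/measurable_EFinP.
have [intf _ cv] := dominated_convergence mD mf' mlim' fcvg' ig fg'.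
split => //; apply: fine_cvg; rewrite fineK//.
exact: integrable_fin_num.
Qed.

Section fundamental_lemma.
Context {R : realType} {d : nat}.
Local Notation ST := ('rV[R]_d * measurableTypeR R)%type.
Implicit Types (g : ST -> R) (a b : 'rV[R]_d) (s t : R).

Let boxes : set (set ST) := [set B | exists a b s t, B = stbox a b s t].

Lemma stboxI a b s t a' b' s' t' : stbox a b s t `&` stbox a' b' s' t' =
  stbox (\row_i Num.max (a 0 i) (a' 0 i)) (\row_i Num.min (b 0 i) (b' 0 i))
    (Num.max s s') (Num.min t t').
Proof.
apply/seteqP; split => [z [[H1 /andP[s1 t1]] [H2 /andP[s2 t2]]]|z [H /andP[]]].
  split; last by rewrite gt_max lt_min; apply/andP; split; apply/andP.
  move=> i; rewrite !mxE gt_max lt_min.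
  by have /andP[? ?] := H1 i; have /andP[? ?] := H2 i; apply/andP; split; apply/andP.
rewrite gt_max lt_min => /andP[s1 s2] /andP[t1 t2]; split; split; try exact/andP.
- move=> i; have := H i; rewrite !mxE gt_max lt_min.
  by move=> /andP[/andP[? ?] /andP[? ?]]; apply/andP.
- move=> i; have := H i; rewrite !mxE gt_max lt_min.
  by move=> /andP[/andP[? ?] /andP[? ?]]; apply/andP.
Qed.

Lemma measurable_stE : (measurable : set (set ST)) = <<s boxes >>.
Proof.
apply/seteqP; split; last first.
  apply: smallest_sub; first exact: sigma_algebra_measurable.
  by move=> _ [a [b [s [t ->]]]]; exact: measurable_stbox.
pose G := g_sigma_algebraType boxes.
have mO (f : ST -> R) : continuous (f : 'rV[R]_d * R -> R) ->
    measurable_fun setT (f : G -> measurableTypeR R).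
  move=> cf; apply: (measurability _ (RGenOInfty.measurableE R)) => //.
  move=> /= _ [_ [x ->] <-]; rewrite setTI.
  have : open (f @^-1` `]x, +oo[ : set ('rV[R]_d * R)).
    apply: open_comp => [y _|]; first exact: cf.
    by rewrite set_itvE; exact: open_gt.
  move=> /open_stbox_cover[a [b [s [t ->]]]].
  apply: sigma_algebra_bigcup => n; apply: sub_sigma_algebra.
  by exists (a n), (b n), (s n), (t n).
have mi : measurable_fun setT (id : G -> ST).
  rewrite (_ : (id : G -> ST) = fun z : G => ((z : ST).1, (z : ST).2)); last first.
    by apply/funext => -[].
  apply: measurable_fun_pair.
    apply: measurable_fun_rVP => i; apply: mO.
    move=> z; apply: (@cvg_comp _ _ _ fst (fun x : 'rV[R]_d => x 0 i)); first exact: cvg_fst.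
    exact: coord_continuous.
  by apply: mO => z; exact: cvg_snd.
by move=> A mA; have := mi measurableT A mA; rewrite setTI.
Qed.

(** Boxes are stable under intersection and generate the Borel sets, so the
    integral of [g] vanishes over every Borel set. *)
Lemma ae_eq0_stbox g a0 b0 s0 t0 : leb_st.-integrable setT (EFin \o g) ->
  (forall z, ~ stbox a0 b0 s0 t0 z -> g z = 0) ->
  (forall a b s t, \int[leb_st]_(z in stbox a b s t) g z = 0) ->
  {ae leb_st, forall z, g z = 0}.
Proof.
move=> ig off H.
have igS A : measurable A -> leb_st.-integrable A (EFin \o g).
  by move=> mA; apply: integrableS ig.
have onbox a b s t : (\int[leb_st]_(z in stbox a b s t) (g z)%:E = 0)%E.
  have := H a b s t; rewrite /Rintegral => E.
  rewrite -(@fineK _ (\int[_]_(_ in _) _)%E) ?E//.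
  apply: integrable_fin_num; last exact: igS (measurable_stbox a b s t).
  exact: measurable_stbox.
have total : (\int[leb_st]_z (g z)%:E = 0)%E.
  transitivity (\int[leb_st]_(z in stbox a0 b0 s0 t0) (g z)%:E)%E; last exact: onbox.
  rewrite [RHS]integral_mkcond; apply: eq_integral => z _; rewrite patchE.
  by case: ifPn => // /negP; rewrite inE => /off ->.
have H0 A : measurable A -> (\int[leb_st]_(z in A) (g z)%:E = 0)%E.
  move=> mA; apply: (@dynkin_induction _ _ boxes
    (fun A : set ST => (\int[leb_st]_(z in A) (g z)%:E = 0)%E)).
  - exact: measurable_stE.
  - move=> _ _ [a [b [s [t ->]]]] [a' [b' [s' [t' ->]]]]; rewrite stboxI.
    by do 4 eexists.
  - exact: total.
  - by move=> _ [a [b [s [t ->]]]]; exact: onbox.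
  - move=> S mS S0; move: total.
    rewrite -(setUv S) integral_setU//; last 3 first.
    + exact: measurableC.
    + by rewrite setUv; exact: measurable_int ig.
    + by apply/disj_setPS => z [].
    by rewrite S0 add0e.
  - move=> F mF tF F0.
    rewrite integral_bigcup//; last by apply: igS; exact: bigcupT_measurable.
    by apply: eseries0 => i _ _; exact: F0.
  - by rewrite -measurable_stE.
have E : ae_eq leb_st setT (EFin \o g) (cst 0%E).
  apply: integral_ae_eq => // E _ mE.
  by rewrite integral0; exact: H0.
by apply: ae_imp E => z /(_ I)[].
Qed.

End fundamental_lemma.

Lemma cvg_prodr {R : realType} (I : Type) (s : seq I) (f : I -> nat -> R)
    (a : I -> R) : (forall i, f i n @[n --> \oo] --> a i) ->
  \prod_(i <- s) f i n @[n --> \oo] --> \prod_(i <- s) a i.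
Proof.
move=> H; elim: s => [|i s IH].
  rewrite big_nil [X in X @ _ --> _](_ : _ = cst (1 : R)); first exact: cvg_cst.
  by apply/funext => n; rewrite big_nil.
rewrite big_cons [X in X @ _ --> _](_ : _ = fun n => f i n * \prod_(j <- s) f j n).
  by apply: cvgM.
by apply/funext => n; rewrite big_cons.
Qed.

Section tensor_tests.
Context {R : realType} {d : nat}.
Local Notation ST := ('rV[R]_d * measurableTypeR R)%type.
Implicit Types (a b : 'rV[R]_d).

Definition xbump a b n (x : 'rV[R]_d) : R := \prod_i bump (a 0 i) (b 0 i) n (x 0 i).

Lemma smooth_coord (f : R -> R) i : smooth (f : R^o -> R) ->
  smooth (fun x : 'rV[R]_d => f (x 0 i)).
Proof.
move=> sf; apply: (@smooth_affine _ _ R^o (fun x : 'rV[R]_d => x 0 i) (fun x => x 0 i)) => //.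
- by move=> k h x; rewrite !mxE.
- exact: coord_continuous.
Qed.

Lemma smooth_xbump a b n : smooth (xbump a b n).
Proof. by apply: smooth_prod => i; apply: smooth_coord; exact: smooth_bump. Qed.

Lemma xbump_ge0 a b n x : 0 <= xbump a b n x.
Proof. by apply: prodr_ge0 => i _; exact: bump_ge0. Qed.

Lemma xbump_le1 a b n x : xbump a b n x <= 1.
Proof.
apply: le_trans (_ : \prod_(i < d) 1 <= _); last by rewrite big1_eq.
by apply: ler_prod => i _; rewrite bump_ge0 bump_le1.
Qed.

Lemma xbump_cvg a b (x : 'rV[R]_d) : (forall i, a 0 i < x 0 i < b 0 i) ->
  xbump a b n x @[n --> \oo] --> (1 : R).
Proof.
move=> H; rewrite /xbump.
have := @cvg_prodr R _ (index_enum 'I_d) _ _ (fun i => bump_cvg (H i)).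
by rewrite big1_eq.
Qed.

Lemma xbump_neq0 a b n x i : xbump a b n x != 0 ->
  a 0 i + n%:R^-1 <= x 0 i <= b 0 i - n%:R^-1 /\ (0 < n)%N.
Proof. by rewrite /xbump (bigD1 i)//= mulf_eq0 negb_or => /andP[/bump_neq0]. Qed.

Lemma smooth_fst (V W : normedModType R) (f : V -> R) : smooth f -> smooth (fun z : V * W => f z.1).
Proof.
move=> sf; apply: (@smooth_affine _ (V * W)%type V (fst : V * W -> V) (fst : V * W -> V)) => //.
by move=> z; exact: cvg_fst.
Qed.

Lemma smooth_snd (V W : normedModType R) (f : W -> R) : smooth f -> smooth (fun z : V * W => f z.2).
Proof.
move=> sf; apply: (@smooth_affine _ (V * W)%type W (snd : V * W -> W) (snd : V * W -> W)) => //.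
by move=> z; exact: cvg_snd.
Qed.

Lemma smooth_tensor (A : 'rV[R]_d -> R) (B : R -> R) : smooth A -> smooth (B : R^o -> R) ->
  smooth (fun z : 'rV[R]_d * R => A z.1 * B z.2).
Proof.
move=> sA sB; apply: (@smoothM _ ('rV[R]_d * R)%type (fun z => A z.1) (fun z => B z.2)).
  exact: smooth_fst.
exact: (@smooth_snd 'rV[R]_d R^o).
Qed.

Lemma tensor_test a b n (B : R -> R) s t (D : set ST) :
  smooth (B : R^o -> R) -> (forall r, ~~ (s <= r <= t) -> B r = 0) ->
  (forall (x : 'rV[R]_d) r, (forall i, a 0 i < x 0 i < b 0 i) -> s <= r <= t -> D (x, r)) ->
  @test_function R ('rV[R]_d * R)%type D (fun z => xbump a b n.+1 z.1 * B z.2).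
Proof.
move=> sB B0 HD; split; first by apply: smooth_tensor => //; exact: smooth_xbump.
(* bumps vanish within this distance from the boundary of the box *)
pose c : R := n.+1%:R^-1; have c0 : 0 < c by rewrite invr_gt0.
exists ([set x : 'rV[R]_d | forall i, `[a 0 i + c, b 0 i - c]%classic (x ord0 i)] `*` `[s, t]%classic).
  apply: compact_setX; last exact: segment_compact.
  by apply: (rV_compact (A := fun i => `[a 0 i + c, b 0 i - c]%classic)) => i; exact: segment_compact.
split=> [[x r] [/= H]|[x r] /= nK].
  rewrite in_itv/= => st; apply: HD => // i.
  by have := H i; rewrite in_itv/= => /andP[? ?]; apply/andP; split; lra.
apply/eqP/negP => /negP; rewrite mulf_eq0 negb_or => /andP[x0 r0]; apply: nK; split => /=.
  by move=> i; rewrite in_itv/=; have [] := xbump_neq0 i x0.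
by rewrite in_itv/=; apply: contraNT r0 => /B0 ->.
Qed.

Lemma measurable_tensor a b n (B : R -> R) : smooth (B : R^o -> R) ->
  measurable_fun setT (fun z : ST => xbump a b n z.1 * B z.2).
Proof.
move=> sB; apply: (@continuous_measurable_st R d); apply: smooth_continuous.
by apply: smooth_tensor => //; exact: smooth_xbump.
Qed.

(** The fundamental lemma of the calculus of variations; products of bumps of
    one variable are enough, because they increase to indicators of boxes. *)
Lemma fundamental_lemma (Q : set ('rV[R]_d * R)) (g : ST -> R) : open Q ->
  leb_st.-integrable (Q : set ST) (EFin \o g) ->
  (forall a b s t n, stbox a b s t `<=` Q ->
    \int[leb_st]_(z in Q) (g z * (xbump a b n.+1 z.1 * bump s t n.+1 z.2)) = 0) ->
  {ae leb_st, forall z, Q z -> g z = 0}.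
Proof.
move=> oQ ig H; have mQ := open_measurable_st oQ.
have mg := measurable_int _ ig; move/measurable_EFinP in mg.
have box0 a b s t : stbox a b s t `<=` Q -> \int[leb_st]_(z in stbox a b s t) g z = 0.
  move=> BQ.
  have [||||_] := @Rintegral_dominated_cvg R _ ST leb_st Q
    (fun n z => g z * (xbump a b n.+1 z.1 * bump s t n.+1 z.2))
    (fun z => g z * \1_(stbox a b s t) z) (fun z => `|g z|) mQ.
  - move=> n; apply: measurable_funM => //; apply: measurable_funTS.
    by apply: measurable_tensor; exact: smooth_bump.
  - move=> z Qz; apply: cvgM; first exact: cvg_cst.
    have [[H1 H2]|nB] := pselect (stbox a b s t z).
      rewrite indicE mem_set//=; rewrite -[X in _ --> X](mulr1 (1 : R)).
      apply: cvgM.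
        by move: (xbump_cvg H1); rewrite -cvg_shiftS.
      by move: (bump_cvg H2); rewrite -cvg_shiftS.
    rewrite indicE memNset//= [X in X @ _ --> _](_ : _ = cst 0); first exact: cvg_cst.
    apply/funext => n /=; apply/eqP/negP => /negP; rewrite mulf_eq0 negb_or => /andP[x0 r0].
    apply: nB; split; last by apply: contraNT r0 => /bump_out ->.
    move=> i; apply: contraNT x0 => ni; rewrite /xbump (bigD1 i)//= bump_out//.
    by rewrite mul0r.
  - by apply/integrable_abse: ig.
  - move=> n z Qz; rewrite normrM ler_piMr// ger0_norm; last first.
      by rewrite mulr_ge0// ?xbump_ge0// bump_ge0.
    by rewrite mulr_ile1// ?xbump_ge0 ?xbump_le1 ?bump_ge0 ?bump_le1.
  rewrite (_ : (fun n => _) = cst 0); last by apply/funext => n; exact: H.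
  move=> /(cvg_lim (@Rhausdorff R)); rewrite lim_cst// => E.
  rewrite -[stbox a b s t](setIidr BQ) Rintegral_mkcondr E.
  apply: eq_Rintegral => z _; rewrite patchE indicE.
  by case: ifP => _; rewrite ?mulr1 ?mulr0.
have [A [B [S [T QE]]]] := open_stbox_cover oQ.
have boxn n : {ae leb_st, forall z, stbox (A n) (B n) (S n) (T n) z -> g z = 0}.
  set B0 := stbox _ _ _ _.
  have B0Q : B0 `<=` Q by rewrite QE => z ?; exists n.
  have mB0 : measurable B0 by exact: measurable_stbox.
  have E : {ae leb_st, forall z, (g \_ B0) z = 0}.
    apply: (@ae_eq0_stbox R d _ (A n) (B n) (S n) (T n)).
    - have /(integrable_mkcond _ mB0) := integrableS mQ mB0 B0Q ig.
      by rewrite restrict_EFin.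
    - by move=> z nB; rewrite patchE memNset.
    - move=> a b s t; rewrite -Rintegral_mkcondr stboxI; apply: box0.
      by rewrite -stboxI => z [_ ?]; exact: B0Q.
  by apply: ae_imp E => z + zB; rewrite patchE mem_set.
have E := ae_foralln boxn; apply: ae_imp E => z zE; rewrite QE => -[n _]; exact: zE.
Qed.

End tensor_tests.

(** * Weak derivatives *)
Section weak_derivatives.
Context {R : realType} {d : nat}.
Local Notation ST := ('rV[R]_d * measurableTypeR R)%type.
Variables (Om : set 'rV[R]_d) (T : R).
Hypotheses (oOm : open Om) (bOm : bounded_set Om).
Local Notation Q := (cylinder Om T).
Local Notation nu := (@leb_st R d).
Implicit Types (w g : ST -> R) (phi : 'rV[R]_d * R -> R).

Lemma open_cylinder : @open ('rV[R]_d * R)%type Q.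
Proof.
rewrite (_ : Q = (fst @^-1` Om) `&` (snd @^-1` `]0, T[))//.
apply: openI; first by apply: open_comp => // x _; exact: cvg_fst.
by apply: open_comp => [x _|]; [exact: cvg_snd|exact: interval_open].
Qed.

Lemma measurable_Om : measurable Om. Proof. exact: open_measurable_rV. Qed.

Lemma measurable_cylinder : measurable Q.
Proof. exact: (open_measurable_st open_cylinder). Qed.

Lemma leb_Om_lty : (leb d Om < +oo)%E.
Proof. exact: leb_bounded_lty measurable_Om bOm. Qed.

Lemma cylinder_lty : (nu Q < +oo)%E.
Proof.
have -> : nu Q = (leb d Om * @lebesgue_measure R `]0%R, T[%classic)%E.
  exact: (@product_measure1E _ _ _ _ R (lebs d) (@lebesgue_measure R) Om `]0, T[%classic
    measurable_Om (measurable_itv _)).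
rewrite lebesgue_measure_itv/=; case: ifP => _; last by rewrite mule0.
by rewrite lte_mul_pinfty// ?ge0_fin_numE// ?leb_Om_lty// ltry.
Qed.

Lemma compact_closure_bounded : compact (closure Om).
Proof.
apply: bounded_closed_compact; last exact: closed_closure.
case: bOm => M [Mr H]; exists M; split => // k Mk x /=.
rewrite closureE => /(_ [set y | `|y| <= k]); apply; split; last exact: H.
rewrite (_ : mkset _ = (fun y : 'rV[R]_d => `|y|) @^-1` [set r | r <= k])//.
by apply: preimage_closed => [y _|]; [exact: norm_continuous|exact: closed_le].
Qed.

Lemma continuous_bounded phi : continuous phi ->
  exists M, forall x t, closure Om x -> 0 <= t <= T -> `|phi (x, t)| <= M.
Proof.
move=> cphi.
have cK : compact (closure Om `*` `[0, T]%classic : set ('rV[R]_d * R)).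
  apply: compact_setX; last exact: segment_compact.
  exact: compact_closure_bounded.
have /compact_bounded[M [_ HM]] : compact (phi @` (closure Om `*` `[0, T]%classic)).
  by apply: continuous_compact cK; exact: continuous_subspaceT.
exists (`|M| + 1) => x t cx t0T.
apply: HM; first by apply: le_lt_trans (ler_norm _) _; rewrite ltrDl.
by exists (x, t) => //; split => //=; rewrite in_itv.
Qed.

Lemma continuous_L2Q phi : continuous phi -> L2Q Om T phi.
Proof.
move=> cphi; have [M HM] := continuous_bounded cphi.
apply: (L2_bounded measurable_cylinder (M := M) cylinder_lty).
  by apply: measurable_funTS; exact: continuous_measurable_st.
move=> [x t] [/= Ox]; rewrite in_itv/= => /andP[t0 tT].
by apply: HM; [exact: subset_closure|rewrite !ltW].
Qed.

Lemma smooth_L2Q phi : smooth phi -> L2Q Om T phi.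
Proof. by move=> sphi; apply: continuous_L2Q; exact: smooth_continuous. Qed.

Lemma test_derive (D : set ('rV[R]_d * R)) phi h : test_function D phi -> test_function D ('D_h phi).
Proof.
move=> [sphi [K cK [KD K0]]]; split; first exact: smooth_derive.
exists K => //; split => // x nKx.
have oK : open (~` K) by apply: closed_openC; apply: compact_closed cK; exact: norm_hausdorff.
rewrite (@near_eq_derive R ('rV[R]_d * R)%type R^o phi (cst 0) x h) ?derive_cst//.
by have := open_nbhs_nbhs (conj oK nKx); apply: filterS => y; exact: K0.
Qed.

Lemma wderivP h w : has_wderiv Om T h w -> is_wderiv Om T h w (wderiv Om T h w).
Proof. by move=> H; rewrite /wderiv; case: xgetP => // /(_ _ (svalP (cid H))). Qed.

Lemma wdivP y : has_wdiv_x Om T y -> is_wdiv_x Om T y (div_x Om T y).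
Proof. by move=> H; rewrite /div_x; case: xgetP => // /(_ _ (svalP (cid H))). Qed.

Lemma test_integrable w phi h : L2Q Om T w -> smooth phi ->
  nu.-integrable Q (EFin \o (fun z => w z * phi z)) /\
  nu.-integrable Q (EFin \o (fun z => w z * 'D_h phi z)).
Proof.
move=> w2 sphi; split; first exact: (L2M measurable_cylinder w2 (smooth_L2Q sphi)).
exact: (L2M measurable_cylinder w2 (smooth_L2Q (smooth_derive h sphi))).
Qed.

Lemma is_wderivB h w1 w2 g1 g2 : L2Q Om T w1 -> L2Q Om T w2 ->
  is_wderiv Om T h w1 g1 -> is_wderiv Om T h w2 g2 ->
  is_wderiv Om T h (fun z => w1 z - w2 z) (fun z => g1 z - g2 z).
Proof.
move=> w12 w22 [g12 H1] [g22 H2]; split; first exact: (L2B measurable_cylinder g12 g22).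
move=> phi tphi; have sphi := tphi.1.
have [_ i1] := test_integrable h w12 sphi; have [_ i2] := test_integrable h w22 sphi.
have [i3 _] := test_integrable h g12 sphi; have [i4 _] := test_integrable h g22 sphi.
transitivity (\int[nu]_(z in Q) (w1 z * 'D_h phi z) - \int[nu]_(z in Q) (w2 z * 'D_h phi z)).
  rewrite -(RintegralB measurable_cylinder i1 i2).
  by apply: eq_Rintegral => z _; rewrite mulrBl.
rewrite H1// H2//.
transitivity (- (\int[nu]_(z in Q) (g1 z * phi z) - \int[nu]_(z in Q) (g2 z * phi z))).
  by rewrite opprB addrC opprK.
rewrite -(RintegralB measurable_cylinder i3 i4).
by congr (- _); apply: eq_Rintegral => z _; rewrite mulrBl.
Qed.

Lemma is_wderiv_unique h w g1 g2 :
  is_wderiv Om T h w g1 -> is_wderiv Om T h w g2 ->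
  {ae nu, forall z, Q z -> g1 z = g2 z}.
Proof.
move=> [g12 H1] [g22 H2].
have E : {ae nu, forall z, Q z -> g1 z - g2 z = 0}.
  apply: (fundamental_lemma open_cylinder).
    apply: (L2_integrable measurable_cylinder cylinder_lty).
    exact: (L2B measurable_cylinder g12 g22).
  move=> a b s t n BQ; set phi : ST -> R := fun z : ST => xbump a b n.+1 z.1 * bump s t n.+1 z.2.
  have tphi : @test_function R ('rV[R]_d * R)%type Q phi.
    have n0 : 0 < n.+1%:R^-1 :> R by rewrite invr_gt0.
    have := @tensor_test R d a b n (bump s t n.+1) (s + n.+1%:R^-1) (t - n.+1%:R^-1) Q
      (smooth_bump s t n.+1).
    apply=> [r|x r H sr]; first by apply: contraNeq => /bump_neq0[].
    by apply: BQ; split => //=; move: sr => /andP[s1 s2]; rewrite (lt_le_trans _ s1) ?ltrDl//= (le_lt_trans s2)// ltrBlDr ltrDl.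
  have [i1 _] := test_integrable h g12 tphi.1; have [i2 _] := test_integrable h g22 tphi.1.
  transitivity (\int[nu]_(z in Q) (g1 z * phi z) - \int[nu]_(z in Q) (g2 z * phi z)).
    rewrite -(RintegralB measurable_cylinder i1 i2).
    by apply: eq_Rintegral => z _; rewrite /phi mulrBl.
  have := H1 _ tphi; rewrite (H2 _ tphi) => /oppr_inj ->; exact: subrr.
by apply: ae_imp E => z H Qz; apply/eqP; rewrite -subr_eq0 H.
Qed.

Lemma is_wdiv_xB y1 y2 g1 g2 : L2vQ Om T y1 -> L2vQ Om T y2 ->
  is_wdiv_x Om T y1 g1 -> is_wdiv_x Om T y2 g2 ->
  is_wdiv_x Om T (fun z => y1 z - y2 z) (fun z => g1 z - g2 z).
Proof.
move=> y12 y22 [g12 H1] [g22 H2]; split; first exact: (L2B measurable_cylinder g12 g22).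
move=> phi tphi; have sphi := tphi.1.
have iy (y : ST -> 'rV[R]_d) : L2vQ Om T y -> nu.-integrable Q (EFin \o
    (fun z => \sum_i y z 0 i * 'D_(e_x i) phi z)).
  move=> yL.
  apply: (@Rintegral_sum R _ ST nu Q measurable_cylinder _ (index_enum 'I_d)
    (fun i z => y z 0 i * 'D_(e_x i) phi z) _).1.
  by move=> i; have [] := test_integrable (e_x i) (yL i) sphi.
have [i3 _] := test_integrable 0 g12 sphi; have [i4 _] := test_integrable 0 g22 sphi.
transitivity (\int[nu]_(z in Q) (\sum_i y1 z 0 i * 'D_(e_x i) phi z) -
  \int[nu]_(z in Q) (\sum_i y2 z 0 i * 'D_(e_x i) phi z)).
  rewrite -(RintegralB measurable_cylinder (iy _ y12) (iy _ y22)).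
  apply: eq_Rintegral => z _; rewrite -sumrB; apply: eq_bigr => i _.
  by rewrite !mxE mulrBl.
rewrite H1// H2//.
transitivity (- (\int[nu]_(z in Q) (g1 z * phi z) - \int[nu]_(z in Q) (g2 z * phi z))).
  by rewrite opprB addrC opprK.
rewrite -(RintegralB measurable_cylinder i3 i4).
by congr (- _); apply: eq_Rintegral => z _; rewrite mulrBl.
Qed.

(** Weak derivatives commute because the derivatives of test functions do. *)
Lemma is_wderiv_mixed h k w g q rho : is_wderiv Om T k w g -> is_wderiv Om T h w q ->
  is_wderiv Om T h g rho -> is_wderiv Om T k q rho.
Proof.
move=> [g2 Hg] [q2 Hq] [rho2 Hr]; split; first exact: rho2.
move=> phi tphi.
have := Hr phi tphi; have := Hq _ (test_derive k tphi); have := Hg _ (test_derive h tphi).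
move=> Eg Eq Er.
apply: oppr_inj; apply: etrans (esym Eq) _; rewrite -Er; apply: etrans _ Eg.
apply: eq_Rintegral => z _.
have E := @derive_mixed R ('rV[R]_d * R)%type phi z k h tphi.1.
exact: (congr1 (fun r => w z * r) E).
Qed.

End weak_derivatives.

(** * Functions with a weak derivative in time *)
Section patches.
Context {R : realType} dm (X : measurableType dm) (mu : {measure set X -> \bar R}).
Variable D : set X.
Hypothesis mD : measurable D.

Lemma L2_patch (f : X -> R) : L2 mu D f -> L2 mu setT (f \_ D).
Proof.
move=> [mf f2]; split; first exact/(measurable_restrictT _ mD).
have /(integrable_mkcond _ mD) := f2.
rewrite restrict_EFin (_ : (fun x => f x ^+ 2) \_ D = (fun x => (f \_ D) x ^+ 2))//.
by apply/funext => x; rewrite !patchE; case: ifP => // _; rewrite expr0n.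
Qed.

Lemma L2_unpatch (f : X -> R) : L2 mu setT f -> L2 mu D f.
Proof.
move=> [mf f2]; split; first exact: measurable_funTS.
exact: integrableS f2.
Qed.
End patches.

Section fubini_real.
Context {R : realType} d1 d2 (X : measurableType d1) (Y : measurableType d2).
Variables (m1 : {sigma_finite_measure set X -> \bar R}) (m2 : {sigma_finite_measure set Y -> \bar R}).
Variable f : X * Y -> R.
Hypothesis fi : (m1 \x m2)%E.-integrable setT (EFin \o f).

Lemma Rintegral_fubini :
  [/\ {ae m1, forall x, m2.-integrable setT (EFin \o (fun y => f (x, y)))},
      m1.-integrable setT (EFin \o (fun x => \int[m2]_y f (x, y))) &
      \int[(m1 \x m2)%E]_z f z = \int[m1]_x \int[m2]_y f (x, y)].
Proof.
have mf : measurable_fun setT f by apply/measurable_EFinP; exact: measurable_int fi.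
have ai := ae_integrable1 fi.
have Fi := integrable_fubini_F fi.
have mF := measurable_Rintegral_snd m2 mf.
have E : ae_eq m1 setT (fubini_F m2 (EFin \o f)) (EFin \o (fun x => \int[m2]_y f (x, y))).
  apply: ae_imp ai => x ix _; rewrite /= /fubini_F /Rintegral fineK//.
  exact: integrable_fin_num ix.
have mF' : measurable_fun setT (EFin \o (fun x => \int[m2]_y f (x, y))) by exact/measurable_EFinP.
split.
- exact: ai.
- apply/integrableP; split => //.
  have E' : ae_eq m1 setT (fun x => `|fubini_F m2 (EFin \o f) x|)%E
      (fun x => `|(\int[m2]_y f (x, y))%:E|)%E.
    by apply: ae_imp E => x H xT; rewrite H.
  have mFi := measurable_int _ Fi.
  have /integrableP[_] := Fi; apply: le_lt_trans; rewrite le_eqVlt; apply/orP; left.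
  have m1' : measurable_fun setT (fun x => `|fubini_F m2 (EFin \o f) x|)%E.
    exact: measurableT_comp.
  have m2' : measurable_fun setT (fun x => `|(\int[m2]_y f (x, y))%:E|)%E.
    exact: measurableT_comp.
  have E2 := ae_eq_integral _ _ measurableT m1' m2' E'.
  by apply/eqP; apply: etrans (esym E2) _.
- rewrite /Rintegral -integral12_prod_meas1//; congr fine.
  exact: (ae_eq_integral _ _ measurableT (measurable_int _ Fi) mF' E).
Qed.
End fubini_real.

Section antiderivatives.
Context {R : realType}.
Local Notation leb1 := (@lebesgue_measure R).
Variables (f : R -> R) (s t : R).
Hypotheses (sf : smooth (f : R^o -> R)) (f0 : forall r, ~~ (s <= r <= t) -> f r = 0).

Let cf : continuous f. Proof. exact: (@smooth_continuous R R^o). Qed.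

Lemma integrable_compact_support : leb1.-integrable setT (EFin \o f).
Proof.
have : leb1.-integrable `[s, t] (EFin \o f).
  by apply: continuous_compact_integrable; [exact: segment_compact|exact: continuous_subspaceT].
have mI : measurable (`[s, t]%classic : set (measurableTypeR R)) by exact: measurable_itv.
move/(integrable_mkcond _ mI); rewrite restrict_EFin.
rewrite (_ : f \_ `[s, t] = f)//; apply/funext => r; rewrite patchE.
by case: ifPn => //; rewrite mem_setE in_itv/= => /f0 ->.
Qed.

Lemma is_derive_primitive r : derivable (primitive f) r 1 /\ 'D_1 (primitive f) r = f r.
Proof.
have ru : r < r + 1 by rewrite ltrDl.
have fi : leb1.-integrable `]-oo, (r + 1)] (EFin \o f).
  by apply: integrableS integrable_compact_support => //; exact: measurable_itv.
have [H1 H2] := continuous_FTC1 ru fi (ltNyr _) (@cf r).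
by split; [exact: H1|rewrite -derive1E].
Qed.

Lemma smooth_primitive : smooth (primitive f : R^o -> R).
Proof.
have cp : continuous (primitive f).
  move=> r; apply: differentiable_continuous; apply/derivable1_diffP.
  by have [] := is_derive_primitive r.
apply/smoothP => -[|n].
  by [].
apply: csmooth_R => //; first by move=> r; have [] := is_derive_primitive r.
rewrite (_ : 'D_1 (primitive f) = f); last first.
  by apply/funext => r; have [] := is_derive_primitive r.
by have /(@smoothP R R^o) := sf; exact.
Qed.

Lemma primitive_support : \int[leb1]_r f r = 0 ->
  forall r, ~~ (s <= r <= t) -> primitive f r = 0.
Proof.
move=> I0 r; rewrite negb_and -!ltNge => /orP[rs|tr].
  rewrite /primitive (eq_Rintegral _ (g := cst 0)); first by rewrite Rintegral_cst// mul0r.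
  move=> q; rewrite inE/= in_itv/= => qr; apply: f0.
  by rewrite negb_and -ltNge (le_lt_trans qr rs).
rewrite -I0 /primitive [LHS]Rintegral_mkcond; apply: eq_Rintegral => q _.
rewrite patchE; case: ifPn => //; rewrite mem_setE in_itv/= -ltNge => rq; rewrite f0//.
by rewrite negb_and -!ltNge (lt_trans tr rq) orbT.
Qed.

End antiderivatives.

Section time_antiderivative.
Context {R : realType} {d : nat}.
Local Notation ST := ('rV[R]_d * measurableTypeR R)%type.
Variables (Om : set 'rV[R]_d) (T : R).
Hypotheses (oOm : open Om) (bOm : bounded_set Om) (T0 : 0 < T).
Local Notation Q := (cylinder Om T).
Local Notation nu := (@leb_st R d).
Local Notation P := (lebs d \x @lebesgue_measure R)%E.
Implicit Types (w g : ST -> R) (phi : 'rV[R]_d * R -> R).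

Let mQ : measurable Q. Proof. exact: measurable_cylinder. Qed.

Lemma patch_off_time g (z : ST) : ~~ (0 < (z.2 : R) < T) -> (g \_ Q) z = 0.
Proof. by move=> nz; rewrite patchE memNset// => -[_]; rewrite /= in_itv/=; exact/negP. Qed.

Lemma patch_L2 g : L2Q Om T g -> L2 P setT (g \_ Q).
Proof. exact: (@L2_patch R _ ST leb_st Q mQ). Qed.

Lemma patch_Rintegral g f : \int[nu]_(z in Q) (g z * f z) = \int[nu]_z ((g \_ Q) z * f z).
Proof.
rewrite Rintegral_mkcond; apply: eq_Rintegral => z _; rewrite !patchE.
by case: ifP => // _; rewrite mul0r.
Qed.

Lemma shift_affine (k : R) (z : 'rV[R]_d * R) : k *: (e_t : 'rV[R]_d * R) + z = stshift k z.
Proof.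
case: z => x t; rewrite /e_t /stshift /tshift /= .
by congr (_, _) => /=; rewrite ?scaler0 ?add0r// addrC /GRing.scale/= mulr1.
Qed.

Lemma test_zero phi : @test_function R ('rV[R]_d * R)%type Q phi ->
  forall z, ~ Q z -> phi z = 0.
Proof. by move=> [_ [K cK [KQ K0]]] z nQ; apply: K0 => /KQ. Qed.

Lemma test_bounded phi : @test_function R ('rV[R]_d * R)%type Q phi ->
  exists M, forall z, `|phi z| <= M.
Proof.
move=> tphi; have [M HM] := continuous_bounded T bOm (smooth_continuous tphi.1).
exists (`|M|) => -[x t]; have [[/= Ox]|nQ] := pselect (Q (x, t)).
  rewrite in_itv/= => /andP[t0 tT]; apply: le_trans (ler_norm M).
  by apply: HM; rewrite ?ltW//; exact: subset_closure.
by rewrite test_zero// normr0.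
Qed.

Lemma quotient_mean phi (z : 'rV[R]_d * R) (k : R) : smooth phi -> 0 < k ->
  exists2 c : R, 0 < c < k & (phi (stshift k z) - phi z) / k = 'D_e_t phi (stshift c z).
Proof.
move=> sphi k0.
have df y : derivable phi y (e_t : 'rV[R]_d * R) by exact: smooth_derivable.
have [c ck E] := line_mean_value z k0 df.
exists c => //; rewrite -(shift_affine k z) -(shift_affine c z) E mulrAC divff ?mul1r//.
by rewrite gt_eqF.
Qed.

Lemma quotient_cvg phi (z : 'rV[R]_d * R) (h : nat -> R) : smooth phi ->
  (forall n, 0 < h n) -> h n @[n --> \oo] --> 0 ->
  (phi (stshift (h n) z) - phi z) / h n @[n --> \oo] --> ('D_e_t phi z : R).
Proof.
move=> sphi h0 hcvg.
have cD : continuous (fun c : R => 'D_e_t phi (c *: (e_t : 'rV[R]_d * R) + z)).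
  move=> c.
  apply: (@continuous_comp _ _ _ (fun c : R => c *: (e_t : 'rV[R]_d * R) + z) ('D_e_t phi)); last first.
    by apply: smooth_continuous; exact: smooth_derive.
  by apply: cvgD; [apply: cvgZr_tmp; exact: cvg_id|exact: cvg_cst].
have := cD 0; rewrite /continuous_at /= scale0r add0r => /cvgrPdist_lt H.
apply/cvgrPdist_lt => e e0; have /nbhs_ballP[r /= r0 Hr] := H _ e0.
have /cvgrPdist_lt/(_ _ r0) := hcvg; apply: filterS => n.
rewrite sub0r normrN gtr0_norm// => hr.
have [c /andP[c0 ch] ->] := quotient_mean z sphi (h0 n).
have := Hr c; rewrite /= shift_affine; apply.
by rewrite /ball/= sub0r normrN gtr0_norm// (lt_trans ch).
Qed.

Let h (n : nat) : R := T / n.+2%:R.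
Let h_gt0 n : 0 < h n. Proof. by rewrite divr_gt0. Qed.
Let h_cvg : h n @[n --> \oo] --> 0.
Proof. exact: time_step_cvg. Qed.

(** Up to time [T] the primitive is [T] times the mean of [g] over the preceding
    [T] units of time, which [diffq_L2] bounds. *)
Lemma stprimitive_L2Q g : L2Q Om T g -> L2Q Om T (stprimitive (g \_ Q)).
Proof.
move=> g2; set b := g \_ Q.
have b2 := patch_L2 g2 : L2 _ setT b.
have Tn0 : - T != 0 by rewrite oppr_eq0 gt_eqF.
have [D2 _] := diffq_L2 (mu := lebs d) (T := T) (b := b) (@patch_off_time g) b2 Tn0.
have mG : measurable_fun setT (stprimitive b) by apply: measurable_primitive; exact: b2.1.
apply: (@L2_le R _ ST nu Q mQ _ (fun z => T * diffq (- T) b z)).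
- exact: measurable_funTS.
- by apply: L2Z => //; apply: L2_unpatch.
- move=> [x t] [_ /=]; rewrite in_itv/= => /andP[t0 tT].
  rewrite /diffq /stshift /tshift /=.
  have -> : stprimitive b (x, t - T) = 0.
    rewrite /stprimitive /=; apply: (primitive_le0 (T := T)); last by rewrite subr_le0 ltW.
    by move=> s s0; exact: (@patch_off_time g (x, s)).
  by rewrite sub0r invrN mulrNN mulrC mulfVK// gt_eqF.
Qed.

(** The primitive in time has the expected weak derivative, because difference
    quotients of the primitive are averages of [g], which converge weakly. *)
Lemma is_wderiv_primitive g : L2Q Om T g -> is_wderiv Om T e_t (stprimitive (g \_ Q)) g.
Proof.
move=> g2; split=> // phi tphi; set b := g \_ Q; set G := stprimitive b.
have b2 := patch_L2 g2 : L2 _ setT b.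
have G2 := stprimitive_L2Q g2 : L2Q Om T G.
have p2 := smooth_L2Q T oOm bOm tphi.1.
have pE : phi \_ Q = phi.
  apply/funext => z; rewrite patchE; case: ifPn => // /negP; rewrite inE => nQ.
  by rewrite test_zero.
have p2' : L2 P setT phi by rewrite -pE; exact: patch_L2.
have Gq2 : L2 P setT (G \_ Q) := patch_L2 G2.
(* the difference quotient moves from the test function to the primitive *)
have step n : \int[nu]_(z in Q) (G z * ((phi (stshift (h n) z) - phi z) / h n)) =
    - \int[P]_z (phi z * diffq (- h n) b z).
  rewrite patch_Rintegral; set Gq := G \_ Q.
  have hn0 : h n != 0 by rewrite gt_eqF.
  have shift2 k : L2 P setT (Gq \o stshift k).
    exact: L2_stshift.
  have i1 := L2M measurableT Gq2 (L2_stshift (h n) p2').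
  have i2 := L2M measurableT Gq2 p2'.
  have i3 := L2M measurableT (shift2 (- h n)) p2'.
  have E1 : \int[P]_z (Gq z * (phi \o stshift (h n)) z) =
      \int[P]_z ((Gq \o stshift (- h n)) z * phi z).
    rewrite -(Rintegral_stshift (h n) i3); apply: eq_Rintegral => z _ /=.
    by rewrite stshiftK.
  transitivity ((h n)^-1 * (\int[P]_z ((Gq \o stshift (- h n)) z * phi z)
     - \int[P]_z (Gq z * phi z))).
    rewrite -E1 -(RintegralB measurableT i1 i2) -(RintegralZl _ measurableT (integrableB_EFin measurableT i1 i2)).
    have H (a b1 c k : R) : a * ((b1 - c) / k) = k^-1 * (a * b1 - a * c).
      by rewrite -mulrBr mulrA mulrC.
    by apply: eq_Rintegral => z _; exact: H.
  rewrite -(RintegralB measurableT i3 i2) -(RintegralZl _ measurableT (integrableB_EFin measurableT i3 i2)).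
  apply: oppr_inj; rewrite opprK -mulN1r.
  rewrite -(RintegralZl _ measurableT); last first.
    exact: (integrableZ_EFin measurableT _ (integrableB_EFin measurableT i3 i2)).
  apply: eq_Rintegral => -[x t] _ /=.
  have [[/= Ox]|nQ] := pselect (Q (x, t)); last by rewrite (test_zero tphi nQ) !mulr0 subrr !mulr0 mul0r.
  rewrite in_itv/= => /andP[t0 tT].
  have -> : (G \_ Q) (x, t) = G (x, t) by rewrite patchE mem_set//; split => //=; rewrite in_itv/= t0.
  have -> : Gq (stshift (- h n) (x, t)) = G (stshift (- h n) (x, t)).
    rewrite /Gq patchE; case: ifPn => // /negP; rewrite inE /stshift /tshift /= => nQ.
    rewrite /G /stprimitive /= (primitive_le0 (T := T))//.
      by move=> s s0; exact: (@patch_off_time g (x, s)).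
    rewrite leNgt; apply/negP => th; apply: nQ; split => //=; rewrite in_itv/= th/=.
    by rewrite (lt_trans _ tT)// ltrBlDr ltrDl.
  rewrite /diffq -/G; move: (G _) (G _) (phi _) => A B C.
  by field.
have cvg1 : \int[nu]_(z in Q) (G z * ((phi (stshift (h n) z) - phi z) / h n)) @[n --> \oo] -->
    \int[nu]_(z in Q) (G z * 'D_e_t phi z).
  have [M HM] := test_bounded (test_derive e_t tphi).
  have Gi : nu.-integrable Q (EFin \o G).
    exact: (L2_integrable mQ (cylinder_lty T oOm bOm) G2).
  have mG : measurable_fun Q G := G2.1.
  have mp k : measurable_fun Q (phi \o stshift k).
    by apply: measurable_funTS; exact: (L2_stshift k p2').1.
  apply: (@Rintegral_dominated_cvg R _ ST nu Q
    (fun n z => G z * ((phi (stshift (h n) z) - phi z) / h n)) _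
    (fun z => M * `|G z|) mQ _ _ _ _).2.
  - move=> n; apply: measurable_funM => //; apply: measurable_funM => //.
    by apply: measurable_funB; [exact: mp|exact: p2.1].
  - move=> z _; apply: cvgM; first exact: cvg_cst.
    exact: (quotient_cvg tphi.1 h_gt0 h_cvg).
  - apply: (integrableZ_EFin mQ); by apply/integrable_abse: Gi.
  - move=> n z _; have [c _ ->] := quotient_mean z tphi.1 (h_gt0 n).
    by rewrite normrM mulrC ler_wpM2r.
have cvg2 : \int[nu]_(z in Q) (G z * ((phi (stshift (h n) z) - phi z) / h n)) @[n --> \oo] -->
    - \int[P]_z (phi z * b z).
  rewrite (_ : (fun n => _) = fun n => - \int[P]_z (phi z * diffq (- h n) b z)).
    apply: cvgN; apply: (diffq_cvg_weak (T := T)) => //.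
    - exact: patch_off_time.
    - by move=> n; rewrite oppr_eq0 gt_eqF.
    - by rewrite -oppr0; apply: cvgN.
  by apply/funext => n; exact: step.
have := cvg_unique (@Rhausdorff R) cvg1 cvg2.
move=> ->; congr (- _); rewrite patch_Rintegral.
by apply: eq_Rintegral => z _; rewrite mulrC.
Qed.

End time_antiderivative.

Lemma ae_exists_itv {R : realType} (P : R -> Prop) (a b : R) : a < b ->
  {ae (@lebesgue_measure R), forall t : R, P t} -> exists2 t, a < t < b & P t.
Proof.
move=> ab [N [mN N0 PN]].
have [//|nH] := pselect (exists2 t, a < t < b & P t).
have sub : `]a, b[%classic `<=` (N : set (measurableTypeR R)).
  move=> t; rewrite /= in_itv/= => abt; apply: PN => /= Pt; apply: nH.
  by exists t.
have mI : measurable (`]a, b[%classic : set (measurableTypeR R)) by exact: measurable_itv.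
have : (@lebesgue_measure R `]a, b[%classic <= 0)%E.
  by rewrite -N0; apply: le_measure; rewrite ?inE.
by rewrite lebesgue_measure_itv/= lte_fin ab -EFinB lee_fin subr_le0 leNgt ab.
Qed.

Section constant_in_time.
Context {R : realType} {d : nat}.
Local Notation ST := ('rV[R]_d * measurableTypeR R)%type.
Variables (Om : set 'rV[R]_d) (T : R).
Hypotheses (oOm : open Om) (bOm : bounded_set Om) (T0 : 0 < T).
Local Notation Q := (cylinder Om T).
Local Notation nu := (@leb_st R d).
Local Notation leb1 := (@lebesgue_measure R).
Local Notation P := (lebs d \x leb1)%E.
Implicit Types (w g : ST -> R) (phi : 'rV[R]_d * R -> R).

Let mQ : measurable Q. Proof. exact: measurable_cylinder. Qed.

Lemma bump_mass : exists N, 0 < \int[leb1]_t bump 0 T N.+1 t.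
Proof.
have mD : measurable (`]0, T[%classic : set (measurableTypeR R)) by exact: measurable_itv.
have mb n : measurable_fun setT (bump 0 T n : measurableTypeR R -> R).
  apply: continuous_measurable_fun; exact: (@smooth_continuous R R^o _ (smooth_bump 0 T n)).
have E n : \int[leb1]_t bump 0 T n.+1 t = \int[leb1]_(t in `]0, T[) bump 0 T n.+1 t.
  rewrite [RHS]Rintegral_mkcond; apply: eq_Rintegral => t _; rewrite patchE.
  case: ifPn => //; rewrite mem_setE in_itv/= => nt; exact: bump_out.
have Dm : (leb1 (`]0%R, T[%classic : set (measurableTypeR R)) = T%:E)%E.
  by rewrite lebesgue_measure_itv/= lte_fin T0 oppr0 adde0.
have [||||_ H] := @Rintegral_dominated_cvg R _ (measurableTypeR R) leb1 `]0, T[%classic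
    (fun n => bump 0 T n.+1) (cst 1) (cst 1) mD.
- by move=> n; exact: measurable_funTS.
- by move=> t; rewrite /= in_itv/= => /bump_cvg; rewrite -cvg_shiftS.
- apply/integrableP; split; first by apply/measurable_EFinP; exact: measurable_cst.
  by under eq_integral do rewrite /= normr1; rewrite integral_cst// mul1e; exact: (eq_ind_r (fun x => (x < +oo)%E) (ltry T) Dm).
- by move=> n t _; rewrite ger0_norm ?bump_ge0// bump_le1.
have E1 : \int[leb1]_(t in `]0, T[) (cst 1 t : R) = T.
  by rewrite Rintegral_cst// mul1r; exact: (congr1 fine Dm).
move: H; rewrite E1.
move/cvgrPdist_lt/(_ _ T0) => [N _ /(_ N (leqnn N))] /= H; exists N; rewrite E.
by move: H; rewrite ltr_distlC subrr => /andP[].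
Qed.

Lemma derive_tensor (A : 'rV[R]_d -> R) (B : R -> R) (z : 'rV[R]_d * R) : smooth A ->
  smooth (B : R^o -> R) ->
  'D_e_t (fun z : 'rV[R]_d * R => A z.1 * B z.2) z = A z.1 * 'D_1 B z.2.
Proof.
move=> sA sB.
have dA : derivable (fun z : 'rV[R]_d * R => A z.1) z e_t.
  by apply: smooth_derivable; exact: (@smooth_fst R _ R^o).
have dB : derivable (fun z : 'rV[R]_d * R => B z.2) z e_t.
  by apply: smooth_derivable; exact: (@smooth_snd R 'rV[R]_d R^o).
apply: etrans (deriveM dA dB) _.
have -> : 'D_e_t (fun z : 'rV[R]_d * R => A z.1) z = 0.
  have [_ E] := @derive_affine R ('rV[R]_d * R)%type 'rV[R]_d fst fst A z e_t (fun _ _ _ => erefl).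
  by apply: etrans E _; rewrite /e_t derive0.
have -> : 'D_e_t (fun z : 'rV[R]_d * R => B z.2) z = 'D_1 B z.2.
  have [_ E] := @derive_affine R ('rV[R]_d * R)%type R^o snd snd B z e_t (fun _ _ _ => erefl).
  exact: E.
by rewrite scaler0 addr0.
Qed.

Lemma tensor_off a b n (s t : R) (z : ST) :
  xbump a b n.+1 z.1 * bump s t n.+1 z.2 != 0 ->
  [/\ stbox a b s t z, s + n.+1%:R^-1 <= (z.2 : R) & (z.2 : R) <= t - n.+1%:R^-1].
Proof.
have n0 : 0 < n.+1%:R^-1 :> R by rewrite invr_gt0.
rewrite mulf_eq0 negb_or => /andP[x0 r0].
have [/andP[r1 r2] _] := bump_neq0 r0.
split=> //; split; last by rewrite (lt_le_trans _ r1) ?ltrDl//= (le_lt_trans r2)// ltrBlDr ltrDl.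
move=> i; have [/andP[y1 y2] _] := xbump_neq0 i x0.
by rewrite (lt_le_trans _ y1) ?ltrDl//= (le_lt_trans y2)// ltrBlDr ltrDl.
Qed.

(** The support of a product of bumps lies in a smaller box; correcting the
    time factor by a multiple of a fixed bump gives it zero mean, so that its
    primitive is again a test function. *)
Lemma tensor_corrected a b n (s t : R) N (z0 : ST) (m : R) :
  stbox a b s t `<=` Q -> xbump a b n.+1 z0.1 * bump s t n.+1 z0.2 != 0 ->
  let f r := bump s t n.+1 r - m * bump 0 T N.+1 r in
  \int[leb1]_r f r = 0 ->
  @test_function R ('rV[R]_d * R)%type Q (fun z => xbump a b n.+1 z.1 * primitive f z.2) /\
  forall z, 'D_e_t (fun z : 'rV[R]_d * R => xbump a b n.+1 z.1 * primitive f z.2) z =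
    xbump a b n.+1 z.1 * f z.2.
Proof.
move=> BQ /tensor_off[[zx zt] zs1 zt1] f f0.
have n0 : 0 < n.+1%:R^-1 :> R by rewrite invr_gt0.
have N0 : 0 < N.+1%:R^-1 :> R by rewrite invr_gt0.
set c : R := n.+1%:R^-1 in n0 zs1 zt1 *; set k : R := N.+1%:R^-1 in N0 *.
have inQ r : s < r < t -> 0 < r < T.
  by move=> sr; have [_] := BQ (z0.1, r) (conj zx sr); rewrite /= in_itv.
have s1 : 0 < s + c.
  by have /inQ/andP[] : s < s + c < t by rewrite ltrDl n0/= (le_lt_trans zs1)//; case/andP: zt.
have t1 : t - c < T.
  have /inQ/andP[] // : s < t - c < t.
  by rewrite (lt_le_trans _ zt1)/= ?ltrBlDr ?ltrDl//; case/andP: zt.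
pose s' := Num.min (s + c) k; pose t' := Num.max (t - c) (T - k).
have sf : smooth (f : R^o -> R).
  rewrite (_ : f = (bump s t n.+1 : R^o -> R) + (cst (- m) : R^o -> R) * (bump 0 T N.+1 : R^o -> R)).
    apply: (@smoothD R R^o); first exact: smooth_bump.
    by apply: (@smoothM R R^o); [exact: smooth_cst|exact: smooth_bump].
  by apply/funext => r; rewrite /f !fctE mulNr.
have fs r : ~~ (s' <= r <= t') -> f r = 0.
  move=> nr; rewrite /f.
  have [->|/bump_neq0[/andP[r1 r2] _]] := eqVneq (bump s t n.+1 r) 0; last first.
    by move: nr; rewrite ge_min r1 le_max r2.
  have [->|/bump_neq0[/andP[r1 r2] _]] := eqVneq (bump 0 T N.+1 r) 0; last first.
    by move: nr; rewrite add0r in r1; rewrite ge_min r1 le_max r2 !orbT.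
  by rewrite mulr0 subrr.
have sp := smooth_primitive sf fs.
split.
  have p0 := primitive_support fs f0.
  apply: (@tensor_test R d a b n (primitive f) s' t' Q sp p0) => x r xab /andP[r1 r2].
  have [Ox _] := BQ (x, z0.2) (conj xab zt).
  split => //=; rewrite in_itv/=; move: r1 r2; rewrite ge_min le_max.
  move=> r1 r2; apply/andP; split.
    by case/orP: r1 => r1; [exact: lt_le_trans r1|exact: lt_le_trans r1].
  by case/orP: r2 => r2; apply: le_lt_trans r2 _ => //; rewrite ltrBlDr ltrDl.
move=> z; rewrite derive_tensor//; last exact: smooth_xbump.
by have [_ ->] := is_derive_primitive sf fs z.2.
Qed.

Lemma integrable_bounded_mul dm (X : measurableType dm) (mu : {measure set X -> \bar R})
    (f k : X -> R) : mu.-integrable setT (EFin \o f) -> measurable_fun setT k ->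
  (forall x, `|k x| <= 1) -> mu.-integrable setT (EFin \o (fun x => f x * k x)).
Proof.
move=> fi mk k1; have mf := measurable_int _ fi; move/measurable_EFinP in mf.
apply: (@le_integrable_EFin R _ X mu setT measurableT _ (fun x => `|f x|)); first exact: measurable_funM.
  by apply/integrable_abse: fi.
by move=> x _; rewrite normrM ler_piMr.
Qed.

(** The value [c x] is the weighted mean in time of [w], the weight being a fixed
    bump. A bump in [x] times one in [t] differs from a multiple of the bump in
    [x] times the weight by the time derivative of a test function
    ([tensor_corrected]), against which [w] integrates to zero. *)
Lemma constant_in_time w : L2Q Om T w ->
  (forall phi, @test_function R ('rV[R]_d * R)%type Q phi ->
    \int[nu]_(z in Q) (w z * 'D_e_t phi z) = 0) ->
  exists c : 'rV[R]_d -> R, [/\ measurable_fun setT c, L2 (leb d) Om c &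
    {ae nu, forall z, Q z -> w z = c z.1}].
Proof.
move=> w2 wD; pose b := w \_ Q.
have b2 : L2 P setT b by exact: patch_L2.
have mb := b2.1.
have bi : P.-integrable setT (EFin \o b).
  have /(integrable_mkcond _ mQ) := L2_integrable mQ (cylinder_lty T oOm bOm) w2.
  by rewrite restrict_EFin.
have [N I0] := bump_mass; set eta := bump 0 T N.+1 in I0; set I := \int[leb1]_t eta t in I0.
have seta : smooth (eta : R^o -> R) by exact: smooth_bump.
have cm (B : R -> R) : smooth (B : R^o -> R) -> measurable_fun setT (B : measurableTypeR R -> R).
  by move=> sB; apply: continuous_measurable_fun; exact: (@smooth_continuous R R^o).
have meta := cm _ seta.
have mBt B : smooth (B : R^o -> R) -> measurable_fun setT (fun z : ST => B z.2).
  by move=> sB; apply: (measurableT_comp (cm _ sB)); exact: measurable_snd.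
have eta1 r : `|eta r| <= 1 by rewrite ger0_norm ?bump_ge0// bump_le1.
have bei : P.-integrable setT (EFin \o (fun z => b z * eta z.2)).
  by apply: integrable_bounded_mul => //; exact: mBt.
have [aei ci _] := Rintegral_fubini bei.
pose c x := I^-1 * \int[leb1]_t (b (x, t) * eta t).
have mc : measurable_fun setT c.
  apply: measurable_funM; first exact: measurable_cst.
  apply: (measurable_Rintegral_snd leb1 (f := fun z => b z * eta z.2)).
  exact: measurable_funM (mBt _ seta).
have ci' : (lebs d).-integrable setT (EFin \o c) by exact: integrableZ_EFin.
pose one : ST -> R := fun z => \1_(`[0, T[%classic) (z.2 : R).
have c1i : P.-integrable setT (EFin \o (fun z => c z.1 * one z)).
  have cni : (lebs d).-integrable setT (EFin \o (fun x => `|c x|)) by apply/integrable_abse: ci'.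
  have [H _] := @integral_slab R _ _ (lebs d) setT (fun x => `|c x|) 0 T measurableT (ltW T0) cni (fun x => normr_ge0 _).
  apply: (le_integrable_EFin measurableT _ H).
    apply: measurable_funM; first exact: (measurableT_comp mc measurable_fst).
    apply: (measurableT_comp (f := \1_(`[0, T[%classic) : measurableTypeR R -> R)) => //.
  move=> z _; have o1 : 0 <= one z by rewrite /one indicE; case: (_ \in _).
  by rewrite patch_setT normrM (ger0_norm o1).
have wc0 : {ae nu, forall z, Q z -> w z - c z.1 = 0}.
  apply: (@fundamental_lemma R d Q (fun z : ST => w z - c z.1) (open_cylinder oOm)).
    have wi := L2_integrable mQ (cylinder_lty T oOm bOm) w2.
    apply: (integrableB_EFin mQ wi).
    have : nu.-integrable Q (EFin \o (fun z => c z.1 * one z)) by apply: integrableS c1i.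
    apply: eq_integrable => // z; rewrite inE => -[_]; rewrite /= in_itv/= => /andP[t0 tT].
    by rewrite /one indicE mem_set/= ?mulr1// in_itv/= tT ltW.
  move=> a0 b0 s t n BQ.
  pose A := xbump a0 b0 n.+1; pose beta := bump s t n.+1.
  have sbeta : smooth (beta : R^o -> R) by exact: smooth_bump.
  have [[z0 nz]|allz] := pselect (exists z0 : ST, A z0.1 * beta z0.2 != 0); last first.
    rewrite (eq_Rintegral _ (g := cst 0)); first by rewrite Rintegral_cst// mul0r.
    move=> z _; have [E|nE] := eqVneq (A z.1 * beta z.2) 0; last by case: allz; exists z.
    by rewrite [X in _ * X]E mulr0.
  have A1 z : `|A z| <= 1 by rewrite ger0_norm ?xbump_ge0// xbump_le1.
  have mA : measurable_fun setT (fun z : ST => A z.1).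
    have := @measurable_tensor R d a0 b0 n.+1 (cst 1) (@smooth_cst R R^o 1).
    by under eq_fun do rewrite mulr1.
  have mAx : measurable_fun setT A.
    by apply: (measurableT_comp mA (pair2_measurable (0 : measurableTypeR R))).
  have Ibeta : leb1.-integrable setT (EFin \o beta).
    apply: (integrable_compact_support sbeta (s := s) (t := t)) => r nr.
    by apply: bump_out; apply: contra nr => /andP[? ?]; rewrite !ltW.
  have Ieta : leb1.-integrable setT (EFin \o eta).
    apply: (integrable_compact_support seta (s := 0) (t := T)) => r nr.
    by apply: bump_out; apply: contra nr => /andP[? ?]; rewrite !ltW.
  pose m := (\int[leb1]_r beta r) / I.
  have f0 : \int[leb1]_r (beta r - m * eta r) = 0.
    rewrite (RintegralB measurableT Ibeta (integrableZ_EFin measurableT m Ieta)).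
    by rewrite (RintegralZl _ measurableT Ieta) mulfVK ?subrr// gt_eqF.
  have [tphi Dphi] := tensor_corrected BQ nz f0.
  have betaT r : beta r != 0 -> 0 < r < T.
    have [[zx _] _ _] := tensor_off nz => /bump_neq0[/andP[r1 r2] _].
    have n0 : 0 < n.+1%:R^-1 :> R by rewrite invr_gt0.
    have sr : s < r < t.
      by rewrite (lt_le_trans _ r1) ?ltrDl//= (le_lt_trans r2)// ltrBlDr ltrDl.
    by have [_] := BQ (z0.1, r) (conj zx sr); rewrite /= in_itv.
  have i1 : P.-integrable setT (EFin \o (fun z => b z * eta z.2 * A z.1)).
    exact: integrable_bounded_mul.
  have i2 : P.-integrable setT (EFin \o (fun z => b z * (A z.1 * beta z.2))).
    apply: integrable_bounded_mul => //; first by apply: measurable_tensor.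
    by move=> z; rewrite normrM mulr_ile1// ger0_norm ?bump_ge0// bump_le1.
  have i3 : P.-integrable setT (EFin \o (fun z => c z.1 * one z * (A z.1 * beta z.2))).
    apply: integrable_bounded_mul => //; first by apply: measurable_tensor.
    by move=> z; rewrite normrM mulr_ile1// ger0_norm ?bump_ge0// bump_le1.
  have icA : (lebs d).-integrable setT (EFin \o (fun x => c x * A x)).
    exact: integrable_bounded_mul.
  pose S := \int[lebs d]_x (c x * A x).
  have J1 : \int[P]_z (b z * eta z.2 * A z.1) = I * S.
    have [_ _ ->] := Rintegral_fubini i1.
    rewrite /S -(RintegralZl I measurableT icA).
    apply: ae_eq_Rintegral => //.
    - exact: (measurable_Rintegral_snd leb1 (measurable_funM (measurable_funM mb (mBt _ seta)) mA)).
    - by apply: measurable_funM => //; exact: measurable_funM.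
    - apply: ae_imp aei => x xi _ /=.
      rewrite (RintegralZr _ measurableT xi) /c mulrA mulrA divff ?mul1r// gt_eqF//.
  have J2 : \int[P]_z (c z.1 * one z * (A z.1 * beta z.2)) = (\int[leb1]_r beta r) * S.
    have [_ _ ->] := Rintegral_fubini i3.
    rewrite /S -(RintegralZl _ measurableT icA); apply: eq_Rintegral => x _ /=.
    rewrite mulrC -(RintegralZl _ measurableT Ibeta); apply: eq_Rintegral => r _.
    have [br0|nbr] := eqVneq (beta r) 0; first by rewrite br0 !mulr0.
    rewrite /one /= indicE mem_set/=; first by rewrite mulr1 mulrA.
    by have /andP[? ?] := betaT _ nbr; rewrite in_itv/= ltW.
  have W : \int[P]_z (b z * (A z.1 * beta z.2)) = m * (I * S).
    have := wD _ tphi; rewrite patch_Rintegral.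
    under eq_Rintegral do rewrite Dphi.
    move=> H; rewrite -J1 -(RintegralZl m measurableT i1); apply/eqP; rewrite -subr_eq0.
    apply/eqP; rewrite -(RintegralB measurableT i2 (integrableZ_EFin measurableT m i1)).
    rewrite -[RHS]H; apply: eq_Rintegral => z _.
    have HH (p q r l k : R) : p * (q * r) - k * (p * l * q) = p * (q * (r - k * l)) by ring.
    exact: HH.
  transitivity (\int[P]_z (b z * (A z.1 * beta z.2)) - \int[P]_z (c z.1 * one z * (A z.1 * beta z.2))).
    rewrite -(RintegralB measurableT i2 i3) Rintegral_mkcond; apply: eq_Rintegral => z _.
    rewrite patchE; case: ifPn => [|/negP]; rewrite inE => Qz.
      have -> : b z = w z by rewrite /b patchE mem_set.
      have -> : one z = 1.
        rewrite /one indicE mem_set//=; case: Qz => _; rewrite /= !in_itv/= => /andP[? ->].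
        by rewrite ltW.
      by rewrite mulr1 -mulrBl.
    have [->|/tensor_off[/BQ//]] := eqVneq (A z.1 * beta z.2) 0.
    by rewrite !mulr0 subrr.
  by rewrite W J2 mulrA /m mulfVK ?subrr// gt_eqF.
have wc : {ae nu, forall z, Q z -> w z = c z.1}.
  by apply: ae_imp wc0 => z H Qz; apply/eqP; rewrite -subr_eq0 H.
exists c; split => //.
(* [c] is square integrable because it agrees with a time section of [w] *)
pose D z := b z - ((fun z : ST => c z.1) \_ Q) z.
have mDf : measurable_fun setT D.
  apply: measurable_funB => //; apply/(measurable_restrictT _ mQ).
  by apply: measurable_funTS; exact: (measurableT_comp mc measurable_fst).
pose N0 : set ST := D @^-1` (~` [set 0]).
have mN0 : measurable N0.
  rewrite -[N0]setTI; apply: mDf => //; apply: measurableC; exact: measurable_set1.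
have N00 : P N0 = 0%E.
  apply: (measure_negligible mN0); apply: negligibleS wc => z /= Dz H; apply: Dz.
  rewrite /D patchE /b patchE; case: ifPn => [|_]; last by rewrite subrr.
  by rewrite inE => Qz; rewrite H// subrr.
have sec := product_ae_sections mN0 N00.
have b2i : P.-integrable setT (EFin \o (fun z => b z ^+ 2)) := b2.2.
have [t t0T [H1 H2]] := ae_exists_itv T0 (ae_imp2 (fun _ a b => conj a b) sec (ae_integrable2 b2i)).
apply: (@ae_eq_L2 R _ _ (leb d) Om (measurable_Om oOm) (fun x => b (x, t))).
- exact: measurable_funTS.
- apply: ae_imp H1 => x + Ox; rewrite /N0 /= => /contrapT; rewrite /D patchE mem_set.
    by move=> /eqP; rewrite subr_eq0 => /eqP.
  by split => //=; rewrite in_itv.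
- split; first by apply: measurable_funTS; apply: (measurableT_comp mb); exact: pair2_measurable.
  by apply: integrableS H2 => //; exact: measurable_Om.
Qed.

End constant_in_time.

(** * Traces in time *)
Section L2_norms.
Context {R : realType} dm (X : measurableType dm) (mu : {measure set X -> \bar R}).
Variable D : set X.
Hypothesis mD : measurable D.
Implicit Types f g : X -> R.

Lemma L2norm_ge0 f : 0 <= L2norm mu D f. Proof. exact: sqrtr_ge0. Qed.

Lemma minkowski f g : L2 mu D f -> L2 mu D g ->
  L2norm mu D (f \+ g) <= L2norm mu D f + L2norm mu D g.
Proof.
move=> f2 g2; rewrite -(ler_pXn2r (n := 2))// ?nnegrE ?addr_ge0 ?L2norm_ge0//.
rewrite L2norm_sqr sqrrD !L2norm_sqr.
have C := cauchy_schwarz mD f2 g2.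
have i1 := L2_sqr f2; have i2 := L2_sqr g2.
have i3 := integrableZ_EFin mD 2 (L2M mD f2 g2).
have -> : \int[mu]_(x in D) ((f \+ g) x ^+ 2) = \int[mu]_(x in D) (f x ^+ 2) +
    2 * \int[mu]_(x in D) (f x * g x) + \int[mu]_(x in D) (g x ^+ 2).
  rewrite -(RintegralZl 2 mD (L2M mD f2 g2)) -(RintegralD mD i1 i3) -(RintegralD mD (integrableD_EFin mD i1 i3) i2).
  by apply: eq_Rintegral => x _ /=; rewrite sqrrD mulr_natl.
by rewrite lerD2r lerD2l -[leRHS]mulr_natl ler_wpM2l.
Qed.

Lemma L2norm_ae f g : measurable_fun D f -> measurable_fun D g ->
  {ae mu, forall x, D x -> f x = g x} -> L2norm mu D f = L2norm mu D g.
Proof.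
move=> mf mg fg; rewrite /L2norm; congr Num.sqrt; apply: (ae_eq_Rintegral mD).
- exact: measurable_funX.
- exact: measurable_funX.
- by apply: ae_imp fg => x H Dx; rewrite H.
Qed.

Lemma L2_ae_le f (k : X -> R) : measurable_fun D f -> mu.-integrable D (EFin \o k) ->
  {ae mu, forall x, D x -> f x ^+ 2 <= k x} ->
  L2 mu D f /\ \int[mu]_(x in D) (f x ^+ 2) <= \int[mu]_(x in D) k x.
Proof.
move=> mf ki fk.
have mk : measurable_fun D k by apply/measurable_EFinP; exact: measurable_int ki.
have mf2 : measurable_fun D (fun x => f x ^+ 2) by exact: measurable_funX.
pose k' x := Num.max (k x) (f x ^+ 2).
have mk' : measurable_fun D k' by exact: measurable_maxr.
have kk : {ae mu, forall x, D x -> k x = k' x}.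
  by apply: ae_imp fk => x H Dx; rewrite /k' max_l// H.
have ki' : mu.-integrable D (EFin \o k').
  apply/integrableP; split; first exact/measurable_EFinP.
  have /integrableP[_] := ki; apply: le_lt_trans; rewrite le_eqVlt; apply/orP; left.
  apply/eqP/esym/(ae_eq_integral _ _ mD).
  - by apply: measurableT_comp => //; exact/measurable_EFinP.
  - by apply: measurableT_comp => //; exact/measurable_EFinP.
  - by apply: ae_imp kk => x H Dx; rewrite /= H.
have fi : mu.-integrable D (EFin \o (fun x => f x ^+ 2)).
  apply: (le_integrable_EFin mD mf2 ki') => x _.
  by rewrite ger0_norm ?sqr_ge0// le_max lexx orbT.
split; first by split.
rewrite (ae_eq_Rintegral mD mk mk' kk); apply: le_Rintegral => // x _.
by rewrite le_max lexx orbT.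
Qed.
End L2_norms.

Section time_sections.
Context {R : realType} {d : nat}.
Local Notation ST := ('rV[R]_d * measurableTypeR R)%type.
Local Notation nu := (@leb_st R d).
Local Notation leb1 := (@lebesgue_measure R).
Local Notation P := (lebs d \x leb1)%E.

Lemma ae_sections (A : ST -> Prop) : {ae nu, forall z, A z} ->
  {ae leb1, forall t, {ae leb d, forall x, A (x, t)}}.
Proof.
move=> [N [mN N0 AN]]; have := product_ae_sections (mu := lebs d) mN N0.
apply: ae_imp => t; apply: ae_imp => x nN; apply: contrapT => nA; apply: nN.
exact: AN.
Qed.

(** The bound [primitive_diff_sqr], integrated over space. *)
Lemma stprimitive_increment (b : ST -> R) (T s t : R) :
  (forall z : ST, ~~ (0 < (z.2 : R) < T) -> b z = 0) -> L2 P setT b -> s <= t ->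
  L2 (leb d) setT (fun x => stprimitive b (x, t) - stprimitive b (x, s)) /\
  \int[leb d]_x ((stprimitive b (x, t) - stprimitive b (x, s)) ^+ 2)
    <= (t - s) * \int[P]_z (b z ^+ 2).
Proof.
move=> boff b2 st.
have b2i : P.-integrable setT (EFin \o (fun z => b z ^+ 2)) := b2.2.
have [ai ki ->] := Rintegral_fubini b2i.
have mb := b2.1; have mG := measurable_primitive mb.
have mGt r : measurable_fun setT (fun x : 'rV[R]_d => stprimitive b (x, r)).
  by apply: (measurableT_comp mG (pair2_measurable (r : measurableTypeR R))).
rewrite -(RintegralZl _ measurableT ki).
apply: L2_ae_le => //.
- exact: measurable_funB.
- exact: integrableZ_EFin.
- apply: ae_imp ai => x xi _.
  have bx2 : L2 leb1 setT (fun r => b (x, r)).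
    by split => //; apply: (measurableT_comp mb); exact: pair1_measurable.
  apply: le_trans (primitive_diff_sqr (T := T) _ bx2 st) _.
    by move=> r nr; exact: boff.
  rewrite ler_wpM2l ?subr_ge0//.
  rewrite Rintegral_mkcond; apply: le_Rintegral => //.
  + have mI : measurable (`]s, t]%classic : set (measurableTypeR R)) by exact: measurable_itv.
    have : leb1.-integrable (`]s, t]%classic : set (measurableTypeR R)) (EFin \o (fun r => b (x, r) ^+ 2)).
      exact: integrableS xi.
    by move/(integrable_mkcond _ mI); rewrite restrict_EFin.
  + by move=> r _; rewrite patchE; case: ifP => // _; exact: sqr_ge0.
Qed.
End time_sections.

Section traces.
Context {R : realType} {d : nat}.
Local Notation ST := ('rV[R]_d * measurableTypeR R)%type.
Variables (Om : set 'rV[R]_d) (T : R).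
Hypotheses (oOm : open Om) (bOm : bounded_set Om) (T0 : 0 < T).
Local Notation Q := (cylinder Om T).
Local Notation nu := (@leb_st R d).
Local Notation leb1 := (@lebesgue_measure R).
Local Notation P := (lebs d \x leb1)%E.
Implicit Types (w g : ST -> R) (phi : 'rV[R]_d * R -> R).

Let mQ : measurable Q. Proof. exact: measurable_cylinder. Qed.
Let mOm : measurable Om. Proof. exact: measurable_Om. Qed.

(** Once the primitive of [g] is subtracted, a function with zero weak time
    derivative is left. *)
Lemma time_representation w g : L2Q Om T w -> is_wderiv Om T e_t w g ->
  exists c : 'rV[R]_d -> R, [/\ measurable_fun setT c, L2 (leb d) Om c &
    {ae nu, forall z, Q z -> w z = c z.1 + stprimitive (g \_ Q) z}].
Proof.
move=> w2 wg; have g2 := wg.1.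
have pg := is_wderiv_primitive oOm bOm T0 g2; have p2 := stprimitive_L2Q oOm T0 g2.
have [_ D0] := is_wderivB oOm bOm w2 p2 wg pg.
have [||c [mc c2 cE]] := constant_in_time oOm bOm T0 (w := fun z => w z - stprimitive (g \_ Q) z).
- exact: (L2B mQ w2 p2).
- move=> phi tphi; rewrite D0// (eq_Rintegral _ (g := cst 0)) ?Rintegral_cst// ?mul0r ?oppr0//.
  by move=> z _; rewrite subrr mul0r.
exists c; split => //; apply: ae_imp cE => z H Qz.
by rewrite -(H Qz) subrK.
Qed.

Lemma stprimitive0 g x : stprimitive (g \_ Q) (x, 0) = 0.
Proof. by apply: (primitive_le0 (T := T)) => // s s0; exact: (@patch_off_time R d Om T g (x, s)). Qed.

(** By [stprimitive_increment] this representative of [w] is Hoelder continuous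
    in time with values in L^2. *)
Lemma trace_of_representation w g c s : L2Q Om T g -> measurable_fun setT c ->
  L2 (leb d) Om c ->
  {ae nu, forall z, Q z -> w z = c z.1 + stprimitive (g \_ Q) z} ->
  is_time_trace Om T s w (fun x => c x + stprimitive (g \_ Q) (x, s)).
Proof.
move=> g2 mc c2 wE; set b := g \_ Q in wE *.
exists (fun t x => c x + stprimitive b (x, t)); split => //.
- move=> t /andP[t0 tT]; apply: (L2D mOm c2).
  have [H _] := stprimitive_increment (@patch_off_time R d Om T g) (patch_L2 oOm g2) t0.
  have := L2_unpatch mOm H; congr (L2 _ _ _); apply/funext => x.
  by rewrite stprimitive0 subr0.
- move=> t0 t0T; pose C := \int[P]_z (b z ^+ 2).
  have C0 : 0 <= C by apply: Rintegral_ge0 => z _; exact: sqr_ge0.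
  have C10 : 0 < C + 1 by rewrite ltr_wpDl.
  have bd s1 t1 : s1 <= t1 -> \int[leb d]_(x in Om)
      ((stprimitive b (x, t1) - stprimitive b (x, s1)) ^+ 2) <= (t1 - s1) * C.
    move=> st; have [H1 H2] := stprimitive_increment (@patch_off_time R d Om T g) (patch_L2 oOm g2) st.
    apply: le_trans H2; rewrite Rintegral_mkcond; apply: le_Rintegral => //.
    + have /(integrable_mkcond _ mOm) := integrableS measurableT mOm (@subsetT _ _) H1.2.
      by rewrite restrict_EFin.
    + exact: H1.2.
    + by move=> x _; rewrite patchE; case: ifP => // _; exact: sqr_ge0.
  apply/cvgrPdist_lt => e e0; rewrite near_withinE.
  have r0 : 0 < e ^+ 2 / (C + 1) by rewrite divr_gt0// exprn_gt0.
  apply/nbhs_ballP; exists (e ^+ 2 / (C + 1)) => //= t; rewrite /ball/= => tt0 _.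
  rewrite sub0r normrN ger0_norm ?L2norm_ge0//.
  rewrite -(ltr_pXn2r (n := 2))// ?nnegrE ?L2norm_ge0 ?(ltW e0)// L2norm_sqr.
  have -> : \int[leb d]_(x in Om) (((fun x => c x + stprimitive b (x, t)) \-
     (fun x => c x + stprimitive b (x, t0))) x ^+ 2) =
     \int[leb d]_(x in Om) ((stprimitive b (x, t) - stprimitive b (x, t0)) ^+ 2).
    by apply: eq_Rintegral => x _ /=; rewrite opprD addrACA subrr add0r.
  apply: (@le_lt_trans _ _ (`|t0 - t| * C)); last first.
    apply: le_lt_trans (_ : _ <= `|t0 - t| * (C + 1)) _; first by rewrite ler_wpM2l// lerDl.
    by rewrite -ltr_pdivlMr.
  have [tt|tt] := leP t0 t.
    by rewrite distrC ger0_norm ?subr_ge0//; exact: bd.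
  rewrite gtr0_norm ?subr_gt0//; apply: le_trans (bd _ _ (ltW tt)).
  rewrite le_eqVlt; apply/orP; left; apply/eqP.
  by apply: eq_Rintegral => x _; rewrite -sqrrN opprB.
- apply: ae_imp (ae_sections wE) => t H /andP[t0 tT].
  apply: ae_imp H => x H Ox; rewrite H//; split => //=; rewrite in_itv/= t0//.
Qed.

(** Two continuous representatives agree at almost all times, hence at times
    arbitrarily close to [s]. *)
Lemma time_trace_unique w s (g1 g2 : 'rV[R]_d -> R) : 0 <= s <= T -> is_time_trace Om T s w g1 ->
  is_time_trace Om T s w g2 -> {ae leb d, forall x, Om x -> g1 x = g2 x}.
Proof.
move=> sT [W1 [L1 C1 E1 ->]] [W2 [L2' C2 E2 ->]].
have d2 : L2 (leb d) Om (W1 s \- W2 s) by exact: (L2B mOm (L1 s sT) (L2' s sT)).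
suff n0 : L2norm (leb d) Om (W1 s \- W2 s) = 0.
  apply: ae_imp (L2norm0_ae mOm d2 n0) => x H Ox.
  by apply/eqP; rewrite -subr_eq0; apply/eqP; exact: H.
apply/le_anti; rewrite L2norm_ge0 andbT.
apply/ler_addgt0Pr => e e0; rewrite add0r.
have e20 : 0 < e / 2 by rewrite divr_gt0.
have /cvgrPdist_lt/(_ _ e20) := C1 s sT; have /cvgrPdist_lt/(_ _ e20) := C2 s sT.
rewrite !near_withinE => /nbhs_ballP[r1 /= r10 B1] /nbhs_ballP[r2 /= r20 B2].
pose r := Num.min r1 r2; have r0 : 0 < r by rewrite lt_min r10.
have [s0 s1] := andP sT.
have ab : Num.max 0 (s - r) < Num.min T (s + r).
  rewrite gt_max !lt_min; clearbody r; clear - T0 r0 s0 s1.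
  apply/and3P; split; first by rewrite T0 ltr_wpDl.
    by apply: lt_le_trans s1; rewrite ltrBlDr ltrDl.
  by rewrite ltrD2l gtrN.
have [t /andP[]] := ae_exists_itv ab (ae_imp2 (fun _ a b => conj a b) E1 E2).
rewrite gt_max lt_min => /andP[t0 tr] /andP[tT tr'] [F1 F2].
have tT' : 0 <= t <= T by rewrite !ltW.
have tT'' : 0 < t < T by rewrite t0.
have bt r' : r <= r' -> ball s r' t.
  move=> rr; rewrite /ball/= ltr_distlC; apply/andP; split.
    by apply: le_lt_trans tr; rewrite lerB.
  by apply: lt_le_trans tr' _; rewrite lerD2l.
have := B1 t (bt r1 ltac:(by rewrite ge_min lexx)); have := B2 t (bt r2 ltac:(by rewrite ge_min lexx orbT)).
rewrite /= in_itv/= => /(_ tT') n2 /(_ tT') n1.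
rewrite sub0r normrN ger0_norm ?L2norm_ge0// in n1.
rewrite sub0r normrN ger0_norm ?L2norm_ge0// in n2.
have f1 := L2B mOm (L1 t tT') (L1 s sT); have f2 := L2B mOm (L2' t tT') (L2' s sT).
have -> : L2norm (leb d) Om (W1 s \- W2 s) =
    L2norm (leb d) Om ((W2 t \- W2 s) \+ (\- (W1 t \- W1 s))).
  have f3 := L2D mOm f2 (L2N mOm f1).
  apply: (L2norm_ae mOm d2.1 f3.1).
  apply: ae_imp2 (F1 tT'') (F2 tT'') => x G1 G2 Ox /=.
  have E := etrans (esym (G1 Ox)) (G2 Ox); rewrite E.
  by move: (W1 s x) (W2 s x) (W2 t x) => p1 p2 p3; ring.
apply: le_trans (minkowski mOm f2 (L2N mOm f1)) _; rewrite L2normN.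
by rewrite [leRHS]splitr lerD// ltW.
Qed.

Lemma ae_fst (A : 'rV[R]_d -> Prop) : {ae leb d, forall x, A x} ->
  {ae nu, forall z, A z.1}.
Proof.
move=> [N [mN N0 AN]]; exists (N `*` setT); split.
- exact: measurableX.
- apply: (product_null (mu := lebs d)); first exact: measurableX.
  exists N; split => // x nx; apply: contrapT => Nx; apply: nx.
  by apply: aeW => t [].
- by move=> z /AN.
Qed.

(** The primitive vanishes at time zero, so the part constant in time is the
    initial trace. *)
Lemma representation0 w g : L2Q Om T w -> is_wderiv Om T e_t w g ->
  is_time_trace Om T 0 w (cst 0) ->
  {ae nu, forall z, Q z -> w z = stprimitive (g \_ Q) z}.
Proof.
move=> w2 wg w0; have [c [mc c2 wE]] := time_representation w2 wg.
have tr := trace_of_representation 0 wg.1 mc c2 wE.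
have c0 := time_trace_unique (ltac:(by rewrite lexx ltW) : 0 <= 0 <= T) w0 tr.
apply: ae_imp2 wE (ae_fst c0) => z E C Qz; rewrite E//.
by move: (C Qz.1); rewrite stprimitive0 addr0 => <-; rewrite add0r.
Qed.

Lemma time_trace_norm w g c : is_wderiv Om T e_t w g -> measurable_fun setT c ->
  L2 (leb d) Om c -> {ae nu, forall z, Q z -> w z = c z.1 + stprimitive (g \_ Q) z} ->
  L2norm (leb d) Om (time_trace Om T T w) =
  L2norm (leb d) Om (fun x => c x + stprimitive (g \_ Q) (x, T)).
Proof.
move=> wg mc c2 wE; have tr := trace_of_representation T wg.1 mc c2 wE.
have tt : is_time_trace Om T T w (time_trace Om T T w).
  by rewrite /time_trace; case: xgetP => // /(_ _ tr).
have TT : 0 <= T <= T by rewrite lexx ltW.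
have L (g' : 'rV[R]_d -> R) : is_time_trace Om T T w g' -> L2 (leb d) Om g' by move=> [W [L _ _ ->]]; exact: L.
apply: (L2norm_ae mOm (L _ tt).1 (L _ tr).1).
exact: time_trace_unique TT tt tr.
Qed.

Lemma L2norm_late_ge w s (K : R) : L2Q Om T w -> 0 < s < T -> 0 <= K ->
  {ae leb1, forall t, s < t < T -> exists2 W, L2 (leb d) Om W &
     K <= L2norm (leb d) Om W ^+ 2 /\ {ae leb d, forall x, Om x -> w (x, t) = W x}} ->
  (T - s) * K <= \int[P]_(z in late s) ((w \_ Q) z ^+ 2).
Proof.
move=> w2 /andP[s0 sT] K0 H; set b := w \_ Q.
have b2 := patch_L2 oOm w2 : L2 P setT b.
have mb := b2.1.
pose F (z : ST) : R := b z ^+ 2 * \1_(late s) z.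
have mF : measurable_fun setT F.
  apply: measurable_funM; first exact: measurable_funX.
  by apply: measurable_indic; exact: measurable_late.
have F0 z : 0 <= F z by rewrite mulr_ge0// sqr_ge0.
have Fi : P.-integrable setT (EFin \o F) by apply: integrable_late; exact: b2.2.
have mI : measurable (`]s, T[%classic : set (measurableTypeR R)) by exact: measurable_itv.
rewrite Rintegral_late; last exact: measurable_funX.
rewrite -/F -lee_fin /Rintegral fineK; last exact: integrable_fin_num Fi.
have -> : (\int[P]_z (F z)%:E = \int[leb1]_t \int[lebs d]_x (F (x, t))%:E)%E.
  by apply: (@fubini_tonelli2 _ _ _ _ _ (lebs d) leb1 (EFin \o F));
    [exact/measurable_EFinP|move=> z; rewrite lee_fin].
have mG : measurable_fun setT (fun t => \int[lebs d]_x (F (x, t))%:E)%E.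
  by apply: (@measurable_fun_fubini_tonelli_G _ _ _ _ _ (lebs d) (EFin \o F));
    [exact/measurable_EFinP|move=> z; rewrite lee_fin].
have -> : ((T - s) * K)%:E = (\int[leb1]_(t in (`]s, T[%classic : set (measurableTypeR R))) K%:E)%E.
  rewrite integral_cst//.
  have Dm : (leb1 (`]s, T[%classic : set (measurableTypeR R)) = (T - s)%:E)%E.
    by rewrite lebesgue_measure_itv/= lte_fin sT.
  by apply: etrans (esym (congr1 (fun x => K%:E * x)%E Dm)); rewrite -EFinM mulrC.
apply: (@le_trans _ _ (\int[leb1]_(t in (`]s, T[%classic : set (measurableTypeR R))) \int[lebs d]_x (F (x, t))%:E)%E); last first.
  apply: ge0_subset_integral => // t _.
  by apply: integral_ge0 => x _; rewrite lee_fin.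
apply: ae_ge0_le_integral => //.
- by move=> t _; apply: integral_ge0 => x _; rewrite lee_fin.
- exact: measurable_funTS.
apply: ae_imp H => t Ht; rewrite /= in_itv/= => st.
have [W W2 [KW wW]] := Ht st.
have -> : (\int[lebs d]_x (F (x, t))%:E = (L2norm (leb d) Om W ^+ 2)%:E)%E.
  have mbt : measurable_fun setT (fun x => b (x, t)).
    by apply: (measurableT_comp mb); exact: pair2_measurable.
  rewrite L2norm_sqr /Rintegral fineK; last exact: integrable_fin_num W2.2.
  transitivity (\int[lebs d]_(x in Om) (b (x, t) ^+ 2)%:E)%E.
    rewrite [RHS]integral_mkcond; apply: eq_integral => x _; rewrite patchE /F.
    rewrite indicE mem_set/= ?mulr1; last by rewrite /late /= ltW//; case/andP: st.
    case: ifPn => // /negP; rewrite inE => nO.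
    by rewrite /b patchE memNset ?expr0n// => -[].
  apply: ae_eq_integral => //.
  - by apply/measurable_EFinP/measurable_funX/measurable_funTS.
  - by apply/measurable_EFinP/measurable_funX; exact: W2.1.
  - apply: ae_imp wW => x E Ox; rewrite -E// /b patchE mem_set//; split => //=.
    by rewrite in_itv/= (lt_trans s0)//; case/andP: st => [].
by rewrite lee_fin.
Qed.

(** By continuity in time, the energy of [w] at times close to [T] is close to
    that of its trace; when [w] has no trace at time [T], the value zero given
    to it by convention makes the bound trivial. *)
Lemma time_trace_late w eta : L2Q Om T w -> 0 < eta ->
  \forall n \near \oo, L2norm (leb d) Om (time_trace Om T T w) ^+ 2 - eta <=
    (T / n.+2%:R)^-1 * \int[P]_(z in late (T - T / n.+2%:R)) ((w \_ Q) z ^+ 2).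
Proof.
move=> w2 eta0; rewrite /time_trace; case: xgetP => [tr -> [W [L C E ->]]|_]; last first.
  apply: nearW => n; apply: (@le_trans _ _ 0).
    rewrite /L2norm (eq_Rintegral _ (g := cst 0)); last by move=> x _; rewrite /= expr0n.
    by rewrite Rintegral_cst// mul0r sqrtr0 expr0n/= sub0r oppr_le0 ltW.
  by rewrite mulr_ge0 ?invr_ge0 ?divr_ge0 ?(ltW T0)// Rintegral_ge0// => z _; exact: sqr_ge0.
set N := L2norm (leb d) Om (W T).
have N0 : 0 <= N by exact: L2norm_ge0.
have TT : 0 <= T <= T by rewrite lexx ltW.
have d0 : 0 < 2 * N + 1 by rewrite ltr_wpDl// mulr_ge0.
(* with this distance [k] to the trace, [N ^+ 2 - eta <= (N - k) ^+ 2] *)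
pose k : R := eta / (2 * N + 1).
have k0 : 0 < k by rewrite divr_gt0.
have /cvgrPdist_lt/(_ _ k0) := C T TT; rewrite near_withinE => /nbhs_ballP[r /= r0 B].
have /cvgrPdist_lt/(_ _ r0) := time_step_cvg T; apply: filterS => n.
have h0 : 0 < T / n.+2%:R by rewrite divr_gt0.
rewrite sub0r normrN gtr0_norm// => hr; set h := T / n.+2%:R in h0 hr *.
have hT : h < T by rewrite /h ltr_pdivrMr// ltr_pMr// ltr1n.
rewrite mulrC ler_pdivlMr//.
have [neg|pos] := leP (N ^+ 2 - eta) 0.
  apply: (@le_trans _ _ 0); first by rewrite mulr_le0_ge0// ltW.
  by apply: Rintegral_ge0 => z _; exact: sqr_ge0.
have := @L2norm_late_ge w (T - h) (N ^+ 2 - eta) w2.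
rewrite subKr mulrC; apply => //; [|exact: ltW|].
  by rewrite subr_gt0 hT/= ltrBlDr ltrDl.
apply: ae_imp E => t Et /andP[ht tT].
have t0 : 0 < t by rewrite (lt_trans _ ht)// subr_gt0.
have tT' : 0 <= t <= T by rewrite !ltW.
exists (W t); first exact: L; split; last by apply: Et; rewrite t0.
have := B t; rewrite /= /ball/= gtr0_norm ?subr_gt0// in_itv/= => /(_ _ tT') n1.
have {}n1 : L2norm (leb d) Om (W t \- W T) < k.
  have : T - t < r by apply: lt_trans hr; rewrite ltrBlDr addrC -ltrBlDr.
  by move/n1; rewrite sub0r normrN ger0_norm ?L2norm_ge0.
have f1 := L2B mOm (L t tT') (L T TT).
have : N <= L2norm (leb d) Om (W t) + k.
  have -> : N = L2norm (leb d) Om (W t \+ (\- (W t \- W T))).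
    by rewrite /N /L2norm; congr Num.sqrt; apply: eq_Rintegral => x _ /=; rewrite opprB addrC subrK.
  apply: le_trans (minkowski mOm (L t tT') (L2N mOm f1)) _.
  by rewrite lerD2l L2normN ltW.
have : 0 <= L2norm (leb d) Om (W t) by exact: L2norm_ge0.
have kE : k * (2 * N + 1) = eta by rewrite /k mulfVK// gt_eqF.
move: (L2norm _ _ (W t)) => M M0 NM; rewrite -kE.
clearbody N k; clear - N0 k0 M0 NM.
have kN : 0 <= k * N by rewrite mulr_ge0// ltW.
have [Nk|kN'] := leP N k.
  have : N ^+ 2 <= k * N by rewrite expr2 ler_wpM2r.
  rewrite mulrDr mulr1 (mulrCA k); have := sqr_ge0 M.
  by move: (M ^+ 2) (N ^+ 2) (k * N) kN => *; lra.
have : (N - k) ^+ 2 <= M ^+ 2.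
  rewrite ler_pXn2r// ?nnegrE ?subr_ge0; first by rewrite lerBlDr.
  exact: ltW.
rewrite sqrrB; have := sqr_ge0 k; rewrite -[N * k *+ 2]mulr_natl (mulrC N k) => h1 h2.
rewrite mulrDr mulr1 (mulrCA k).
move: (k * N) (k ^+ 2) (N ^+ 2) (M ^+ 2) h1 h2 => a b c d0 *; lra.
Qed.

End traces.

(** * Green's formula *)
Section green.
Context {R : realType} {d : nat}.
Local Notation ST := ('rV[R]_d * measurableTypeR R)%type.
Local Notation V := ('rV[R]_d * R)%type.
Variables (Om : set 'rV[R]_d) (T : R).
Hypotheses (oOm : open Om) (bOm : bounded_set Om) (T0 : 0 < T).
Local Notation Q := (cylinder Om T).
Local Notation nu := (@leb_st R d).
Local Notation leb1 := (@lebesgue_measure R).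
Local Notation P := (lebs d \x leb1)%E.
Implicit Types (w g : ST -> R) (phi : 'rV[R]_d * R -> R).

Let mQ : measurable Q. Proof. exact: measurable_cylinder. Qed.
Let mOm : measurable Om. Proof. exact: measurable_Om. Qed.
Let oQ : @open V Q. Proof. exact: open_cylinder. Qed.

(** Cutting [phi] off outside [Q] keeps it smooth, since within [Q] it vanishes
    off a compact subset. *)
Lemma patch_test phi (K : set V) : smooth phi -> compact K -> K `<=` Q ->
  (forall z, Q z -> ~ K z -> phi z = 0) ->
  test_function Q (phi \_ Q) /\
  forall z h, Q z -> 'D_h (phi \_ Q) z = 'D_h phi z.
Proof.
move=> sphi cK KQ K0.
have near_in z : Q z -> \forall y \near z, (phi \_ Q) y = phi y.
  move=> Qz; have := open_nbhs_nbhs (conj oQ Qz); apply: filterS => y Qy.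
  by rewrite patchE mem_set.
have off z : ~ K z -> (phi \_ Q) z = 0.
  by move=> nK; rewrite patchE; case: ifPn => //; rewrite inE => Qz; exact: K0.
split; last by move=> z h Qz; apply: near_eq_derive; exact: near_in.
split; last by exists K.
apply: smooth_local => z; have [Qz|nQz] := pselect (Q z).
  by exists phi => //; exact: near_in.
exists (cst 0); first exact: smooth_cst.
have oK : open (~` K) by apply: closed_openC; apply: compact_closed cK; exact: norm_hausdorff.
by have := open_nbhs_nbhs (conj oK (fun Kz => nQz (KQ _ Kz))); apply: filterS => y; exact: off.
Qed.

Lemma continuous_stshift k : continuous (stshift k : V -> V).
Proof.
move=> z; have -> : (stshift k : V -> V) = fun z : V => z + (0, k).
  by apply/funext => -[x t]; rewrite /stshift /tshift; congr (_, _); rewrite /= addr0.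
by apply: cvgD; [exact: cvg_id|exact: cvg_cst].
Qed.

Lemma shift_smooth phi k : smooth phi -> smooth (fun z : V => phi (stshift k z)) /\
  forall z h, 'D_h (fun z : V => phi (stshift k z)) z = 'D_h phi (stshift k z).
Proof.
move=> sphi.
have A (c : R) (h x : V) : stshift k (c *: h + x) = c *: h + stshift k x.
  by case: h => h1 h2; case: x => x1 x2; rewrite /stshift /tshift /=; congr (_, _); rewrite /= addrA.
split.
  apply: (@smooth_affine R V V (stshift k : V -> V) id phi) => //.
  exact: continuous_stshift.
by move=> z h; have [_] := @derive_affine R V V (stshift k) id phi z h A.
Qed.

Lemma derive_x_time phi (B : R -> R) i (z : V) : smooth phi -> smooth (B : R^o -> R) ->
  'D_(e_x i) (fun z : V => phi z * B z.2) z = 'D_(e_x i) phi z * B z.2.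
Proof.
move=> sphi sB.
have dA : derivable phi z (e_x i) by exact: smooth_derivable.
have dB : derivable (fun z : V => B z.2) z (e_x i).
  by apply: smooth_derivable; exact: (@smooth_snd R 'rV[R]_d R^o).
apply: etrans (deriveM dA dB) _.
have -> : 'D_(e_x i) (fun z : V => B z.2) z = 0.
  have [_ E] := @derive_affine R V R^o snd snd B z (e_x i) (fun _ _ _ => erefl).
  by apply: etrans E _; rewrite /e_x derive0.
by rewrite scaler0 add0r /GRing.scale/= mulrC.
Qed.

(** The bump in time removes the times at which the shifted argument leaves the
    cylinder, and [phi] itself vanishes near the lateral boundary. *)
Lemma shifted_test phi (U : set V) k n : smooth phi -> 0 <= k ->
  open U -> lateral Om T `<=` U -> (forall z, U z -> phi z = 0) ->
  let psi := (fun z : V => phi (stshift (- k) z) * bump k T n.+1 z.2) \_ Q in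
  test_function Q psi /\
  forall z i, Q z -> 'D_(e_x i) psi z = 'D_(e_x i) phi (stshift (- k) z) * bump k T n.+1 z.2.
Proof.
move=> sphi k0 oU LU U0; set f := fun z : V => _ * _.
have c0 : 0 < n.+1%:R^-1 :> R by rewrite invr_gt0.
set c : R := n.+1%:R^-1 in c0.
have [ss Ds] := shift_smooth (- k) sphi.
have sf : smooth f.
  apply: (@smoothM R V); first exact: ss.
  exact: (@smooth_snd R 'rV[R]_d R^o _ (smooth_bump k T n.+1)).
pose K : set V := (closure Om `*` `[k + c, T - c]%classic) `&` (stshift (- k) @^-1` (~` U)).
have cK : compact K.
  apply: compact_closedI.
    apply: compact_setX; last exact: segment_compact.
    exact: compact_closure_bounded.
  apply: preimage_closed; last exact: open_closedC.
  by move=> z _; exact: continuous_stshift.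
have KQ : K `<=` Q.
  move=> [x t] [[/= cx]]; rewrite in_itv/= => /andP[t1 t2] nU.
  have t0 : 0 < t by apply: lt_le_trans t1; rewrite ltr_wpDl.
  have tT : t < T by apply: le_lt_trans t2 _; rewrite ltrBlDr ltrDl.
  split => /=; last by rewrite in_itv/= t0.
  apply: contrapT => nO; apply: nU; apply: LU; split => //=.
  rewrite /tshift in_itv/= subr_gt0; apply/andP; split.
    by apply: lt_le_trans t1; rewrite ltrDl.
  by apply: le_lt_trans tT; rewrite gerBl.
have fK z : Q z -> ~ K z -> f z = 0.
  case: z => x t [/= Ox _] nK; rewrite /f/=.
  have [->|p0] := eqVneq (phi (stshift (- k) (x, t))) 0; first by rewrite mul0r.
  have [->|/bump_neq0[b1 _]] := eqVneq (bump k T n.+1 t) 0; first by rewrite mulr0.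
  exfalso; apply: nK; split.
    by split => /=; [exact: subset_closure|rewrite in_itv].
  by move=> /= Uz; move: p0; rewrite U0// eqxx.
have [tt DE] := patch_test sf cK KQ fK.
split; first exact: tt.
move=> z i Qz; rewrite (DE z _ Qz); apply: etrans (derive_x_time i z ss (smooth_bump k T n.+1)) _.
by rewrite Ds.
Qed.

(** The bump tends to the indicator of the times at which the shifted argument
    belongs to the cylinder. *)
Lemma cvg_cut (a : ST -> R) (X : V -> R) k : 0 <= k -> L2Q Om T a -> continuous X ->
  \int[nu]_(z in Q) (a z * (X (stshift (- k) z) * bump k T n.+1 z.2)) @[n --> \oo] -->
  \int[P]_z ((a \_ Q) z * (X \_ Q) (stshift (- k) z)).
Proof.
move=> k0 a2 cX.
have cXk : continuous (fun z : V => X (stshift (- k) z)).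
  by move=> z; apply: continuous_comp; [exact: continuous_stshift|exact: cX].
have [M HM] := continuous_bounded T bOm cXk.
have ai := L2_integrable mQ (cylinder_lty T oOm bOm) a2.
have mX : measurable_fun Q (fun z => X (stshift (- k) z)).
  by apply: measurable_funTS; exact: continuous_measurable_st.
have mb n : measurable_fun Q (fun z : ST => bump k T n z.2).
  apply: measurable_funTS; apply: (measurableT_comp (f := bump k T n : measurableTypeR R -> R)).
    apply: continuous_measurable_fun; exact: (@smooth_continuous R R^o _ (smooth_bump k T n)).
  exact: measurable_snd.
pose chi (z : ST) : R := if k < z.2 then 1 else 0.
have -> : \int[P]_z ((a \_ Q) z * (X \_ Q) (stshift (- k) z)) =
    \int[nu]_(z in Q) (a z * (X (stshift (- k) z) * chi z)).
  rewrite patch_Rintegral; apply: eq_Rintegral => -[x t] _.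
  rewrite !patchE; case: ifPn => [|_]; last by rewrite !mul0r.
  rewrite inE => -[/= Ox]; rewrite in_itv/= => /andP[t0 tT]; congr (_ * _).
  have tk : t - k < T by apply: le_lt_trans tT; rewrite gerBl.
  rewrite /chi /=; case: ltP => kt.
    rewrite mem_set ?mulr1//; split => //=.
    by rewrite /tshift in_itv/= subr_gt0 kt.
  rewrite memNset ?mulr0// => -[_]; rewrite /= /tshift in_itv/= subr_gt0.
  by rewrite ltNge kt.
apply: (@Rintegral_dominated_cvg R _ ST nu Q _ _ (fun z => M * `|a z|) mQ _ _ _ _).2.
- move=> n; apply: measurable_funM; first exact: a2.1.
  exact: measurable_funM.
- move=> [x t] [/= Ox]; rewrite in_itv/= => /andP[t0 tT].
  apply: cvgM; first exact: cvg_cst; apply: cvgM; first exact: cvg_cst.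
  rewrite /chi /=; case: ltP => kt.
    have : k < t < T by rewrite kt.
    by move=> /bump_cvg; rewrite -cvg_shiftS.
  rewrite (_ : (fun n => bump k T n.+1 t) = cst 0); first exact: cvg_cst.
  by apply/funext => n; apply: bump_out; rewrite ltNge kt.
- by apply: (integrableZ_EFin mQ); apply/integrable_abse: ai.
- move=> n [x t] [/= Ox]; rewrite in_itv/= => /andP[t0 tT].
  rewrite normrM mulrC ler_wpM2r// normrM (ger0_norm (bump_ge0 _ _ _ _)).
  have XM : `|X (stshift (- k) (x, t))| <= M.
    by apply: HM; [exact: subset_closure|rewrite !ltW].
  apply: le_trans XM; rewrite -[leRHS]mulr1 ler_wpM2l ?bump_le1//.
Qed.

Variables (p : ST -> 'rV[R]_d) (kap : ST -> R).
Hypotheses (p2 : L2vQ Om T p) (divp : is_wdiv_x Om T p kap).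
Let pq i : ST -> R := (fun z => p z 0 i) \_ Q.

Lemma green_smooth phi (U : set V) k : smooth phi -> 0 <= k ->
  open U -> lateral Om T `<=` U -> (forall z, U z -> phi z = 0) ->
  \sum_i \int[P]_z (pq i z * ('D_(e_x i) phi \_ Q) (stshift (- k) z)) =
  - \int[P]_z ((kap \_ Q) z * (phi \_ Q) (stshift (- k) z)).
Proof.
move=> sphi k0 oU LU U0.
have cphi := smooth_continuous sphi.
have cD i : continuous ('D_(e_x i) phi) by apply: smooth_continuous; exact: smooth_derive.
have c1 i := cvg_cut k0 (p2 i) (cD i).
have c2 := cvg_cut k0 divp.1 cphi.
have C1 := @cvg_sumr R _ (index_enum 'I_d) _ _ c1.
have C2 := cvgN c2.
apply: (cvg_unique (@Rhausdorff R) C1).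
rewrite (_ : (fun n => _) = (fun n => - \int[nu]_(z in Q)
  (kap z * (phi (stshift (- k) z) * bump k T n.+1 z.2)))); first exact: C2.
apply/funext => n.
have [tt DE] := shifted_test n sphi k0 oU LU U0.
have E := divp.2 _ tt.
pose psi : V -> R := (fun z : V => phi (stshift (- k) z) * bump k T n.+1 z.2) \_ Q.
have E2 : \int[nu]_(z in Q) (kap z * psi z) =
    \int[nu]_(z in Q) (kap z * (phi (stshift (- k) z) * bump k T n.+1 z.2)).
  by apply: eq_Rintegral => z zQ; rewrite /psi patchE zQ.
rewrite -E2 -E.
have i1 i : nu.-integrable Q (EFin \o (fun z => p z 0 i *
    ('D_(e_x i) phi (stshift (- k) z) * bump k T n.+1 z.2))).
  apply: (@L2M R _ ST nu Q mQ _ _ (p2 i)); apply: (smooth_L2Q T oOm bOm).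
  have [sD _] := shift_smooth (- k) (smooth_derive (e_x i) sphi).
  apply: (@smoothM R V _ _ sD).
  exact: (@smooth_snd R 'rV[R]_d R^o _ (smooth_bump k T n.+1)).
have [_ <-] := @Rintegral_sum R _ ST nu Q mQ _ (index_enum 'I_d) _ i1.
apply: eq_Rintegral => z; rewrite inE => Qz; apply: eq_bigr => i _.
by rewrite DE.
Qed.

Lemma L2norm_patch (a : ST -> R) : L2norm P setT (a \_ Q) = normQ Om T a.
Proof.
rewrite /normQ /L2norm; congr Num.sqrt; rewrite [RHS]Rintegral_mkcond.
apply: eq_Rintegral => z _; rewrite !patchE; case: ifP => // _; exact: expr0n.
Qed.

Lemma L2norm_coord (F : ST -> 'rV[R]_d) i : L2vQ Om T F ->
  normQ Om T (fun z => F z 0 i) <= vnormQ Om T F.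
Proof.
move=> F2; rewrite -(ler_pXn2r (n := 2))// ?nnegrE ?sqrtr_ge0//.
rewrite L2norm_sqr (L2vnorm_sqr mQ F2) (bigD1 i)//= lerDl; apply: sumr_ge0 => j _.
by apply: Rintegral_ge0 => z _; exact: sqr_ge0.
Qed.

Lemma shift_pairing (a b : ST -> R) k : L2Q Om T a -> L2Q Om T b ->
  P.-integrable setT (EFin \o (fun z => (a \_ Q) z * (b \_ Q) (stshift k z))) /\
  `|\int[P]_z ((a \_ Q) z * (b \_ Q) (stshift k z))| <= normQ Om T a * normQ Om T b.
Proof.
move=> a2 b2; have a2' := patch_L2 oOm a2; have b2' := patch_L2 oOm b2.
have bs := L2_stshift k b2'.
split; first exact: (L2M measurableT a2' bs).
apply: le_trans (cauchy_schwarz_norm measurableT a2' bs) _.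
by rewrite (L2norm_stshift k b2') !L2norm_patch.
Qed.

Lemma shift_pairingB (a b b' : ST -> R) k : L2Q Om T a -> L2Q Om T b -> L2Q Om T b' ->
  \int[P]_z ((a \_ Q) z * (b \_ Q) (stshift k z)) -
  \int[P]_z ((a \_ Q) z * (b' \_ Q) (stshift k z)) =
  \int[P]_z ((a \_ Q) z * ((b \- b') \_ Q) (stshift k z)).
Proof.
move=> a2 b2 b2'.
rewrite -(RintegralB measurableT (shift_pairing k a2 b2).1 (shift_pairing k a2 b2').1).
apply: eq_Rintegral => z _; rewrite -mulrBr; congr (_ * _); rewrite !patchE.
by case: ifP; rewrite ?subr0.
Qed.

(** Green's formula with a backward shift in time passes from the smooth
    functions that vanish near the lateral boundary to their limits. Only
    spatial derivatives occur, so the ends of the time interval contribute no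
    boundary terms. *)
Lemma green w k : L2Q Om T w -> L2vQ Om T (grad_x Om T w) ->
  zero_on_lateral Om T w -> 0 <= k ->
  \sum_i \int[P]_z (pq i z * ((fun z => grad_x Om T w z 0 i) \_ Q) (stshift (- k) z)) =
  - \int[P]_z ((kap \_ Q) z * (w \_ Q) (stshift (- k) z)).
Proof.
move=> w2 gw2 w0 k0.
apply/eqP; rewrite -subr_eq0 opprK -normr_eq0; apply/eqP/le_anti; rewrite normr_ge0 andbT.
apply/ler_addgt0Pr => e e0; rewrite add0r.
pose C := \sum_i normQ Om T (fun z => p z 0 i) + normQ Om T kap + 1.
have C0 : 0 < C.
  by rewrite ltr_wpDl// addr_ge0 ?sqrtr_ge0// sumr_ge0// => i _; exact: sqrtr_ge0.
have eC : 0 < e / C by rewrite divr_gt0.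
have [phi [sphi [U oU [LU U0]] n1 n2]] := w0 _ eC.
have G := green_smooth sphi k0 oU LU U0.
have phi2 := smooth_L2Q T oOm bOm sphi.
have D2 i := smooth_L2Q T oOm bOm (smooth_derive (e_x i) sphi).
have F2 : L2vQ Om T (fun z => grad_x Om T w z - \row_i 'D_(e_x i) phi z).
  move=> i; have := L2B mQ (gw2 i) (D2 i); congr (L2 _ _ _).
  by apply/funext => z /=; rewrite !mxE.
have S1 i : `|\int[P]_z (pq i z * ((fun z => grad_x Om T w z 0 i) \_ Q) (stshift (- k) z)) -
    \int[P]_z (pq i z * ('D_(e_x i) phi \_ Q) (stshift (- k) z))| <=
    normQ Om T (fun z => p z 0 i) * (e / C).
  rewrite (shift_pairingB (- k) (p2 i) (gw2 i) (D2 i)).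
  apply: le_trans (shift_pairing (- k) (p2 i) (L2B mQ (gw2 i) (D2 i))).2 _.
  rewrite ler_wpM2l ?sqrtr_ge0//; apply: le_trans (ltW n2).
  apply: le_trans (L2norm_coord i F2).
  rewrite le_eqVlt; apply/orP; left; apply/eqP; congr (normQ Om T _).
  by apply/funext => z /=; rewrite !mxE.
have S2 : `|\int[P]_z ((kap \_ Q) z * (w \_ Q) (stshift (- k) z)) -
    \int[P]_z ((kap \_ Q) z * (phi \_ Q) (stshift (- k) z))| <= normQ Om T kap * (e / C).
  rewrite (shift_pairingB (- k) divp.1 w2 phi2).
  apply: le_trans (shift_pairing (- k) divp.1 (L2B mQ w2 phi2)).2 _.
  by rewrite ler_wpM2l ?sqrtr_ge0// ltW.
have := S2; move: G.
move: (\int[P]_z ((kap \_ Q) z * (w \_ Q) _)) (\int[P]_z ((kap \_ Q) z * (phi \_ Q) _)) => A B G {}S2.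
set S := \sum_i _; set S' := \sum_i _ in G.
have SS : `|S - S'| <= (\sum_i normQ Om T (fun z => p z 0 i)) * (e / C).
  rewrite /S /S' -sumrB; apply: le_trans (ler_norm_sum _ _ _) _.
  by rewrite mulr_suml; apply: ler_sum => i _; exact: S1.
have -> : S + A = (S - S') + (A - B) by rewrite G; ring.
apply: le_trans (ler_normD _ _) _; apply: le_trans (lerD SS S2) _.
rewrite -mulrDl mulrC -mulrA ler_piMr ?(ltW e0)// mulrC ler_pdivrMr// mul1r.
by rewrite /C lerDl.
Qed.

End green.

(** * The energy of the error *)
Section traces_on_lateral_boundary.
Context {R : realType} {d : nat}.
Local Notation ST := ('rV[R]_d * measurableTypeR R)%type.
Local Notation V := ('rV[R]_d * R)%type.
Variables (Om : set 'rV[R]_d) (T : R).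
Hypotheses (oOm : open Om) (bOm : bounded_set Om) (T0 : 0 < T).
Local Notation Q := (cylinder Om T).
Local Notation nu := (@leb_st R d).
Implicit Types (w : ST -> R).

Let mQ : measurable Q. Proof. exact: measurable_cylinder. Qed.
Let mOm : measurable Om. Proof. exact: measurable_Om. Qed.

Lemma grad_x_L2 w : has_grad_x Om T w -> L2vQ Om T (grad_x Om T w).
Proof.
move=> gw i; have [H _] := wderivP (gw i); move: H; congr (L2 _ _ _).
by apply/funext => z; rewrite mxE.
Qed.

Lemma has_wderivB h w1 w2 : L2Q Om T w1 -> L2Q Om T w2 -> has_wderiv Om T h w1 ->
  has_wderiv Om T h w2 ->
  is_wderiv Om T h (fun z => w1 z - w2 z) (wderiv Om T h (fun z => w1 z - w2 z)) /\
  {ae nu, forall z, Q z -> wderiv Om T h (fun z => w1 z - w2 z) z =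
     wderiv Om T h w1 z - wderiv Om T h w2 z}.
Proof.
move=> w12 w22 h1 h2.
have H := is_wderivB oOm bOm w12 w22 (wderivP h1) (wderivP h2).
have H' := wderivP (ex_intro _ _ H : has_wderiv Om T h (fun z => w1 z - w2 z)).
by split => //; exact: is_wderiv_unique oOm bOm _ _ _ _ H' H.
Qed.

Lemma L2norm_diff_lt dm (X : measurableType dm) (mu : {measure set X -> \bar R})
    (D : set X) n (F A B : X -> 'rV[R]_n) (eps : R) : measurable D -> 0 < eps ->
  L2v mu D A -> L2v mu D B -> L2v mu D F ->
  (forall i, {ae mu, forall x, D x -> F x 0 i = A x 0 i - B x 0 i}) ->
  L2vnorm mu D A < eps / 2 -> L2vnorm mu D B < eps / 2 -> L2vnorm mu D F < eps.
Proof.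
move=> mD e0 A2 B2 F2 FE nA nB.
have e20 : 0 <= eps / 2 by rewrite divr_ge0// ltW.
have S (G : X -> 'rV[R]_n) : L2vnorm mu D G < eps / 2 -> L2vnorm mu D G ^+ 2 < (eps / 2) ^+ 2.
  by move=> H; rewrite ltr_pXn2r// ?nnegrE ?sqrtr_ge0.
rewrite -(ltr_pXn2r (n := 2))// ?nnegrE ?sqrtr_ge0 ?(ltW e0)//.
apply: (@le_lt_trans _ _ (2 * L2vnorm mu D A ^+ 2 + 2 * L2vnorm mu D B ^+ 2)); last first.
  have := S _ nA; have := S _ nB.
  move: (L2vnorm mu D A ^+ 2) (L2vnorm mu D B ^+ 2) => a b.
  have -> : (eps / 2) ^+ 2 = eps ^+ 2 / 4 by field.
  by move: (eps ^+ 2) => c; lra.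
rewrite !L2vnorm_sqr// !mulr_sumr -big_split/=; apply: ler_sum => i _.
rewrite -(RintegralZl 2 mD (A2 i).2) -(RintegralZl 2 mD (B2 i).2).
have i1 := integrableZ_EFin mD 2 (A2 i).2; have i2 := integrableZ_EFin mD 2 (B2 i).2.
rewrite -(RintegralD mD i1 i2).
apply: (L2_ae_le mD (F2 i).1 (integrableD_EFin mD i1 i2) _).2.
apply: ae_imp (FE i) => x H Dx; rewrite H//=.
move: (A x 0 i) (B x 0 i) => a b; have := sqr_ge0 (a + b).
by rewrite sqrrB sqrrD; move: (a ^+ 2) (b ^+ 2) (a * b) => p q r; lra.
Qed.

Lemma zero_on_lateralB u v : L2Q Om T u -> L2Q Om T v -> has_grad_x Om T u ->
  has_grad_x Om T v -> zero_on_lateral Om T u -> zero_on_lateral Om T v ->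
  zero_on_lateral Om T (fun z => u z - v z).
Proof.
move=> u2 v2 gu gv u0 v0 eps eps0.
have e20 : 0 < eps / 2 by rewrite divr_gt0.
have [p [sp [U oU [LU U0]] p1 p2]] := u0 _ e20.
have [q [sq [W oW [LW W0]] q1 q2]] := v0 _ e20.
pose phi : V -> R := fun z => p z - q z.
have sphi : smooth phi.
  have -> : phi = p + (cst (-1) : V -> R) * q.
    by apply/funext => z; rewrite /phi !fctE mulN1r.
  exact: (@smoothD R V _ _ sp (@smoothM R V _ _ (@smooth_cst R V (-1)) sq)).
have DE z i : 'D_(e_x i) phi z = 'D_(e_x i) p z - 'D_(e_x i) q z.
  have d1 : derivable p z (e_x i) by exact: smooth_derivable.
  have d2 : derivable q z (e_x i) by exact: smooth_derivable.
  exact: (deriveB d1 d2).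
have Dp i := smooth_L2Q T oOm bOm (smooth_derive (e_x i) sp).
have Dq i := smooth_L2Q T oOm bOm (smooth_derive (e_x i) sq).
have gu2 := grad_x_L2 gu; have gv2 := grad_x_L2 gv.
have gE i := has_wderivB u2 v2 (gu i) (gv i).
exists phi; split => //.
- exists (U `&` W); first exact: openI.
  split; first by move=> z Lz; split; [exact: LU|exact: LW].
  by move=> z [Uz Wz]; rewrite /phi U0// W0// subrr.
- have a2 := L2B mQ u2 (smooth_L2Q T oOm bOm sp).
  have b2 := L2N mQ (L2B mQ v2 (smooth_L2Q T oOm bOm sq)).
  have -> : normQ Om T ((fun z => u z - v z) \- phi) =
     L2norm nu Q ((u \- p) \+ (\- (v \- q))).
    by rewrite /normQ; congr (L2norm _ _ _); apply/funext => z; rewrite /phi /=; ring.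
  apply: le_lt_trans (minkowski mQ a2 b2) _.
  by rewrite L2normN [ltRHS]splitr; apply: ltrD.
- have A2 : L2v nu Q (fun z => grad_x Om T u z - \row_i 'D_(e_x i) p z).
    move=> i; have := L2B mQ (gu2 i) (Dp i); congr (L2 _ _ _).
    by apply/funext => z /=; rewrite !mxE.
  have B2 : L2v nu Q (fun z => grad_x Om T v z - \row_i 'D_(e_x i) q z).
    move=> i; have := L2B mQ (gv2 i) (Dq i); congr (L2 _ _ _).
    by apply/funext => z /=; rewrite !mxE.
  have F2 : L2v nu Q (fun z => grad_x Om T (fun z => u z - v z) z - \row_i 'D_(e_x i) phi z).
    move=> i; have := L2B mQ (gE i).1.1 (smooth_L2Q T oOm bOm (smooth_derive (e_x i) sphi)).
    by congr (L2 _ _ _); apply/funext => z /=; rewrite !mxE.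
  apply: (L2norm_diff_lt mQ eps0 A2 B2 F2 _ p2 q2) => i.
  apply: ae_imp (gE i).2 => z H Qz; rewrite !mxE (H Qz) DE.
  by rewrite opprD [in RHS]opprD addrACA.
Qed.

Lemma time_trace_L2 w : L2 (leb d) Om (time_trace Om T T w).
Proof.
rewrite /time_trace; case: xgetP => [tr -> [W [L _ _ ->]]|_].
  by apply: L => //; rewrite lexx ltW.
exact: L2_cst mOm _ (leb_Om_lty oOm bOm).
Qed.

Lemma vnorm_end_sqr (y : ST -> 'rV[R]_d) : vnorm_end Om T y ^+ 2 =
  \sum_i L2norm (leb d) Om (time_trace Om T T (fun z => y z 0 i)) ^+ 2.
Proof.
rewrite /vnorm_end L2vnorm_sqr//; last first.
  move=> i; have := time_trace_L2 (fun z => y z 0 i); congr (L2 _ _ _).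
  by apply/funext => x; rewrite mxE.
apply: eq_bigr => i _; rewrite L2norm_sqr; apply: eq_Rintegral => x _.
by rewrite mxE.
Qed.

End traces_on_lateral_boundary.

Section error_identity.
Context {R : realType} {d : nat}.
Local Notation ST := ('rV[R]_d * measurableTypeR R)%type.
Variables (Om : set 'rV[R]_d) (T : R).
Hypotheses (oOm : open Om) (bOm : bounded_set Om) (T0 : 0 < T).
Local Notation Q := (cylinder Om T).
Local Notation nu := (@leb_st R d).
Local Notation leb1 := (@lebesgue_measure R).
Local Notation P := (lebs d \x leb1)%E.
Implicit Types (w a b : ST -> R).

Let mQ : measurable Q. Proof. exact: measurable_cylinder. Qed.
Let mOm : measurable Om. Proof. exact: measurable_Om. Qed.

Lemma is_time_traceB s w1 w2 (g1 g2 : 'rV[R]_d -> R) : is_time_trace Om T s w1 g1 ->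
  is_time_trace Om T s w2 g2 ->
  is_time_trace Om T s (fun z => w1 z - w2 z) (fun x => g1 x - g2 x).
Proof.
move=> [W1 [L1 C1 E1 ->]] [W2 [L2' C2 E2 ->]].
exists (fun t x => W1 t x - W2 t x); split => //.
- by move=> t tT; exact: (L2B mOm (L1 t tT) (L2' t tT)).
- move=> t0 t0T; apply/cvgrPdist_lt => e e0; have e20 : 0 < e / 2 by rewrite divr_gt0.
  have /cvgrPdist_lt/(_ _ e20) := C1 t0 t0T; have /cvgrPdist_lt/(_ _ e20) := C2 t0 t0T.
  rewrite !near_withinE; apply: filterS2 => t H2 H1 tI.
  have tT : 0 <= t <= T by move: tI; rewrite /= in_itv.
  have := H1 tI; have := H2 tI; rewrite !sub0r !normrN !ger0_norm ?L2norm_ge0// => n2 n1.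
  have f1 := L2B mOm (L1 t tT) (L1 t0 t0T); have f2 := L2B mOm (L2' t tT) (L2' t0 t0T).
  have -> : L2norm (leb d) Om ((fun x => W1 t x - W2 t x) \- (fun x => W1 t0 x - W2 t0 x)) =
      L2norm (leb d) Om ((W1 t \- W1 t0) \+ (\- (W2 t \- W2 t0))).
    by congr (L2norm _ _ _); apply/funext => x /=; rewrite opprD [in RHS]opprD addrACA.
  apply: le_lt_trans (minkowski mOm f1 (L2N mOm f2)) _.
  by rewrite L2normN [ltRHS]splitr ltrD.
- apply: ae_imp2 E1 E2 => t F1 F2 tT.
  by apply: ae_imp2 (F1 tT) (F2 tT) => x G1 G2 Ox; rewrite G1// G2.
Qed.

Lemma pair_patch a b : \int[P]_z ((a \_ Q) z * (b \_ Q) z) = \int[nu]_(z in Q) (a z * b z).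
Proof.
rewrite [RHS]Rintegral_mkcond; apply: eq_Rintegral => z _; rewrite !patchE.
by case: ifP => // _; rewrite mul0r.
Qed.

Lemma patch_ae a b : {ae nu, forall z, Q z -> a z = b z} ->
  {ae P, forall z, setT z -> (a \_ Q) z = (b \_ Q) z}.
Proof.
move=> ab; apply: (ae_imp (mu := nu) _ ab) => z H _; rewrite !patchE.
by case: ifPn => //; rewrite inE.
Qed.

Lemma pairing_ae a a' b b' : L2Q Om T a -> L2Q Om T a' -> L2Q Om T b -> L2Q Om T b' ->
  {ae nu, forall z, Q z -> a z = a' z} -> {ae nu, forall z, Q z -> b z = b' z} ->
  \int[nu]_(z in Q) (a z * b z) = \int[nu]_(z in Q) (a' z * b' z).
Proof.
move=> a2 a2' b2 b2' aE bE; apply: (ae_eq_Rintegral mQ).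
- exact: (measurable_funM a2.1 b2.1).
- exact: (measurable_funM a2'.1 b2'.1).
- by apply: ae_imp2 aE bE => z A B Qz; rewrite A// B.
Qed.

Lemma stshift0 (z : ST) : stshift 0 z = z.
Proof. by case: z => x t; rewrite /stshift /tshift /= addr0. Qed.

Let slab : set ST := [set z : ST | Om z.1 /\ 0 < (z.2 : R) < T].

Lemma slabP (z : ST) : slab z -> Q z.
Proof. by move=> [Oz tz]; split => //=; rewrite in_itv. Qed.

Lemma patch_slab a (z : ST) : ~ slab z -> (a \_ Q) z = 0.
Proof.
move=> nz; rewrite patchE memNset// => -[Oz /=]; rewrite in_itv => tz.
Qed.

Variables (p : ST -> 'rV[R]_d) (kap e g : ST -> R) (r rho : 'I_d -> ST -> R).
Hypotheses (p2 : L2vQ Om T p) (divp : is_wdiv_x Om T p kap).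
Hypotheses (e2 : L2Q Om T e) (ge : has_grad_x Om T e) (e0 : zero_on_lateral Om T e).
Hypotheses (eg : is_wderiv Om T e_t e g) (init : is_time_trace Om T 0 e (cst 0)).
Hypothesis r2 : forall i, L2Q Om T (r i).
Hypothesis rrho : forall i, is_wderiv Om T e_t (r i) (rho i).
Let q i : ST -> R := fun z => grad_x Om T e z 0 i.
Hypothesis pE : forall i, {ae nu, forall z, Q z -> p z 0 i = r i z - q i z}.

Let q2 i : L2Q Om T (q i). Proof. exact: grad_x_L2. Qed.
Let kap2 : L2Q Om T kap. Proof. exact: divp.1. Qed.
Let g2 : L2Q Om T g. Proof. exact: eg.1. Qed.
Let rho2 i : L2Q Om T (rho i). Proof. exact: (rrho i).1. Qed.

(* [e'] and [r'] below are representatives of [e] and [r] that are given by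
   primitives at every point of the cylinder *)
Let e' : ST -> R := stprimitive (g \_ Q) \_ Q.
Let e'2 : L2 P setT e'.
Proof. by apply: (patch_L2 oOm); exact: stprimitive_L2Q. Qed.
Let e'E : {ae nu, forall z, Q z -> e z = stprimitive (g \_ Q) z}.
Proof. exact: (representation0 oOm bOm T0 e2 eg init). Qed.

Let rep i := time_representation oOm bOm T0 (r2 i) (rrho i).
Let c i := sval (cid (rep i)).
Let cP i : [/\ measurable_fun setT (c i), L2 (leb d) Om (c i) &
    {ae nu, forall z, Q z -> r i z = c i z.1 + stprimitive (rho i \_ Q) z}].
Proof. exact: svalP (cid (rep i)). Qed.

Let r' i : ST -> R := (fun z : ST => c i z.1 + stprimitive (rho i \_ Q) z) \_ Q.
Let r'E i : {ae P, forall z, setT z -> (r i \_ Q) z = r' i z}.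
Proof. by apply: patch_ae; case: (cP i). Qed.
Let r'2 i : L2 P setT (r' i).
Proof.
apply: (ae_eq_L2 measurableT _ (r'E i) (patch_L2 oOm (r2 i))).
have [mc _ _] := cP i; apply/(measurable_restrictT _ mQ); apply: measurable_funTS.
apply: measurable_funD; first exact: (measurableT_comp mc measurable_fst).
by apply: measurable_primitive; exact: (patch_L2 oOm (rho2 i)).1.
Qed.

Let green' k : 0 <= k ->
  \sum_i \int[P]_z ((r' i z - (q i \_ Q) z) * (q i \_ Q) (stshift (- k) z)) =
  - \int[P]_z ((kap \_ Q) z * e' (stshift (- k) z)).
Proof.
move=> k0.
have G := green oOm bOm p2 divp e2 (grad_x_L2 ge) e0 k0.
have -> : \int[P]_z ((kap \_ Q) z * e' (stshift (- k) z)) =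
    \int[P]_z ((kap \_ Q) z * (e \_ Q) (stshift (- k) z)).
  have s2 := stprimitive_L2Q oOm T0 g2.
  apply/esym/eqP; rewrite -subr_eq0 -normr_eq0; apply/eqP/le_anti; rewrite normr_ge0 andbT.
  rewrite (shift_pairingB oOm (- k) kap2 e2 s2).
  apply: le_trans (shift_pairing oOm (- k) kap2 (L2B mQ e2 s2)).2 _.
  have -> : normQ Om T (e \- stprimitive (g \_ Q)) = 0; last by rewrite mulr0.
  rewrite /normQ /L2norm (_ : \int[_]_(z in _) _ = 0) ?sqrtr0//.
  rewrite -[RHS](mul0r (fine (nu Q))) -(Rintegral_cst _ mQ 0).
  apply: (ae_eq_Rintegral mQ) => //.
    by apply: measurable_funX; exact: (L2B mQ e2 s2).1.
  by apply: ae_imp e'E => z H Qz /=; rewrite H// subrr expr0n.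
rewrite -G; apply: eq_bigr => i _.
have qs := L2_stshift (- k) (patch_L2 oOm (q2 i)).
apply: (ae_eq_Rintegral measurableT).
- apply: measurable_funM; last exact: qs.1.
  by apply: measurable_funB; [exact: (r'2 i).1|exact: (patch_L2 oOm (q2 i)).1].
- by apply: measurable_funM; [exact: (patch_L2 oOm (p2 i)).1|exact: qs.1].
- have H := patch_ae (pE i).
  apply: ae_imp2 H (r'E i) => z A B _.
  congr (_ * _); rewrite -(B I) -/(q i).
  have -> : (r i \_ Q) z - (q i \_ Q) z = ((fun z => r i z - q i z) \_ Q) z.
    by rewrite !patchE; case: ifP; rewrite ?subr0.
  exact: esym (A I).
Qed.

(** Green's formula for [e] without shift. *)
Lemma gradient_identity : vnormQ Om T (grad_x Om T e) ^+ 2 =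
  \sum_i \int[nu]_(z in Q) (r i z * q i z) + \int[nu]_(z in Q) (kap z * e z).
Proof.
have s2 := stprimitive_L2Q oOm T0 g2.
have G := green' (lexx 0).
have K : \int[P]_z ((kap \_ Q) z * e' (stshift (- 0) z)) = \int[nu]_(z in Q) (kap z * e z).
  transitivity (\int[P]_z ((kap \_ Q) z * e' z)).
    by apply: eq_Rintegral => z _; rewrite oppr0 stshift0.
  rewrite pair_patch; apply/esym/(pairing_ae kap2 kap2 e2 s2) => //.
  exact: aeW.
have S i : \int[P]_z ((r' i z - (q i \_ Q) z) * (q i \_ Q) (stshift (- 0) z)) =
    \int[nu]_(z in Q) (r i z * q i z) - \int[nu]_(z in Q) (q i z ^+ 2).
  have qp := patch_L2 oOm (q2 i).
  transitivity (\int[P]_z (r' i z * (q i \_ Q) z) - \int[P]_z ((q i \_ Q) z * (q i \_ Q) z)).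
    rewrite -(RintegralB measurableT (L2M measurableT (r'2 i) qp) (L2M measurableT qp qp)).
    by apply: eq_Rintegral => z _; rewrite oppr0 stshift0 mulrBl.
  have S2 : \int[P]_z ((q i \_ Q) z * (q i \_ Q) z) = \int[nu]_(z in Q) (q i z ^+ 2).
    by rewrite (pair_patch (q i) (q i)); apply: eq_Rintegral => z _; rewrite expr2.
  have S1 : \int[P]_z (r' i z * (q i \_ Q) z) = \int[nu]_(z in Q) (r i z * q i z).
    rewrite -(pair_patch (r i) (q i)); apply: (ae_eq_Rintegral measurableT).
    - exact: (measurable_funM (r'2 i).1 qp.1).
    - exact: (measurable_funM (patch_L2 oOm (r2 i)).1 qp.1).
    - by apply: ae_imp (r'E i) => z H zT; rewrite (H zT).
  by rewrite S1 S2.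
move: G; rewrite K (eq_bigr _ (fun i _ => S i)) sumrB => G.
rewrite (L2vnorm_sqr mQ (grad_x_L2 ge)).
have H (a b k : R) : a - b = - k -> b = a + k by move=> E; lra.
exact: H G.
Qed.

(** As its initial trace vanishes, [e] is the primitive of [g], and
    [energy_of_primitive] applies. *)
Lemma final_energy : norm_end Om T e ^+ 2 / 2 <= \int[nu]_(z in Q) (e z * g z).
Proof.
have s2 := stprimitive_L2Q oOm T0 g2.
have -> : \int[nu]_(z in Q) (e z * g z) = \int[P]_z (e' z * (g \_ Q) z).
  by rewrite pair_patch; apply: (pairing_ae e2 s2 g2 g2) => //; exact: aeW.
apply: (energy_of_primitive T0) => //.
- exact: patch_slab.
- exact: patch_slab.
- exact: patch_L2.
- by move=> z /slabP Qz; rewrite /e' patchE mem_set.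
move=> eta eta0; apply: filterS (time_trace_late oOm T0 e2 eta0) => n.
move=> H; apply: le_trans H _; rewrite le_eqVlt; apply/orP; left; apply/eqP; congr (_ * _).
have mL := measurable_late (X := 'rV[R]_d) (T - T / n.+2%:R).
apply: (ae_eq_Rintegral mL).
- by apply: measurable_funX; apply: measurable_funTS; exact: (patch_L2 oOm e2).1.
- by apply: measurable_funX; apply: measurable_funTS; exact: e'2.1.
- by apply: ae_imp (patch_ae e'E) => z H _; rewrite (H I).
Qed.

(** This is [energy_at_end], in which [time_trace_late] bounds the energy in the
    last time windows from below. *)
Lemma final_gradient_energy eps : 1 <= eps ->
  2^-1 * (1 - eps^-1) * vnorm_end Om T (grad_x Om T e) ^+ 2 <=
  \int[nu]_(z in Q) (kap z * g z) - \sum_i \int[nu]_(z in Q) (q i z * rho i z)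
  + eps / 2 * \sum_i L2norm (leb d) Om (time_trace Om T T (r i)) ^+ 2.
Proof.
move=> eps1; rewrite vnorm_end_sqr//.
pose rT i (x : 'rV[R]_d) := c i x + stprimitive (rho i \_ Q) (x, T).
have TT : 0 <= T <= T by rewrite lexx ltW.
have rT2 i : L2 (lebs d) Om (rT i).
  have [mc c2 wE] := cP i.
  have [W [L _ _ WE]] := trace_of_representation oOm T (rho2 i) mc c2 wE.
  by rewrite /rT WE; exact: L.
have rTE i : L2norm (leb d) Om (time_trace Om T T (r i)) ^+ 2 =
    \int[lebs d]_(x in Om) (rT i x ^+ 2).
  have [mc c2 wE] := cP i.
  by rewrite (time_trace_norm oOm T0 (rrho i) mc c2 wE) L2norm_sqr.
have -> : \int[nu]_(z in Q) (kap z * g z) = \int[P]_z ((kap \_ Q) z * (g \_ Q) z).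
  by rewrite pair_patch.
have -> : \sum_i \int[nu]_(z in Q) (q i z * rho i z) =
    \sum_i \int[P]_z ((q i \_ Q) z * (rho i \_ Q) z).
  by apply: eq_bigr => i _; rewrite pair_patch.
have -> : \sum_i L2norm (leb d) Om (time_trace Om T T (r i)) ^+ 2 =
    \sum_i \int[lebs d]_(x in Om) (rT i x ^+ 2) by apply: eq_bigr => i _; exact: rTE.
apply: (energy_at_end mOm T0 (r := r') (c := c) (e := e')) => //.
- by move=> i z; exact: patch_slab.
- by move=> i z; exact: patch_slab.
- by move=> i z; exact: patch_slab.
- exact: patch_slab.
- exact: patch_slab.
- exact: patch_slab.
- by move=> i; exact: patch_L2.
- by move=> i; exact: patch_L2.
- exact: patch_L2.
- exact: patch_L2.
- by move=> i z /slabP Qz; rewrite /r' patchE mem_set.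
- by move=> z /slabP Qz; rewrite /e' patchE mem_set.
- by move=> k /andP[k0 _]; exact: green'.
- by move=> i eta eta0; exact: (time_trace_late oOm T0 (q2 i) eta0).
Qed.

End error_identity.

(** * The majorant and its optimal parameters *)
Section majorant.
Context {R : realType}.
Implicit Types a b c k x y : R.

Lemma young x y k : 0 < k -> 2 * (x * y) <= k * x ^+ 2 + k^-1 * y ^+ 2.
Proof.
move=> k0; have kn : k != 0 by rewrite gt_eqF.
have : 0 <= k^-1 * (k * x - y) ^+ 2 by rewrite mulr_ge0 ?sqr_ge0// invr_ge0 ltW.
have -> : k^-1 * (k * x - y) ^+ 2 = k * x ^+ 2 + k^-1 * y ^+ 2 - 2 * (x * y) by field.
by rewrite subr_ge0.
Qed.

Lemma young_sqrD x y k : 0 < k -> (x + y) ^+ 2 <= (1 + k) * x ^+ 2 + (1 + 1 / k) * y ^+ 2.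
Proof.
move=> k0; have := young x y k0; rewrite sqrrD -mulr_natl div1r !mulrDl !mul1r.
by move: (x ^+ 2) (y ^+ 2) (x * y) (k * _) (k^-1 * _) => p q r s t; lra.
Qed.

(** Twice the first estimate plus [2 * delta] times the second. The products
    with [A] are collected before Young's inequality with the parameter [zeta]
    is applied, and [beta1], [beta2] then split the square of a sum of three
    terms. Here [A], [B], [E] are the norms of the gradient, of the time
    derivative and of the error itself, and [N], [G] the squared norms of the
    final traces of the error and of its gradient. *)
Lemma error_majorant (A B N G E rr req rh S CF delta zeta eps beta1 beta2 : R) :
  0 <= A -> 0 <= B -> 0 <= req -> 0 < CF -> 0 < delta -> 0 < zeta ->
  0 < beta1 -> 0 < beta2 ->
  A ^+ 2 + N / 2 <= rr * A + req * E -> E <= CF * A ->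
  2^-1 * (1 - eps^-1) * G <= req * B - B ^+ 2 + rh * A + eps / 2 * S ->
  (2 - 1 / zeta) * (A ^+ 2 + delta * B ^+ 2) + delta * (1 - 1 / eps) * G + N <=
  eps * delta * S + zeta * ((1 + beta1) * ((1 + beta2) * rr ^+ 2
    + (1 + 1 / beta2) * CF ^+ 2 * req ^+ 2)
    + (1 + 1 / beta1) * delta ^+ 2 * rh ^+ 2 + delta * req ^+ 2).
Proof.
move=> A0 B0 req0 CF0 d0 z0 b10 b20 h1 hE h2.
have h1' : 2 * A ^+ 2 + N <= 2 * ((rr + CF * req) * A).
  have : req * E <= req * (CF * A) by rewrite ler_wpM2l.
  have -> : (rr + CF * req) * A = rr * A + req * (CF * A) by ring.
  by move: h1; move: (rr * A) (req * E) (req * _) (A ^+ 2) => a b c x *; lra.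
have h2' : delta * (1 - eps^-1) * G + 2 * (delta * B ^+ 2) <=
    2 * (delta * (req * B)) + 2 * (delta * rh * A) + eps * delta * S.
  have := ler_wpM2l (ltW (mulr_gt0 (ltr0n R 2) d0)) h2.
  have K k : 2 * delta * (2^-1 * (1 - k) * G) = delta * (1 - k) * G by field.
  rewrite (K eps^-1).
  have -> : 2 * delta * (req * B - B ^+ 2 + rh * A + eps / 2 * S) =
    2 * (delta * (req * B)) - 2 * (delta * B ^+ 2) + 2 * (delta * rh * A) + eps * delta * S by field.
  by move: (delta * (1 - eps^-1) * G) (delta * (req * B)) (delta * B ^+ 2) (delta * rh * A) (eps * delta * S) => *; lra.
have y1 := young (rr + CF * req + delta * rh) A z0.
have y2 := ler_wpM2l (ltW d0) (young req B z0).
have s1 := young_sqrD (rr + CF * req) (delta * rh) b10.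
have b11 : 0 <= 1 + beta1 by rewrite addr_ge0// ltW.
have s2 := ler_wpM2l b11 (young_sqrD rr (CF * req) b20).
have s := ler_wpM2l (ltW z0) (lerD s1 s2).
rewrite !div1r.
have e1 : (rr + CF * req + delta * rh) * A = (rr + CF * req) * A + delta * rh * A by ring.
rewrite e1 in y1.
have -> : (2 - zeta^-1) * (A ^+ 2 + delta * B ^+ 2) = 2 * A ^+ 2 + 2 * (delta * B ^+ 2)
  - (zeta^-1 * A ^+ 2 + delta * (zeta^-1 * B ^+ 2)) by ring.
have -> : zeta * ((1 + beta1) * ((1 + beta2) * rr ^+ 2 + (1 + beta2^-1) * CF ^+ 2 * req ^+ 2)
    + (1 + beta1^-1) * delta ^+ 2 * rh ^+ 2 + delta * req ^+ 2) =
  zeta * ((1 + beta1) * ((1 + beta2) * rr ^+ 2 + (1 + beta2^-1) * (CF * req) ^+ 2)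
    + (1 + beta1^-1) * (delta * rh) ^+ 2) + delta * (zeta * req ^+ 2) by ring.
have e2 : delta * (2 * (req * B)) = 2 * (delta * (req * B)) by ring.
have e3 : delta * (zeta * req ^+ 2 + zeta^-1 * B ^+ 2) =
  delta * (zeta * req ^+ 2) + delta * (zeta^-1 * B ^+ 2) by ring.
rewrite e2 e3 in y2.
move: s; rewrite !div1r !mulrDr.
move: (zeta * (rr + CF * req + delta * rh) ^+ 2) y1 => X1 y1.
move: (zeta * ((1 + beta1) * (rr + CF * req) ^+ 2)) => X2.
move=> s.
rewrite ?mulrDr in h1' y1 y2 h2' *.
lra.
Qed.

(** Completing squares: the excess over the minimal value is a sum of two
    nonnegative terms which vanish exactly at the optimal parameters. *)
Lemma majorant_excess a b c (beta1 beta2 : R) : 0 < beta1 -> 0 < beta2 ->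
  (1 + beta1) * ((1 + beta2) * a ^+ 2 + (1 + 1 / beta2) * c ^+ 2) + (1 + 1 / beta1) * b ^+ 2 =
  (a + b + c) ^+ 2 + ((1 + beta1) / beta2 * (beta2 * a - c) ^+ 2
    + beta1^-1 * (beta1 * (a + c) - b) ^+ 2).
Proof.
move=> b1 b2; have n1 : beta1 != 0 by rewrite gt_eqF.
have n2 : beta2 != 0 by rewrite gt_eqF.
by field; rewrite n1.
Qed.

Lemma majorant_minimizer a b c (K1 K2 beta1 beta2 : R) : 0 < a -> 0 < b -> 0 < c ->
  0 < beta1 -> 0 < beta2 ->
  let F x y := K1 + (1 + x) * ((1 + y) * a ^+ 2 + (1 + 1 / y) * c ^+ 2)
    + (1 + 1 / x) * b ^+ 2 + K2 in
  (forall x y, 0 < x -> 0 < y -> F beta1 beta2 <= F x y) <->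
  beta1 = b / (a + c) /\ beta2 = c / a.
Proof.
move=> a0 b0 c0 b10 b20 F.
have ac0 : 0 < a + c by rewrite addr_gt0.
have regroup (k1 k2 p q t1 t2 : R) : p + q = t1 + t2 -> k1 + p + q + k2 = k1 + k2 + t1 + t2.
  by move=> E; rewrite -(addrA (k1 + k2)) -E; ring.
have FE x y : 0 < x -> 0 < y -> F x y = K1 + K2 + (a + b + c) ^+ 2 +
    ((1 + x) / y * (y * a - c) ^+ 2 + x^-1 * (x * (a + c) - b) ^+ 2).
  move=> x0 y0; rewrite /F; apply: regroup; exact: majorant_excess.
have e1 x y : 0 < x -> 0 < y -> 0 <= (1 + x) / y * (y * a - c) ^+ 2.
  by move=> x0 y0; rewrite mulr_ge0 ?sqr_ge0// divr_ge0 ?addr_ge0 ?ltW.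
have e2 x : 0 < x -> 0 <= x^-1 * (x * (a + c) - b) ^+ 2.
  by move=> x0; rewrite mulr_ge0 ?sqr_ge0// invr_ge0 ltW.
have s10 : 0 < b / (a + c) by rewrite divr_gt0.
have s20 : 0 < c / a by rewrite divr_gt0.
have Fs : F (b / (a + c)) (c / a) = K1 + K2 + (a + b + c) ^+ 2.
  rewrite FE// mulfVK ?gt_eqF// mulfVK ?gt_eqF// !subrr expr0n/= !mulr0.
  by rewrite !addr0.
split=> [/(_ _ _ s10 s20)|[-> ->] x y x0 y0]; last first.
  by rewrite Fs FE// lerDl addr_ge0// ?e1// e2.
rewrite Fs FE// gerDl => le0.
have p1 := e1 _ _ b10 b20; have p2 := e2 _ b10.
have z1 : (1 + beta1) / beta2 * (beta2 * a - c) ^+ 2 = 0.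
  by apply/le_anti; rewrite p1 andbT; apply: le_trans le0; rewrite lerDl.
have z2 : beta1^-1 * (beta1 * (a + c) - b) ^+ 2 = 0.
  by apply/le_anti; rewrite p2 andbT; apply: le_trans le0; rewrite lerDr.
split.
  move/eqP: z2; rewrite mulf_eq0 invr_eq0 gt_eqF//= sqrf_eq0 subr_eq0 => /eqP <-.
  by rewrite mulfK// gt_eqF.
move/eqP: z1; rewrite mulf_eq0 (gt_eqF (divr_gt0 (addr_gt0 ltr01 b10) b20))/=.
rewrite sqrf_eq0 subr_eq0 => /eqP <-.
by rewrite mulfK// gt_eqF.
Qed.
End majorant.

(** * The error estimate *)
Section error_energy.
Context {R : realType} {d : nat}.
Local Notation ST := ('rV[R]_d * measurableTypeR R)%type.
Variables (Om : set 'rV[R]_d) (T : R).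
Hypotheses (oOm : open Om) (bOm : bounded_set Om) (T0 : 0 < T).
Local Notation Q := (cylinder Om T).
Local Notation nu := (@leb_st R d).

Let mQ : measurable Q. Proof. exact: measurable_cylinder. Qed.

Variables (f u v : ST -> R) (y : ST -> 'rV[R]_d).
Hypotheses (f2 : L2Q Om T f) (hu : heat_solution Om T f u)
  (hv : V_grad_dt Om T v) (hy : H_div_x_1 Om T y).
Let e : ST -> R := fun z => u z - v z.
Let r_eq : ST -> R := fun z => f z - dt Om T v z + div_x Om T y z.
Let r_d : ST -> 'rV[R]_d := fun z => y z - grad_x Om T v z.
Let A := vnormQ Om T (grad_x Om T e).
Let B := normQ Om T (dt Om T e).

(** The estimates that [error_majorant] combines: Friedrichs' inequality and the
    results of testing with the error and with its difference quotients in
    time. *)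
Lemma error_energy :
  [/\ forall CF, friedrichs_constant Om T CF -> normQ Om T e <= CF * A,
      A ^+ 2 + norm_end Om T e ^+ 2 / 2 <=
        vnormQ Om T r_d * A + normQ Om T r_eq * normQ Om T e &
      forall eps, 1 <= eps ->
        2^-1 * (1 - eps^-1) * vnorm_end Om T (grad_x Om T e) ^+ 2 <=
        normQ Om T r_eq * B - B ^+ 2 + vnormQ Om T (vdt Om T r_d) * A
        + eps / 2 * vnorm_end Om T r_d ^+ 2].
Proof.
have [[[[u2 gu ut] u0] uw ui] heat] := hu.
have [[[[v2 gv vt] v0] vw vi] gvt] := hv.
have [y2 yw yt] := hy.
have e2 : L2Q Om T e by exact: (L2B mQ u2 v2).
have gE i := has_wderivB oOm bOm u2 v2 (gu i) (gv i).
have ge : has_grad_x Om T e.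
  by move=> i; exists (wderiv Om T (e_x i) e); exact: (gE i).1.
have [eg dE] := has_wderivB oOm bOm u2 v2 ut vt.
have e0 : zero_on_lateral Om T e by exact: zero_on_lateralB.
have init : is_time_trace Om T 0 e (cst 0).
  have := is_time_traceB oOm ui vi; congr (is_time_trace _ _ _ _ _).
  by apply/funext => x; rewrite /= subrr.
have g2 : L2Q Om T (dt Om T e) := eg.1.
have gu2 := grad_x_L2 gu; have ge2 := grad_x_L2 ge.
have [dy2 _] := wdivP yw.
have dtv2 := (wderivP vt).1 : L2Q Om T (dt Om T v).
have req2 : L2Q Om T r_eq by exact: (L2D mQ (L2B mQ f2 dtv2) dy2).
pose r i : ST -> R := fun z => r_d z 0 i.
have rdE i : r i = (fun z => y z 0 i - wderiv Om T (e_x i) v z).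
  by apply/funext => z; rewrite /r /r_d !mxE.
have r2 i : L2Q Om T (r i).
  by rewrite rdE; exact: (L2B mQ (y2 i) (wderivP (gv i)).1).
(* the regularity of [dt v] enters here: it gives [r_d] a time derivative *)
have gvt' i : is_wderiv Om T e_t (wderiv Om T (e_x i) v) (wderiv Om T (e_x i) (dt Om T v)).
  exact: (is_wderiv_mixed (wderivP vt) (wderivP (gv i)) (wderivP (gvt i))).
pose rho i : ST -> R := fun z => vdt Om T r_d z 0 i.
have rhoE i : rho i = dt Om T (r i) by apply/funext => z; rewrite /rho /vdt mxE.
have rrho i : is_wderiv Om T e_t (r i) (rho i).
  rewrite rhoE; apply: wderivP; rewrite rdE.
  eexists; exact: (is_wderivB oOm bOm (y2 i) (wderivP (gv i)).1 (wderivP (yt i)) (gvt' i)).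
(* comparing with the exact flux leaves a field whose divergence and values are
   both expressed by the residuals and the first derivatives of [e] *)
pose p z := y z - grad_x Om T u z.
pose kap z := div_x Om T y z - lap_x Om T u z.
have p2 : L2vQ Om T p.
  move=> i; have := L2B mQ (y2 i) (gu2 i); congr (L2 _ _ _).
  by apply/funext => z; rewrite /p /= !mxE.
have divp : is_wdiv_x Om T p kap by exact: (is_wdiv_xB oOm bOm y2 gu2 (wdivP yw) (wdivP uw)).
have kap2 : L2Q Om T kap := divp.1.
have pE i : {ae nu, forall z, Q z -> p z 0 i = r i z - grad_x Om T e z 0 i}.
  apply: ae_imp (gE i).2 => z H Qz; rewrite rdE /p !mxE (H Qz).
  by move: (wderiv _ _ _ u z) (wderiv _ _ _ v z) (y z 0 i) => a b c; ring.
have kapE : {ae nu, forall z, Q z -> kap z = r_eq z - dt Om T e z}.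
  apply: ae_imp2 heat dE => z H1 H2 Qz.
  have := H1 Qz; have := H2 Qz; rewrite /kap /r_eq -/(dt Om T e z) -/(dt Om T u z) -/(dt Om T v z).
  move: (dt Om T e z) (dt Om T u z) (dt Om T v z) (lap_x Om T u z) (div_x Om T y z) (f z) => a b c l k m -> <-.
  by ring.
have kapI (b : ST -> R) : L2Q Om T b -> \int[nu]_(z in Q) (kap z * b z) =
    \int[nu]_(z in Q) (r_eq z * b z) - \int[nu]_(z in Q) (dt Om T e z * b z).
  move=> b2; rewrite -(RintegralB mQ (L2M mQ req2 b2) (L2M mQ g2 b2)).
  apply: (ae_eq_Rintegral mQ).
  - exact: (measurable_funM kap2.1 b2.1).
  - exact: (measurable_funB (measurable_funM req2.1 b2.1) (measurable_funM g2.1 b2.1)).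
  - by apply: ae_imp kapE => z H Qz; rewrite (H Qz) mulrBl.
have G1 := gradient_identity oOm bOm T0 p2 divp e2 ge e0 eg init r2 rrho pE.
have G2 := final_energy oOm bOm T0 e2 eg init.
split.
- by move=> CF [_]; apply.
- rewrite {1}/A G1 (kapI _ e2).
  have C1 : \sum_i \int[nu]_(z in Q) (r i z * grad_x Om T e z 0 i) <= vnormQ Om T r_d * A.
    exact: (cauchy_schwarzv mQ (r2 : L2v nu Q r_d) ge2).
  have C2 : \int[nu]_(z in Q) (r_eq z * e z) <= normQ Om T r_eq * normQ Om T e.
    exact: (cauchy_schwarz mQ req2 e2).
  have E : \int[nu]_(z in Q) (e z * wderiv Om T e_t (fun z => u z - v z) z) =
      \int[nu]_(z in Q) (dt Om T e z * e z).
    by apply: eq_Rintegral => z _; rewrite mulrC.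
  move: G2 C1 C2; rewrite E.
  move: (\sum_i _) (\int[nu]_(z in Q) (r_eq z * e z)) (\int[nu]_(z in Q) (dt Om T e z * e z))
    (norm_end Om T e ^+ 2) (vnormQ Om T r_d * A) (_ * _) => *; lra.
move=> eps eps1.
have := final_gradient_energy oOm bOm T0 p2 divp e2 ge e0 eg init r2 rrho pE eps1.
rewrite (kapI _ g2) => H; apply: le_trans H _; rewrite (vnorm_end_sqr oOm bOm T0 r_d) lerD2r.
have C1 : \int[nu]_(z in Q) (r_eq z * dt Om T e z) <= normQ Om T r_eq * B.
  exact: (cauchy_schwarz mQ req2 g2).
have C2 : - \sum_i \int[nu]_(z in Q) (grad_x Om T e z 0 i * rho i z) <= vnormQ Om T (vdt Om T r_d) * A.
  have n2 : L2v nu Q (fun z => - vdt Om T r_d z).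
    move=> i; have := L2N mQ (rrho i).1; congr (L2 _ _ _).
    by apply/funext => z; rewrite /rho /= !mxE.
  have CS := cauchy_schwarzv mQ n2 ge2.
  have NE : L2vnorm nu Q (fun z => - vdt Om T r_d z) = vnormQ Om T (vdt Om T r_d).
    rewrite /vnormQ /L2vnorm; congr Num.sqrt; apply: eq_Rintegral => z _.
    by apply: eq_bigr => i _; rewrite mxE sqrrN.
  rewrite -NE; apply: le_trans CS; rewrite le_eqVlt; apply/orP; left; apply/eqP.
  rewrite -sumrN; apply: eq_bigr => i _.
  rewrite -mulN1r -(RintegralZl (-1) mQ (L2M mQ (ge2 i) (rrho i).1)).
  apply: eq_Rintegral => z _.
  have NV : (- vdt Om T r_d z) 0 i = - rho i z by rewrite mxE.
  have HH (a b : R) : -1 * (a * b) = - b * a by ring.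
  by rewrite NV; exact: HH.
have E : \int[nu]_(z in Q) (dt Om T e z * dt Om T e z) = B ^+ 2.
  by rewrite /B L2norm_sqr; apply: eq_Rintegral => z _; rewrite expr2.
rewrite E; apply: lerD => //; exact: lerB.
Qed.
End error_energy.

Theorem corollary2 (R : realType) (d : nat) (hd : (1 <= d <= 3)%N)
    (Om : set 'rV[R]_d) (hOm : bounded_lipschitz_domain Om)
    (T : R) (hT : 0 < T)
    (CF : R) (hCF : friedrichs_constant Om T CF)
    (theta h : R) (htheta : 0 < theta) (hh : 0 < h)
    (f u v : 'rV[R]_d * measurableTypeR R -> R)
    (y : 'rV[R]_d * measurableTypeR R -> 'rV[R]_d)
    (hf : L2Q Om T f) (hu : heat_solution Om T f u)
    (hv : V_grad_dt Om T v) (hy : H_div_x_1 Om T y) :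
  let delta := theta * h in
  let e := fun z => u z - v z in
  let r_eq := fun z => f z - dt Om T v z + div_x Om T y z in
  let r_d := fun z => y z - grad_x Om T v z in
  let majorant := fun beta1 beta2 : R =>
    2 * delta * vnorm_end Om T r_d ^+ 2
    + (1 + beta1) * ((1 + beta2) * vnormQ Om T r_d ^+ 2
                     + (1 + 1 / beta2) * CF ^+ 2 * normQ Om T r_eq ^+ 2)
    + (1 + 1 / beta1) * delta ^+ 2 * vnormQ Om T (vdt Om T r_d) ^+ 2
    + delta * normQ Om T r_eq ^+ 2 in
  let beta2s := CF * normQ Om T r_eq / vnormQ Om T r_d in
  let root := Num.sqrt
    ((1 + beta2s) * vnormQ Om T r_d ^+ 2
     + (1 + 1 / beta2s) * CF ^+ 2 * normQ Om T r_eq ^+ 2) in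
  let beta1s := delta * vnormQ Om T (vdt Om T r_d) / root in
  [/\ forall zeta eps beta1 beta2 : R,
        1 / 2 <= zeta -> 1 <= eps -> 0 < beta1 -> 0 < beta2 ->
        (2 - 1 / zeta) * (vnormQ Om T (grad_x Om T e) ^+ 2
                          + delta * normQ Om T (dt Om T e) ^+ 2)
        + delta * (1 - 1 / eps) * vnorm_end Om T (grad_x Om T e) ^+ 2
        + norm_end Om T e ^+ 2
        <= eps * delta * vnorm_end Om T r_d ^+ 2
           + zeta * ((1 + beta1)
                       * ((1 + beta2) * vnormQ Om T r_d ^+ 2
                          + (1 + 1 / beta2) * CF ^+ 2 * normQ Om T r_eq ^+ 2)
                     + (1 + 1 / beta1) * delta ^+ 2
                       * vnormQ Om T (vdt Om T r_d) ^+ 2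
                     + delta * normQ Om T r_eq ^+ 2),
      forall beta1 beta2 : R, 0 < beta1 -> 0 < beta2 ->
        vnormQ Om T (grad_x Om T e) ^+ 2
        + delta * normQ Om T (dt Om T e) ^+ 2
        + norm_end Om T e ^+ 2
        + delta / 2 * vnorm_end Om T (grad_x Om T e) ^+ 2
        <= majorant beta1 beta2 &
      vnormQ Om T r_d != 0 -> root != 0 -> 0 < beta1s -> 0 < beta2s ->
      forall beta1 beta2 : R, 0 < beta1 -> 0 < beta2 ->
        (forall b1 b2 : R, 0 < b1 -> 0 < b2 ->
           majorant beta1 beta2 <= majorant b1 b2)
        <-> beta1 = beta1s /\ beta2 = beta2s].
Proof.
move=> delta e r_eq r_d majorant beta2s root beta1s.
have [oOm _ _ bOm _] := hOm.
have d0 : 0 < delta by exact: mulr_gt0.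
have CF0 : 0 < CF by case: hCF.
have [hE h1 h2] := error_energy oOm bOm hT hf hu hv hy.
have part1 zeta eps beta1 beta2 : 1 / 2 <= zeta -> 1 <= eps -> 0 < beta1 -> 0 < beta2 -> _ :=
  fun z0 e1 b10 b20 => error_majorant (sqrtr_ge0 _) (sqrtr_ge0 _) (sqrtr_ge0 _) CF0 d0
    (lt_le_trans (divr_gt0 ltr01 (ltr0n R 2)) z0) b10 b20 h1 (hE _ hCF) (h2 eps e1).
split; first exact: part1.
- move=> beta1 beta2 b10 b20.
  have z2 : 1 / 2 <= 1 :> R by rewrite ler_pdivrMr// mul1r ler1n.
  have e2 : 1 <= 2 :> R by rewrite ler1n.
  have := part1 1 2 beta1 beta2 z2 e2 b10 b20.
  have regroup (a b k g n r p1 p2 p3 : R) :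
      (2 - 1 / 1) * (a + b) + k * (1 - 1 / 2) * g + n <= r + 1 * (p1 + p2 + p3) ->
      a + b + n + k / 2 * g <= r + p1 + p2 + p3.
    have -> : (2 - 1 / 1) * (a + b) + k * (1 - 1 / 2) * g + n = a + b + n + k / 2 * g by field.
    by rewrite mul1r !addrA.
  exact: regroup.
move=> rd0 root0 s10 s20 beta1 beta2 b10 b20.
pose a := vnormQ Om T r_d; pose c := CF * normQ Om T r_eq.
pose b := delta * vnormQ Om T (vdt Om T r_d).
have a0 : 0 < a by rewrite lt_def rd0 sqrtr_ge0.
have c0 : 0 < c by move: s20; rewrite /beta2s pmulr_lgt0// invr_gt0.
(* the radicand at [beta2s] is the square of [a + c] *)
have rootE : root = a + c.
  have ac0 : 0 <= a + c by rewrite addr_ge0// ltW.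
  rewrite -[RHS]ger0_norm// -sqrtr_sqr /root; congr Num.sqrt.
  have -> : (1 + 1 / beta2s) * CF ^+ 2 * normQ Om T r_eq ^+ 2 = (1 + 1 / beta2s) * c ^+ 2.
    have HH (k l n : R) : k * l ^+ 2 * n ^+ 2 = k * (l * n) ^+ 2 by ring.
    exact: HH.
  rewrite /beta2s -/a -/c; move: a c a0 c0 {ac0} => a' c' a0' c0'.
  by field; rewrite !gt_eqF.
have b0 : 0 < b.
  by move: s10; rewrite /beta1s rootE pmulr_lgt0// invr_gt0 addr_gt0.
have mE x z : majorant x z = 2 * delta * vnorm_end Om T r_d ^+ 2
    + (1 + x) * ((1 + z) * a ^+ 2 + (1 + 1 / z) * c ^+ 2) + (1 + 1 / x) * b ^+ 2
    + delta * normQ Om T r_eq ^+ 2.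
  have HH (q p k l n w t r : R) :
      q + (1 + x) * (p + k * l ^+ 2 * n ^+ 2) + t * w ^+ 2 * r ^+ 2 + delta * n ^+ 2 =
      q + (1 + x) * (p + k * (l * n) ^+ 2) + t * (w * r) ^+ 2 + delta * n ^+ 2 by ring.
  exact: HH.
have := majorant_minimizer (2 * delta * vnorm_end Om T r_d ^+ 2)
  (delta * normQ Om T r_eq ^+ 2) a0 b0 c0 b10 b20.
rewrite /beta1s rootE -/b -/c -/a /beta2s -/c -/a => H.
apply: iff_trans H; split=> H x z x0 z0; first by rewrite -!mE; exact: H.
by rewrite !mE; exact: H.
Qed.
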